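(* For any integer $S\ge 3$, $$\rho^{ex}_S=\frac{\tan\frac{\pi}{S}-\frac{\pi}{S}}{S\tan\frac{\pi}{S}},$$ and the plane convex bodies in the class $\{S\}$ with maximal external robustness (that is, those $K\in\{S\}$ with $\rho^{ex}(K,G)=\rho^{ex}_S$, $G$ being the center of gravity of $K$) are the regular $S$-gons.
   Context: A convex body is a compact convex set with nonempty interior. $\mathcal K_2$ denotes the family of convex bodies in $\mathbb R^2$ with piecewise smooth ($C^\infty$) boundary. Let $K\in\mathcal K_2$ and $p\in\operatorname{int}K$. A point $q\in\operatorname{bd}K$ is an equilibrium point of $K$ with respect to $p$ if the line through $q$ perpendicular to $q-p$ supports $K$ (at a smooth boundary point this means that $q$ is a critical point of $z\mapsto|z-p|$, $z\in\operatorname{bd}K$). The equilibrium point $q$ is nondegenerate if: when $\operatorname{bd}K$ is smooth at $q$, the second derivative of $z\mapsto|z-p|$, $z\in\operatorname{bd}K$, at $q$ is not zero; when $\operatorname{bd}K$ is not smooth at $q$, both angles between $p-q$ and the two one-sided tangent half lines of $\operatorname{bd}K$ at $q$ are acute. A nondegenerate equilibrium point at a smooth boundary point is stable (resp. unstable) if that second derivative is positive (resp. negative); a nondegenerate equilibrium point at a nonsmooth boundary point is unstable. Standing assumption: all bodies considered have only nondegenerate equilibrium points with respect to the reference point in question. If $K$ has $S$ stable points with respect to $p$, let $\mathcal F_{<}(K,p)$ be the family of convex bodies $K'\in\mathcal K_2$ with $K'\subseteq K$, $p\in\operatorname{int}K'$, having strictly fewer than $S$ stable points with respect to $p$. The (downward)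 external robustness of $K$ with respect to $p$ is $$\rho^{ex}(K,p)=\frac{\inf\{\operatorname{area}(K\setminus K'):K'\in\mathcal F_{<}(K,p)\}}{\operatorname{area}(K)}.$$ $\{S\}$ denotes the family of $K\in\mathcal K_2$ having $S$ stable points with respect to their own center of gravity (with uniform density), and $\rho^{ex}_S=\sup\{\rho^{ex}(K,G):K\in\{S\}\}$, where $G$ is the center of gravity of $K$. *)

(* Defs.v *)
From HB Require Import structures.
From mathcomp Require Import all_boot all_order all_algebra.
From mathcomp Require Import all_classical all_reals all_analysis.

Set Implicit Arguments.
Unset Strict Implicit.
Unset Printing Implicit Defensive.

Import Order.TTheory GRing.Theory Num.Theory.
Import numFieldNormedType.Exports.

Local Open Scope ring_scope.
Local Open Scope classical_set_scope.

(* The plane is [R * R].  Its library norm is the sup norm, which is used only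
   through the topology, derivatives and convexity; Euclidean notions are
   introduced here. *)
Section Plane.
Variable R : realType.
Implicit Types (u v p q z : R * R) (K A : set (R * R)).

Definition dot u v : R := u.1 * v.1 + u.2 * v.2.

Definition enorm u : R := Num.sqrt (dot u u).

Definition edist p q : R := enorm (p - q).

(* Unoriented angle in [0, pi], meaningful for nonzero vectors. *)
Definition angle u v : R := acos (dot u v / (enorm u * enorm v)).

Definition acute u v : Prop := angle u v < pi / 2.

Definition boundary A : set (R * R) := closure A `\` A°.

Definition plane_measure : set (R * R) -> \bar R :=
  (@lebesgue_measure R \x @lebesgue_measure R)%E.

Definition area A : R := fine (plane_measure A).

Definition centroid K : R * R :=
  ((\int[plane_measure]_(z in K) z.1) / area K,
   (\int[plane_measure]_(z in K) z.2) / area K).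

Definition convex_body K : Prop :=
  [/\ compact K, convex_set K & K° !=set0].

Definition smooth_curve (g : R -> R * R) : Prop :=
  forall (n : nat) (t : R), derivable (g^`(n)) t 1.

(* The boundary is a simple closed curve made of finitely many regular smooth
   arcs.  An arc is smooth on the closed parameter interval when it is the
   restriction of a curve that is smooth on the whole line. *)
Definition piecewise_smooth_boundary K : Prop :=
  exists (gamma : R -> R * R) (N : nat) (t : nat -> R),
    [/\ (0 < N)%N,
        (forall i, (i < N)%N ->
          t i < t i.+1 /\
          exists g : R -> R * R, smooth_curve g /\
            forall s, t i <= s <= t i.+1 -> g s = gamma s /\ g^`() s != 0),
        gamma (t N) = gamma (t 0%N),
        {in `[t 0%N, t N[ &, injective gamma} &
        gamma @` `[t 0%N, t N] = boundary K].

Definition ps_convex_body K : Prop :=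
  convex_body K /\ piecewise_smooth_boundary K.

(* [n] is a normal vector of the line through [q]. *)
Definition supporting_line K q (n : R * R) : Prop :=
  K q /\ ((forall z, K z -> dot (z - q) n <= 0) \/
          (forall z, K z -> 0 <= dot (z - q) n)).

Definition equilibrium K p q : Prop :=
  boundary K q /\ supporting_line K q (q - p).

(* [g], restricted to a small interval around 0, is a regular smooth
   parametrization of a neighbourhood of [q] in the boundary of [K]. *)
Definition boundary_chart K q (g : R -> R * R) : Prop :=
  [/\ smooth_curve g, g 0 = q &
      exists2 e : R, 0 < e &
        [/\ forall t : R, - e < t < e -> g^`() t != 0,
            {in `]- e, e[ &, injective g} &
            exists2 U : set (R * R), open U & U q /\
              g @` `]- e, e[ = boundary K `&` U]].

(* The boundary is a C^oo curve near q.  A point where two smooth arcs meet with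
   a common tangent but without being jointly C^oo counts as nonsmooth. *)
Definition smooth_point K q : Prop := exists g, boundary_chart K q g.

(* Second derivative of the distance to [p] in a boundary chart.  At an
   equilibrium point the first derivative vanishes, so a change of chart
   multiplies this number by a positive factor: its sign does not depend on
   the chart. *)
Definition dist_deriv2 p (g : R -> R * R) : R :=
  ((fun t : R => edist (g t) p)^`(2))%classic 0.

(* [u] spans a one-sided tangent half line of the boundary of [K] at [q]: it is
   the initial velocity of a regular smooth arc of the boundary issued from [q].
   On a piecewise smooth boundary there are exactly two such half lines. *)
Definition tangent_direction K q u : Prop :=
  u != 0 /\
  exists g : R -> R * R,
    [/\ smooth_curve g, g 0 = q, g^`() 0 = u &
        exists2 e : R, 0 < e & forall t : R, 0 <= t < e -> boundary K (g t)].

Definition nondegenerate K p q : Prop :=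
  (smooth_point K q ->
     exists2 g, boundary_chart K q g & dist_deriv2 p g != 0) /\
  (~ smooth_point K q ->
     forall u, tangent_direction K q u -> acute (p - q) u).

Definition only_nondegenerate K p : Prop :=
  forall q, equilibrium K p q -> nondegenerate K p q.

(* Nondegenerate equilibria at nonsmooth boundary points are unstable, so a
   stable point always admits a boundary chart. *)
Definition stable K p q : Prop :=
  equilibrium K p q /\
  exists2 g, boundary_chart K q g & 0 < dist_deriv2 p g.

Definition has_stable_points K p (S : nat) : Prop :=
  ([set q | stable K p q] #= `I_S)%card.

Definition fewer_stable K p : set (set (R * R)) :=
  [set K' | [/\ ps_convex_body K', K' `<=` K, K'° p, only_nondegenerate K' p &
     exists S S' : nat,
       [/\ has_stable_points K p S, has_stable_points K' p S' & (S' < S)%N]]].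

(* The infimum is that of a set of nonnegative reals, nonempty as soon as [K]
   has at least 3 stable points: a small ellipse around [p] has only 2. *)
Definition ext_robustness K p : R :=
  inf [set area (K `\` K') | K' in fewer_stable K p] / area K.

Definition stable_class (S : nat) : set (set (R * R)) :=
  [set K | [/\ ps_convex_body K, only_nondegenerate K (centroid K) &
               has_stable_points K (centroid K) S]].

(* For [3 <= S] the supremum is that of a nonempty set of reals in [0, 1]. *)
Definition max_ext_robustness (S : nat) : R :=
  sup [set ext_robustness K (centroid K) | K in stable_class S].

Definition convex_hull n (v : 'I_n -> R * R) : set (R * R) :=
  [set z | exists w : 'I_n -> R,
     [/\ forall i, 0 <= w i, \sum_(i < n) w i = 1 &
         z = \sum_(i < n) w i *: v i]].

Definition regular_vertex (n : nat) (c : R * R) (r phi : R) (k : 'I_n) : R * R :=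
  let theta := phi + k%:R * (2 * pi / n%:R) in
  c + (r * cos theta, r * sin theta).

Definition regular_polygon (n : nat) : set (set (R * R)) :=
  [set K | exists (c : R * R) (r phi : R),
     0 < r /\ K = convex_hull (regular_vertex (n := n) c r phi)].

End Plane.

(* Main.v *)
(* Let rho be the radial function of a convex body K about an interior point p.
   Stable points of K are the strict local minima of rho, and rho is unimodal
   between two consecutive ones, at angles u and v.  Cutting off the part of K
   over [u, v] outside the disc of radius max (rho u) (rho v) removes one
   minimum; the hull of suitable samples of the resulting star-shaped profile is
   a polygon inside K, arbitrarily close to that profile, with fewer stable
   points.  The lines supporting K at the two stable points bound the area of K
   over [u, v] from below by gain x times the area cut off, where
   x = (v - u) / 2 and gain x = sin x / (sin x - x cos x).  As gain is strictly
   convex on (0, pi) and the half angles x add up to pi, some cut has area at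
   most area K / (S gain (pi / S)), and equality forces K to be a regular S-gon.
   Conversely, if a body inside a regular S-gon leaves out an area smaller than
   that of the tip beyond the incircle at one vertex, its radial function exceeds
   the inradius near each of the S vertices but not at the edge midpoints, hence
   it has at least S stable points. *)

(* Competitors must be piecewise smooth convex bodies with only nondegenerate equilibria, and a
   truncated profile need not even be convex. Polygons are used because their equilibria are easy to
   control: one that is not a vertex lies inside an edge and is stable, and one at a vertex is
   nondegenerate as soon as all other vertices lie strictly below its perpendicular. Samples taken
   on the profile itself would all be equilibria wherever it follows a circle; hence their radii are
   damped geometrically away from each peak, by a total factor that tends to 1 as the samples get
   denser.

   Stable points are counted only through extrema of the radial function, from above by the maxima
   that separate them and from below by dips between higher values, so one-sided estimates suffice
   on both sides.

   In the extremal sector both stable radii are equal, to [r] say, and the body is a kite of area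
   [r ^+ 2 * tan x] about a circular sector of area [r ^+ 2 * x]; this is the origin of [gain]. *)
Require Import Defs.
From mathcomp Require Import all_boot all_order all_algebra.
From mathcomp Require Import all_classical all_reals all_analysis.
From mathcomp Require Import measurable_realfun ring lra zify.
Import Defs.

Set Implicit Arguments.
Unset Strict Implicit.
Unset Printing Implicit Defensive.

Import Order.TTheory GRing.Theory Num.Theory.
Import numFieldNormedType.Exports.

Local Open Scope ring_scope.
Local Open Scope classical_set_scope.

(* [lra] parses the whole context, which is slow when most hypotheses are not
   inequalities; they are discarded first. *)
Ltac discard_irrelevant := repeat match goal with
  | x := _ |- _ => clearbody x
  | H : ?T |- _ =>
    lazymatch T with
    | is_true (_ <= _) => fail
    | is_true (_ < _) => fail
    | is_true (_ && _) => fail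
    | _ = _ => fail
    | _ /\ _ => fail
    | _ => lazymatch type of T with Prop => clear H end
    end
  end.
Ltac slra := solve [discard_irrelevant; lra | lra].
Ltac snra := solve [discard_irrelevant; nra | nra].

(** * Polar coordinates and the radial function *)

Section Polar.
Variable R : realType.
Implicit Types (p q z a b : R * R) (s t u : R) (K : set (R * R)).

Definition pol p s t : R * R := (p.1 + s * cos t, p.2 + s * sin t).

(** The parameter is an arbitrary real, unlike the weight of the library's convex combinations:
    negative values run past [a] away from [b], as [locmin_supports] requires. *)
Definition seg a b t : R * R :=
  (a.1 + t * (b.1 - a.1), a.2 + t * (b.2 - a.2)).

Lemma nbhs_boxP q (A : set (R * R)) : nbhs q A <->
  exists2 e : R, 0 < e &
    forall z, `|z.1 - q.1| < e -> `|z.2 - q.2| < e -> A z.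
Proof.
split => [/nbhs_ballP[e e0 H]|[e e0 H]]; [|apply/nbhs_ballP]; exists e => //.
  by move=> z z1 z2; apply: H; split; rewrite -ball_normE /= distrC.
move=> z [z1 z2]; apply: H; rewrite distrC.
  by move: z1; rewrite -ball_normE.
by move: z2; rewrite -ball_normE.
Qed.

Lemma convex_set_seg K a b t :
  convex_set K -> K a -> K b -> 0 <= t <= 1 -> K (seg a b t).
Proof.
move=> Kc Ka Kb /andP[t0 t1].
have := Kc b a (Itv01 t0 t1) (mem_set Kb) (mem_set Ka).
rewrite inE; congr (K _).
by rewrite /conv /seg /=; congr pair; rewrite /= /GRing.scale /= /unstable.onem; ring.
Qed.

Lemma seg_convex_set K :
  (forall a b t, K a -> K b -> 0 <= t <= 1 -> K (seg a b t)) -> convex_set K.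
Proof.
move=> H a b l; rewrite !inE => Ka Kb.
have := H b a l%:num Kb Ka; rewrite ge0 le1 => /(_ isT); congr (K _).
by rewrite /conv /seg /=; congr pair; rewrite /= /GRing.scale /= /unstable.onem; ring.
Qed.

Lemma cos_lt1 u : 0 < u < 2 * pi -> cos u < 1.
Proof.
move=> /andP[u0 u1]; have -> : u = (u / 2) *+ 2.
  by rewrite mulr2n; field.
rewrite cos_mulr2n cos2sin2.
have : 0 < sin (u / 2) by apply: sin_gt0_pi; slra.
by move=> /(exprn_gt0 2); slra.
Qed.

Lemma cos_eq1 u : `|u| < 2 * pi -> cos u = 1 -> u = 0.
Proof.
move=> u2 cu; apply/eqP; rewrite -normr_eq0; apply/negPn/negP => un0.
have : cos `|u| < 1 by apply: cos_lt1; rewrite u2 lt_neqAle eq_sym un0 normr_ge0.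
by rewrite cos_norm cu ltxx.
Qed.

Lemma unit_circle_angle (x y : R) : x ^+ 2 + y ^+ 2 = 1 ->
  exists2 t, 0 <= t < 2 * pi & cos t = x /\ sin t = y.
Proof.
move=> xy; have pi0 := @pi_gt0 R.
have x1 : -1 <= x <= 1 by apply/andP; split; snra.
have sa : sin (acos x) = `|y|.
  rewrite sin_acos // -sqrtr_sqr; congr Num.sqrt; slra.
have := acos_ge0 x1; have := acos_lepi x1; move=> h1 h0.
have [y0|y0] := leP 0 y.
  exists (acos x); first by slra.
  by rewrite sa acosK ?in_itv //= ger0_norm.
exists (2 * pi - acos x).
  suff : 0 < acos x by slra.
  apply: acos_gt0; rewrite lt_neqAle; case/andP: x1 => -> ->.
  by rewrite andbT; apply/eqP => x1; move: xy; rewrite x1; snra.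
have -> : 2 * pi - acos x = - acos x + pi *+ 2 by rewrite mulr2n; ring.
by rewrite cosD2pi sinD2pi cosN sinN sa acosK ?in_itv // ltr0_norm // opprK.
Qed.

Lemma polar_exists p z (a : R) :
  exists t s, [/\ a <= t < a + 2 * pi, 0 <= s & z = pol p s t].
Proof.
set x := z.1 - p.1; set y := z.2 - p.2; have pi0 := @pi_gt0 R.
set s := Num.sqrt (x ^+ 2 + y ^+ 2).
have [s0|s0] := eqVneq s 0.
  exists a, 0; split => //; first by slra.
  move/eqP: s0; rewrite sqrtr_eq0 => h.
  have [x0 y0] : x = 0 /\ y = 0 by split; snra.
  rewrite /pol !mul0r !addr0 [z]surjective_pairing.
  by congr pair; apply/eqP; rewrite -subr_eq0; apply/eqP.
have ss : s ^+ 2 = x ^+ 2 + y ^+ 2 by rewrite sqr_sqrtr // addr_ge0 ?sqr_ge0.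
(* Coordinates in the frame rotated by [a]: an angle in [0, 2 pi) there becomes one in the window
   that starts at [a]. *)
have [] := @unit_circle_angle ((x * cos a + y * sin a) / s)
                           ((y * cos a - x * sin a) / s).
  have cs := cos2Dsin2 a.
  rewrite !expr_div_n -mulrDl ss.
  have -> : (x * cos a + y * sin a) ^+ 2 + (y * cos a - x * sin a) ^+ 2 =
     (x ^+ 2 + y ^+ 2) * (cos a ^+ 2 + sin a ^+ 2) by ring.
  by rewrite cs mulr1 divff // -ss expf_neq0.
move=> t t2 [ct st]; exists (a + t), s; split; first by slra.
  exact: sqrtr_ge0.
rewrite /pol cosD sinD ct st [z]surjective_pairing.
have cs := cos2Dsin2 a.
have zx : z.1 = p.1 + x by rewrite /x; ring.
have zy : z.2 = p.2 + y by rewrite /y; ring.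
congr pair => /=; [rewrite zx | rewrite zy]; congr (_ + _).
  transitivity (x * (cos a ^+ 2 + sin a ^+ 2)); first by rewrite cs mulr1.
  by field.
transitivity (y * (cos a ^+ 2 + sin a ^+ 2)); first by rewrite cs mulr1.
by field.
Qed.

Lemma pol_inj p s s' t t' : 0 < s -> 0 < s' -> `|t - t'| < 2 * pi ->
  pol p s t = pol p s' t' -> s = s' /\ t = t'.
Proof.
move=> s0 s'0 tt [/addrI e1 /addrI e2].
have cs := cos2Dsin2 t; have cs' := cos2Dsin2 t'.
have ss : s ^+ 2 = s' ^+ 2.
  rewrite -[LHS]mulr1 -[RHS]mulr1 -{1}cs -cs' !mulrDr -!exprMn.
  by rewrite e1 e2.
have {}ss : s = s' by apply: (pexpIrn (n := 2)) => //; rewrite nnegrE ltW.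
subst s'; split => //.
have /mulfI h : s != 0 by rewrite gt_eqF.
move: e1 e2 => /h e1 /h e2.
by apply/eqP; rewrite -subr_eq0; apply/eqP/cos_eq1; rewrite // cosB e1 e2; slra.
Qed.

Lemma pol_2pi p s t : pol p s (t + 2 * pi) = pol p s t.
Proof.
by rewrite /pol (_ : 2 * pi = pi *+ 2) ?cosD2pi ?sinD2pi // mulr2n; ring.
Qed.

Lemma dot_pol p s t r u :
  dot (pol p s t - p) (pol p r u - p) = s * r * cos (t - u).
Proof. by rewrite /dot /pol /= cosB; ring. Qed.

Lemma sin_atan (x : R) : sin (atan x) = x / Num.sqrt (1 + x ^+ 2).
Proof.
have c0 : cos (atan x) != 0.
  rewrite cos_atan invr_eq0 gt_eqF // sqrtr_gt0.
  by rewrite ltr_pwDl // sqr_ge0.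
by rewrite -cos_atan -{2}(atanK x) /tan divfK.
Qed.

(** An explicit continuous inverse of [pol] near the point: in the frame rotated by [t], with
    coordinates [X] and [Y], the angle is [t + atan (Y / X)] as long as [X] is positive. *)
Lemma pol_near p s t e : 0 < s -> 0 < e ->
  \forall z \near pol p s t, exists t' s',
    [/\ `|t' - t| < e, `|s' - s| < e, 0 < s' & z = pol p s' t'].
Proof.
move=> s0 e0.
pose X z := (z.1 - p.1) * cos t + (z.2 - p.2) * sin t.
pose Y z := (z.2 - p.2) * cos t - (z.1 - p.1) * sin t.
pose th z := t + atan (Y z / X z).
pose sg z := Num.sqrt (X z * X z + Y z * Y z).
have cs := cos2Dsin2 t.
have Xq : X (pol p s t) = s.
  rewrite /X /pol /=; transitivity (s * (cos t ^+ 2 + sin t ^+ 2)); first by ring.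
  by rewrite cs mulr1.
have Yq : Y (pol p s t) = 0 by rewrite /Y /pol /=; ring.
have c1 z : {for z, continuous (fun z : R * R => z.1)} by exact: cvg_fst.
have c2 z : {for z, continuous (fun z : R * R => z.2)} by exact: cvg_snd.
have cX : {for pol p s t, continuous X}.
  by apply: cvgD; apply: cvgMr_tmp; apply: cvgB; (exact: c1 || exact: c2 || exact: cvg_cst).
have cY : {for pol p s t, continuous Y}.
  by apply: cvgB; apply: cvgMr_tmp; apply: cvgB; (exact: c1 || exact: c2 || exact: cvg_cst).
have cT : th z @[z --> pol p s t] --> t.
  rewrite -[X in _ --> X]addr0; apply: cvgD; first exact: cvg_cst.
  have h : Y z / X z @[z --> pol p s t] --> (0 : R).
    have := cvgM cY (cvgV _ cX); rewrite Xq Yq mul0r; apply.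
    by rewrite gt_eqF.
  have := @continuous_atan R 0; rewrite /prop_for /continuous_at atan0 => ca.
  exact: cvg_comp h ca.
have cS : sg z @[z --> pol p s t] --> s.
  have h : X z * X z + Y z * Y z @[z --> pol p s t] --> s ^+ 2.
    have := cvgD (cvgM cX cX) (cvgM cY cY).
    by rewrite Xq Yq mul0r addr0; apply.
  have := @sqrt_continuous R (s ^+ 2).
  rewrite /continuous_at sqrtr_sqr gtr0_norm // => ca.
  exact: cvg_comp h ca.
have X0 : \forall z \near pol p s t, 0 < X z.
  by move: cX; rewrite /prop_for /continuous_at Xq => /cvgr_gt; exact.
near=> z.
have Xz : 0 < X z by near: z.
have sz : 0 < sg z by rewrite sqrtr_gt0 ltr_pwDl ?mulr_gt0 // -expr2 sqr_ge0.
exists (th z), (sg z); split => //.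
- by rewrite distrC; near: z; move/cvgrPdist_lt: cT; exact.
- by rewrite distrC; near: z; move/cvgrPdist_lt: cS; exact.
have sqE : Num.sqrt (1 + (Y z / X z) ^+ 2) = sg z / X z.
  rewrite -[in RHS](gtr0_norm Xz) -[in RHS]sqrtr_sqr -sqrtrV ?sqr_ge0 //.
  rewrite -sqrtrM ?addr_ge0 ?sqr_ge0 //; congr Num.sqrt.
  by field; rewrite gt_eqF.
have cE : cos (atan (Y z / X z)) = X z / sg z.
  by rewrite cos_atan sqE invf_div.
have sE : sin (atan (Y z / X z)) = Y z / sg z.
  by rewrite sin_atan sqE; field; rewrite !gt_eqF.
rewrite /pol /th cosD sinD cE sE [z in LHS]surjective_pairing; congr pair.
  transitivity (p.1 + (z.1 - p.1) * (cos t ^+ 2 + sin t ^+ 2)).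
    by rewrite cs; ring.
  by rewrite /X /Y; field; rewrite gt_eqF.
transitivity (p.2 + (z.2 - p.2) * (cos t ^+ 2 + sin t ^+ 2)).
  by rewrite cs; ring.
by rewrite /X /Y; field; rewrite gt_eqF.
Unshelve. all: by end_near. Qed.

Lemma continuous_pair (T : topologicalType) (f g : T -> R) :
  continuous f -> continuous g -> continuous (fun x => (f x, g x)).
Proof. by move=> cf cg x; exact: (cvg_pair (cf x) (cg x)). Qed.

Lemma continuous_pol (T : topologicalType) p (f g : T -> R) :
  continuous f -> continuous g -> continuous (fun x => pol p (f x) (g x)).
Proof.
move=> cf cg; apply: continuous_pair => x.
  apply: cvgD; first exact: cvg_cst.
  apply: cvgM; first exact: cf.
  by apply: continuous_comp; [exact: cg|exact: continuous_cos].
apply: cvgD; first exact: cvg_cst.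
apply: cvgM; first exact: cf.
by apply: continuous_comp; [exact: cg|exact: continuous_sin].
Qed.

End Polar.

Section Radial.
Variable R : realType.
Implicit Types (p q z a b : R * R) (s t u : R).

Definition rad (K : set (R * R)) p t : R := sup [set s | 0 <= s /\ K (pol p s t)].

Lemma rad_2pi (K : set (R * R)) p t : rad K p (t + 2 * pi) = rad K p t.
Proof.
by rewrite /rad; congr sup; apply/seteqP; split => s /=; rewrite pol_2pi.
Qed.

Variables (K : set (R * R)) (p : R * R).
Hypotheses (Kb : convex_body K) (pK : K° p).

Lemma body_closed : closed K.
Proof. by case: Kb => cK _ _; exact: compact_closed (@norm_hausdorff _ _) cK. Qed.

Lemma body_seg a b t : K a -> K b -> 0 <= t <= 1 -> K (seg a b t).
Proof. by case: Kb => _ cK _; exact: convex_set_seg. Qed.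

Lemma body_bounded : exists M : R, forall s t, 0 <= s -> K (pol p s t) -> s <= M.
Proof.
case: Kb => /compact_bounded[M [_ HM]] _ _.
have {}HM := HM (M + 1) ltac:(slra).
exists ((M + 1) + `|p.1| + ((M + 1) + `|p.2|)) => s t s0 Kz.
have := HM _ Kz; rewrite /= prod_normE /= ge_max => /andP[z1 z2].
have h1 : `|s * cos t| <= (M + 1) + `|p.1|.
  have -> : s * cos t = (p.1 + s * cos t) - p.1 by ring.
  by rewrite (le_trans (ler_normB _ _)) // lerD2r.
have h2 : `|s * sin t| <= (M + 1) + `|p.2|.
  have -> : s * sin t = (p.2 + s * sin t) - p.2 by ring.
  by rewrite (le_trans (ler_normB _ _)) // lerD2r.
have cs := cos2Dsin2 t.
have -> : s = s * cos t * cos t + s * sin t * sin t.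
  by rewrite -{1}(mulr1 s) -cs; ring.
apply: lerD; apply: le_trans (ler_norm _) _; rewrite normrM.
  apply: le_trans h1; rewrite -[leRHS]mulr1 ler_wpM2l //; exact: cos_max.
apply: le_trans h2; rewrite -[leRHS]mulr1 ler_wpM2l //; exact: sin_max.
Qed.

Lemma polB p' s t : (pol p' s t).1 - p'.1 = s * cos t /\
  (pol p' s t).2 - p'.2 = s * sin t.
Proof. by rewrite /pol /=; split; ring. Qed.

Lemma interior_pol q : K° q -> exists2 r : R, 0 < r &
  forall s t, `|s| < r -> K (pol q s t).
Proof.
move=> /nbhs_boxP[e e0 H]; exists e => // s t sr.
have [h1 h2] := polB q s t.
apply: H; rewrite ?h1 ?h2 normrM; apply: le_lt_trans sr.
  by rewrite -[leRHS]mulr1 ler_wpM2l //; exact: cos_max.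
by rewrite -[leRHS]mulr1 ler_wpM2l //; exact: sin_max.
Qed.

Lemma Kp : K p.
Proof. exact: interior_subset. Qed.

Let A t := [set s | 0 <= s /\ K (pol p s t)].

Let hasA t : has_sup (A t).
Proof.
split.
  exists 0; split => //; rewrite /pol !mul0r !addr0 -surjective_pairing.
  exact: Kp.
by have [M HM] := body_bounded; exists M => s [s0]; exact: HM.
Qed.

Lemma seg_pol s s' t : s' != 0 -> seg p (pol p s' t) (s / s') = pol p s t.
Proof. by move=> s0; rewrite /seg /pol /=; congr pair; field. Qed.

Lemma rad_ge s t : 0 <= s -> K (pol p s t) -> s <= rad K p t.
Proof. by move=> s0 Ks; apply: sup_upper_bound => //; exact: hasA. Qed.

Lemma rad_gt0 t : 0 < rad K p t.
Proof.
have [r r0 H] := interior_pol pK.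
have : r / 2 <= rad K p t by apply: rad_ge; [slra|apply: H; rewrite gtr0_norm; slra].
by slra.
Qed.

Lemma lt_rad s t : 0 <= s -> s < rad K p t -> K (pol p s t).
Proof.
move=> s0 sr; have [s' [s'0 Ks'] ss'] := sup_gt (hasA t).1 sr.
have s'p : 0 < s' by apply: le_lt_trans ss'.
rewrite -(@seg_pol s s') ?gt_eqF //; apply: body_seg => //; first exact: Kp.
by rewrite divr_ge0 // ler_pdivrMr // mul1r ltW.
Qed.

Lemma near_notin s t : ~ K (pol p s t) -> \forall u \near t, ~ K (pol p s u).
Proof.
move=> nK; have : nbhs (pol p s t) (~` K).
  by apply: open_nbhs_nbhs; split => //; exact: closed_openC body_closed.
have cp : continuous (fun u : R => pol p s u).
  by apply: continuous_pol; [move=> ?; exact: cvg_cst|move=> ?; exact: cvg_id].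
by move=> /(cp t).
Qed.

Lemma near_notin_r s t : ~ K (pol p s t) -> \forall u \near s, ~ K (pol p u t).
Proof.
move=> nK; have : nbhs (pol p s t) (~` K).
  by apply: open_nbhs_nbhs; split => //; exact: closed_openC body_closed.
have cp : continuous (fun u : R => pol p u t).
  by apply: continuous_pol; [move=> ?; exact: cvg_id|move=> ?; exact: cvg_cst].
by move=> /(cp s).
Qed.

(** Strictly below the radius the point lies on a segment from [p] to a point of [K]; at the radius
    itself, were it outside, closedness would keep out the points just below it too. *)
Lemma in_radP s t : 0 <= s -> K (pol p s t) <-> s <= rad K p t.
Proof.
move=> s0; split; first exact: rad_ge.
rewrite le_eqVlt => /predU1P[->|]; last exact: lt_rad.
apply: contrapT => /near_notin_r/nbhs_ballP[e /= e0 H].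
have r0 := rad_gt0 t.
apply: (H (Num.max (rad K p t - e / 2) (rad K p t / 2))).
  rewrite -ball_normE /= ltr_norml /Num.max; case: ifP => h; slra.
by apply: lt_rad; rewrite /Num.max; case: ifP => h; slra.
Qed.

(** The homothety centred at [b] that maps [a] to [seg a b t] maps a box around [a] to a smaller box
    still inside [K]; [w] is the preimage of [z]. *)
Lemma interior_seg a b t : K° a -> K b -> 0 <= t < 1 -> K° (seg a b t).
Proof.
move=> /nbhs_boxP[e e0 H] Kb' /andP[t0 t1]; apply/nbhs_boxP.
exists (e * (1 - t)); first by rewrite mulr_gt0 // subr_gt0.
move=> z z1 z2.
have t1n : 1 - t != 0 by rewrite gt_eqF // subr_gt0.
pose w : R * R := ((z.1 - t * b.1) / (1 - t), (z.2 - t * b.2) / (1 - t)).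
have -> : z = seg w b t.
  by rewrite /seg /w /= [LHS]surjective_pairing; congr pair; field.
have tp : 0 < 1 - t by rewrite subr_gt0.
apply: body_seg => //; last by rewrite t0 ltW.
apply: H; rewrite /w /=.
  have -> : (z.1 - t * b.1) / (1 - t) - a.1 = (z.1 - (seg a b t).1) / (1 - t).
    by rewrite /seg /=; field.
  by rewrite normrM normfV (gtr0_norm tp) ltr_pdivrMr.
have -> : (z.2 - t * b.2) / (1 - t) - a.2 = (z.2 - (seg a b t).2) / (1 - t).
  by rewrite /seg /=; field.
by rewrite normrM normfV (gtr0_norm tp) ltr_pdivrMr.
Qed.

Lemma interior_radP s t : 0 <= s -> K° (pol p s t) <-> s < rad K p t.
Proof.
move=> s0; split.
  move=> /(@interior_pol _)[r r0 H].
  have : s + r / 2 <= rad K p t.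
    apply: rad_ge; first slra.
    have -> : pol p (s + r / 2) t = pol (pol p s t) (r / 2) t.
      by rewrite /pol /=; congr pair; ring.
    by apply: H; rewrite gtr0_norm; slra.
  by slra.
move=> sr; have r0 := rad_gt0 t.
rewrite -(@seg_pol s (rad K p t)) ?gt_eqF //; apply: interior_seg => //.
  by apply/in_radP => //; exact: ltW.
by rewrite divr_ge0 ?(ltW r0) // ltr_pdivrMr // mul1r.
Qed.

Lemma boundary_radP z : boundary K z <-> exists t, z = pol p (rad K p t) t.
Proof.
rewrite /boundary -(closure_id K).1 ?setDE; last exact: body_closed.
split.
  case=> Kz /= nKz; have [t [s [_ s0 zE]]] := polar_exists p z 0.
  exists t; rewrite zE; congr pol; apply/eqP; rewrite eq_le; apply/andP; split.
    by apply/in_radP => //; rewrite -zE.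
  by rewrite leNgt; apply/negP => /interior_radP; rewrite -zE => /(_ s0).
case=> t ->; have r0 := rad_gt0 t; split.
  by apply/in_radP => //; exact: ltW.
by move=> /interior_radP => /(_ (ltW r0)); rewrite ltxx.
Qed.

Lemma boundary_pol t : boundary K (pol p (rad K p t) t).
Proof. by apply/boundary_radP; exists t. Qed.

(** The radius cannot drop suddenly, because interior points stay in [K] when the ray turns a
    little, nor jump up, because the complement of [K] is open. *)
Lemma rad_continuous : continuous (rad K p).
Proof.
move=> t; apply/cvgrPdist_lt => e e0; have r0 := rad_gt0 t.
pose s1 := Num.max (rad K p t - e / 2) (rad K p t / 2).
have s10 : 0 <= s1 by rewrite /s1 /Num.max; case: ifP => h; slra.
have s1r : s1 < rad K p t by rewrite /s1 /Num.max; case: ifP => h; slra.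
have s1e : rad K p t - e / 2 <= s1 by rewrite /s1 le_max lexx.
have cp : continuous (fun u : R => pol p s1 u).
  by apply: continuous_pol; [move=> ?; exact: cvg_cst|move=> ?; exact: cvg_id].
have N1 : \forall u \near t, K (pol p s1 u).
  by have /interior_radP := s1r; move=> /(_ s10) /(cp t).
have N2 : \forall u \near t, ~ K (pol p (rad K p t + e / 2) u).
  by apply: near_notin => /in_radP h; have := h ltac:(slra); slra.
near=> u.
have h1 : s1 <= rad K p u by apply/in_radP => //; near: u.
have h2 : ~ K (pol p (rad K p t + e / 2) u) by near: u.
have h3 : rad K p u < rad K p t + e / 2.
  by rewrite ltNge; apply/negP => /in_radP h; apply: h2; apply: h; slra.
by rewrite ltr_norml; slra.
Unshelve. all: by end_near. Qed.

End Radial.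

(** * Derivatives of plane curves and of the distance to a point *)

Section Calculus.
Variable R : realType.
Implicit Types (f : R -> R) (g : R -> R * R).

Lemma is_derive_pair g (t : R) (d : R * R) :
  is_derive t 1 g d <->
  is_derive t (1 : R) (fun s => (g s).1) d.1 /\
  is_derive t (1 : R) (fun s => (g s).2) d.2.
Proof.
split=> [[dg <-]|[[d1 d1E] [d2 d2E]]].
  have h : h^-1 *: ((g \o shift t) (h *: (1 : R)) - g t) @[h --> 0^'] --> 'D_1 g t.
    exact: dg.
  split.
    have h1 : h^-1 *: (((fun s => (g s).1) \o shift t) (h *: (1 : R)) - (g t).1)
      @[h --> 0^'] --> ('D_1 g t).1.
      by apply: (@cvg_comp _ _ _ _ fst _ _ _ h); exact: cvg_fst.
    by split; [exact: (cvgP _ h1)|exact: cvg_lim h1].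
  have h1 : h^-1 *: (((fun s => (g s).2) \o shift t) (h *: (1 : R)) - (g t).2)
      @[h --> 0^'] --> ('D_1 g t).2.
    by apply: (@cvg_comp _ _ _ _ snd _ _ _ h); exact: cvg_snd.
  by split; [exact: (cvgP _ h1)|exact: cvg_lim h1].
have h1 : h^-1 *: (((fun s => (g s).1) \o shift t) (h *: (1 : R)) - (g t).1)
      @[h --> 0^'] --> 'D_1 (fun s => (g s).1) t by exact: d1.
have h2 : h^-1 *: (((fun s => (g s).2) \o shift t) (h *: (1 : R)) - (g t).2)
      @[h --> 0^'] --> 'D_1 (fun s => (g s).2) t by exact: d2.
have h : h^-1 *: ((g \o shift t) (h *: (1 : R)) - g t) @[h --> 0^'] -->
   ('D_1 (fun s => (g s).1) t, 'D_1 (fun s => (g s).2) t).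
  exact: (cvg_pair h1 h2).
rewrite [d]surjective_pairing -d1E -d2E.
by split; [exact: (cvgP _ h)|exact: cvg_lim h].
Qed.

Lemma derivable_is_derive1 g (t : R) : derivable g t 1 ->
  is_derive t 1 g (g^`() t).
Proof. by move=> dg; rewrite derive1E; exact: derivableP. Qed.

Lemma smooth_is_derive g n (t : R) : smooth_curve g ->
  is_derive t 1 (g^`(n)) (g^`(n.+1) t).
Proof. by move=> sg; rewrite derive1nS; exact: derivable_is_derive1. Qed.

Lemma is_derive_continuous f (t a : R) : is_derive t 1 f a -> {for t, continuous f}.
Proof.
by move=> [df _]; apply: differentiable_continuous; apply/derivable1_diffP.
Qed.

Lemma is_derive_pair_continuous g (t : R) (a : R * R) :
  is_derive t 1 g a -> {for t, continuous g}.
Proof.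
by move=> [df _]; apply: differentiable_continuous; apply/derivable1_diffP.
Qed.

Lemma is_derive_pos f (a : R) : is_derive (0 : R) 1 f a -> 0 < a ->
  exists2 e : R, 0 < e & forall t, `|t| < e ->
    (0 < t -> f 0 < f t) /\ (t < 0 -> f t < f 0).
Proof.
move=> [df da] a0.
have h : h^-1 *: ((f \o shift 0) (h *: (1 : R)) - f 0) @[h --> 0^'] --> a.
  by rewrite -da; exact: df.
have /nbhs_ballP[e /= e0 H] : \forall h \near (0 : R)^', 0 < h^-1 *: ((f \o shift 0) (h *: (1 : R)) - f 0).
  by move/cvgr_gt: h; exact.
exists e => // t te.
have H1 (t0 : t != 0) : 0 < t^-1 * (f t - f 0).
  have := H t; rewrite -ball_normE /= sub0r normrN => /(_ te t0).
  by rewrite /GRing.scale /= mulr1 addr0.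
split => t0.
  have := H1 ltac:(by rewrite gt_eqF).
  by rewrite pmulr_rgt0 ?invr_gt0 // subr_gt0.
have := H1 ltac:(by rewrite lt_eqF).
by rewrite nmulr_rgt0 ?invr_lt0 // subr_lt0.
Qed.

Lemma is_derive_locmax f (a : R) : is_derive (0 : R) 1 f a ->
  (\forall t \near 0, f t <= f 0) -> a = 0.
Proof.
move=> df /nbhs_ballP[e /= e0 H].
have He t : `|t| < e -> f t <= f 0.
  by move=> te; apply: H; rewrite -ball_normE /= sub0r normrN.
case: (ltgtP a 0) => // a0.
  have dN : is_derive (0 : R) 1 (fun t => - f t) (- a) by exact: is_deriveN.
  have [|d d0 Hd] := is_derive_pos dN; first by rewrite oppr_gt0.
  pose t := Num.min d e / 2.
  have t0 : 0 < t by rewrite /t divr_gt0 // lt_min d0.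
  have td : t < d by rewrite /t; have := ge_min d d e; rewrite lexx /=; slra.
  have te : t < e by rewrite /t; have := ge_min e d e; rewrite lexx orbT; slra.
  have := (Hd (- t) ltac:(by rewrite normrN gtr0_norm)).2 ltac:(by slra).
  by have := He (- t) ltac:(by rewrite normrN gtr0_norm); slra.
have [//|d d0 Hd] := is_derive_pos df.
pose t := Num.min d e / 2.
have t0 : 0 < t by rewrite /t divr_gt0 // lt_min d0.
have td : t < d by rewrite /t; have := ge_min d d e; rewrite lexx /=; slra.
have te : t < e by rewrite /t; have := ge_min e d e; rewrite lexx orbT; slra.
have := (Hd t ltac:(by rewrite gtr0_norm)).1 t0.
by have := He t ltac:(by rewrite gtr0_norm); slra.
Qed.

Lemma strict_min_deriv2 f (f1 : R -> R) (a : R) :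
  (forall t : R, is_derive t 1 f (f1 t)) -> is_derive (0 : R) 1 f1 a ->
  f1 0 = 0 -> 0 < a ->
  exists2 e : R, 0 < e & forall t, t != 0 -> `|t| < e -> f 0 < f t.
Proof.
move=> df df1 f10 a0; have [e e0 He] := is_derive_pos df1 a0.
have cf : continuous f by move=> t; exact: is_derive_continuous (df t).
exists e => // t tn0 te; case: (ltgtP t 0) tn0 => // t0 _.
  have [c] := @MVT R f f1 t 0 t0 (fun x _ => df x) (continuous_subspaceT cf).
  rewrite in_itv /= => /andP[c1 c2].
  have := (He c ltac:(by move: te; rewrite !ltr0_norm //; slra)).2 c2.
  by rewrite f10; snra.
have [c] := @MVT R f f1 0 t t0 (fun x _ => df x) (continuous_subspaceT cf).
rewrite in_itv /= => /andP[c1 c2].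
have := (He c ltac:(by move: te; rewrite !gtr0_norm //; slra)).1 c1.
by rewrite f10; snra.
Qed.

(** The squared distance replaces [edist] in the calculus: it is differentiable everywhere along a
    smooth curve, even at [p]. [sqd1] and [sqd2] are its first two derivatives. *)
Definition sqd (p : R * R) g (t : R) : R := dot (g t - p) (g t - p).
Definition sqd1 p g (t : R) : R := 2 * dot (g t - p) (g^`() t).
Definition sqd2 p g (t : R) : R :=
  2 * (dot (g^`() t) (g^`() t) + dot (g t - p) (g^`(2) t)).

Lemma is_derive_dot g g' (t : R) (d d' : R * R) : is_derive t 1 g d -> is_derive t 1 g' d' ->
  is_derive t (1 : R) (fun s => dot (g s) (g' s)) (dot d (g' t) + dot (g t) d').
Proof.
move=> /is_derive_pair[d1 d2] /is_derive_pair[d'1 d'2].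
rewrite /dot; apply: is_derive_eq; rewrite /GRing.scale /=; ring.
Qed.

Lemma is_derive_subr g (t : R) (d p : R * R) : is_derive t 1 g d ->
  is_derive t (1 : R) (fun s => g s - p) d.
Proof. by move=> dg; apply: is_derive_eq; rewrite subr0. Qed.

Lemma is_derive_sqd p g (t : R) : smooth_curve g ->
  is_derive t 1 (sqd p g) (sqd1 p g t).
Proof.
move=> sg; have /(is_derive_subr p) h := smooth_is_derive 0 t sg.
have := is_derive_dot h h.
by congr is_derive; rewrite /sqd1 derive1n1 /dot /=; ring.
Qed.

Lemma is_derive_sqd1 p g (t : R) : smooth_curve g ->
  is_derive t 1 (sqd1 p g) (sqd2 p g t).
Proof.
move=> sg; have /(is_derive_subr p) h := smooth_is_derive 0 t sg.
have h1 := smooth_is_derive 1 t sg.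
have h2 := is_derive_dot h h1.
have : is_derive t (1 : R) (fun s => 2 * dot (g s - p) (g^`() s)) (2 *: (dot ((g^`(1))%classic t) ((g^`(1))%classic t) +
         dot (g t - p) ((g^`(2))%classic t))) by exact: is_deriveZ.
by [].
Qed.

(** The distance is the root of [sqd], so its derivative is [sqd1] over twice the distance; at a
    critical point the variation of the denominator is multiplied by [sqd1 = 0]. Hence both second
    derivatives have the same sign. *)
Lemma dist_deriv2E p g : smooth_curve g -> g 0 != p -> sqd1 p g 0 = 0 ->
  0 < sqd p g 0 /\ dist_deriv2 p g = sqd2 p g 0 / (2 * Num.sqrt (sqd p g 0)).
Proof.
move=> sg g0 s10.
have s0 : 0 < sqd p g 0.
  rewrite /sqd /dot -!expr2 lt_neqAle eq_sym addr_ge0 ?sqr_ge0 // andbT.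
  apply: contra g0; rewrite paddr_eq0 ?sqr_ge0 // !sqrf_eq0 !subr_eq0.
  by rewrite -xpair_eqE -!surjective_pairing.
split => //.
have c0 : {for (0 : R), continuous (sqd p g)}.
  by apply: is_derive_continuous; exact: is_derive_sqd.
have N : \forall t \near 0, (fun t => edist (g t) p)^`() t =
    sqd1 p g t * (2 * Num.sqrt (sqd p g t))^-1.
  near=> t.
  have st : 0 < sqd p g t by near: t; move/cvgr_gt: c0; apply.
  have d1 := is_derive1_sqrt st.
  have d2 := is_derive_sqd p t sg.
  have := is_derive1_comp d1 d2.
  by rewrite derive1E => h; rewrite mulrC; exact: (derive_val (is_derive := h)).
rewrite /dist_deriv2 derive1nS derive1n1 derive1E.
rewrite (near_eq_derive _ N).
have d1 := is_derive_sqd1 p 0 sg.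
have d2 := is_derive1_comp (is_derive1_sqrt s0) (is_derive_sqd p 0 sg).
have d3 : is_derive (0 : R) (1 : R) (fun t => 2 * Num.sqrt (sqd p g t))
   (2 *: ((2 * Num.sqrt (sqd p g 0))^-1 * sqd1 p g 0)) by exact: is_deriveZ.
pose k t := 2 * Num.sqrt (sqd p g t).
have n0 : k 0 != 0.
  by rewrite mulf_neq0 // gt_eqF // sqrtr_gt0.
have d4 : is_derive (0 : R) (1 : R) (fun t => (k t)^-1)
   (- (k 0) ^- 2 *: (2 *: ((2 * Num.sqrt (sqd p g 0))^-1 * sqd1 p g 0))).
  exact: is_deriveV.
have d5 := is_deriveM d1 d4.
have := derive_val (is_derive := d5).
rewrite s10 scale0r add0r => ->.
by rewrite /GRing.scale /= mulrC.
Unshelve. all: by end_near. Qed.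

End Calculus.

Section PlaneVec.
Variable R : realType.
Implicit Types (p q z a b : R * R) (s t u : R).

Lemma near_seg q z (P : set (R * R)) : nbhs q P ->
  exists2 d : R, 0 < d & forall t, `|t| < d -> P (seg q z t).
Proof.
move=> /nbhs_boxP[e e0 H]; set M := 1 + `|z.1 - q.1| + `|z.2 - q.2|.
have M0 : 0 < M by rewrite /M; have := normr_ge0 (z.1 - q.1); have := normr_ge0 (z.2 - q.2); slra.
have h (t x : R) : `|x| <= M -> `|t| < e / M -> `|t * x| < e.
  move=> xM te; rewrite normrM; apply: (@le_lt_trans _ _ (`|t| * M)).
    by rewrite ler_wpM2l.
  by rewrite -ltr_pdivlMr.
exists (e / M); first by rewrite divr_gt0.
move=> t te; apply: H; rewrite /seg /= addrAC subrr add0r; apply: h => //.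
  by rewrite /M; have := normr_ge0 (z.2 - q.2); slra.
by rewrite /M; have := normr_ge0 (z.1 - q.1); slra.
Qed.

Lemma dot_seg p q z t : dot (seg q z t - p) (seg q z t - p) =
  dot (q - p) (q - p) + 2 * t * dot (z - q) (q - p) + t ^+ 2 * dot (z - q) (z - q).
Proof. by rewrite /dot /seg /=; ring. Qed.

Lemma seg_back q z t : 1 + t != 0 -> seg (seg q z (- t)) z (t / (1 + t)) = q.
Proof. by move=> t1; rewrite /seg /= [RHS]surjective_pairing; congr pair; field. Qed.

Lemma dot_ge0 (v : R * R) : 0 <= dot v v.
Proof. by rewrite /dot -!expr2 addr_ge0 ?sqr_ge0. Qed.

Lemma dot_sub_gt0 q z : z != q -> 0 < dot (z - q) (z - q).
Proof.
move=> zq; rewrite lt_neqAle dot_ge0 andbT eq_sym; apply: contra zq.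
rewrite /dot -!expr2 paddr_eq0 ?sqr_ge0 // !sqrf_eq0 !subr_eq0.
by rewrite -xpair_eqE -!surjective_pairing.
Qed.

Lemma dot_pol_self p s t : dot (pol p s t - p) (pol p s t - p) = s ^+ 2.
Proof. by rewrite dot_pol subrr cos0 mulr1 expr2. Qed.

Lemma nbhs_ball_real (x : R) (P : set R) : (\forall u \near x, P u) <->
  exists2 e, 0 < e & forall u, `|u - x| < e -> P u.
Proof.
split=> [/nbhs_ballP[e e0 H]|[e e0 H]]; [|apply/nbhs_ballP]; exists e => // u.
  by move=> ux; apply: H; rewrite -ball_normE /= distrC.
by rewrite -ball_normE /= distrC; exact: H.
Qed.

End PlaneVec.

(** * Local extrema of the radial function *)

Section LocalExtrema.
Variable R : realType.
Variables (K : set (R * R)) (p : R * R).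
Hypotheses (Kb : convex_body K) (pK : K° p).
Implicit Types (q z a b : R * R) (s t u : R).

Local Notation rho := (rad K p).
Definition bpt (K : set (R * R)) p t : R * R := pol p (rad K p t) t.
Local Notation bp := (bpt K p).

Lemma bpt_in t : K (bp t).
Proof. by apply/in_radP => //; exact/ltW/rad_gt0. Qed.

(** If [z] were not strictly below the perpendicular at [bp t], a short step from [bp t] towards [z]
    would increase the distance to [p], at least by the positive quadratic term; but it stays in [K]
    over angles near [t], where the radius is at most [rho t]. *)
Lemma locmax_below t z : (\forall u \near t, rho u <= rho t) ->
  K z -> z != bp t -> dot (z - bp t) (bp t - p) < 0.
Proof.
move=> /nbhs_ball_real[e e0 He] Kz zq; rewrite ltNge; apply/negP => dge.
have r0 := rad_gt0 Kb pK t.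
have [d d0 Hd] := near_seg z (pol_near p t r0 e0).
pose x := Num.min d 1 / 2.
have x0 : 0 < x by rewrite /x divr_gt0 // lt_min d0 ltr01.
have xd : x < d by rewrite /x; have := ge_min d d 1; rewrite lexx /=; slra.
have x1 : x < 1 by rewrite /x; have := ge_min 1 d 1; rewrite lexx orbT; slra.
have [u [s [ut _ s0 wE]]] := Hd x ltac:(by rewrite gtr0_norm).
have Kw : K (seg (pol p (rho t) t) z x).
  by apply: body_seg => //; [exact: bpt_in|rewrite (ltW x0) ltW].
have sr : s <= rho t.
  apply: le_trans (He u ut); apply/in_radP => //; first exact: ltW.
  by rewrite -wE.
have := dot_seg p (bp t) z x; rewrite {1 2}/bpt wE /bpt !dot_pol_self.
have := dot_sub_gt0 zq; move: dge; rewrite /bpt => dge dz E.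
have : s ^+ 2 <= rho t ^+ 2 by rewrite ler_pXn2r // ?nnegrE ltW.
have : 0 < x ^+ 2 * dot (z - pol p (rho t) t) (z - pol p (rho t) t).
  by rewrite mulr_gt0 // exprn_gt0.
have : 0 <= 2 * x * dot (z - pol p (rho t) t) (pol p (rho t) t - p).
  by rewrite mulr_ge0 // mulr_ge0 // ltW.
by slra.
Qed.

(** Suppose [z] is strictly beyond the perpendicular. A short step from [bp t] away from [z] leads
    closer to [p] than [rho t], hence to an interior point by minimality; then [bp t], on the
    segment from that point to [z], would be interior as well. *)
Lemma locmin_supports t z : (\forall u \near t, rho t <= rho u) ->
  K z -> dot (z - bp t) (bp t - p) <= 0.
Proof.
move=> /nbhs_ball_real[e e0 He] Kz; rewrite leNgt; apply/negP => dgt.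
have r0 := rad_gt0 Kb pK t.
have [d d0 Hd] := near_seg z (pol_near p t r0 e0).
set D := dot (z - bp t) (bp t - p) in dgt.
set Q := dot (z - bp t) (z - bp t).
have Q0 : 0 <= Q by exact: dot_ge0.
(* With [x * (Q + 1) < D] the squared distance after the step,
   [rho t ^+ 2 - 2 * x * D + x ^+ 2 * Q], is below [rho t ^+ 2]. *)
pose x := Num.min d (D / (Q + 1)) / 2.
have DQ : 0 < D / (Q + 1) by rewrite divr_gt0 // ltr_wpDl.
have x0 : 0 < x by rewrite /x divr_gt0 // lt_min d0.
have xd : x < d.
  by rewrite /x; have := ge_min d d (D / (Q + 1)); rewrite lexx /=; slra.
have xD : x * (Q + 1) < D.
  rewrite -ltr_pdivlMr ?ltr_wpDl //.
  by rewrite /x; have := ge_min (D / (Q + 1)) d (D / (Q + 1)); rewrite lexx orbT; slra.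
have [u [s [ut _ s0 wE]]] := Hd (- x) ltac:(by rewrite normrN gtr0_norm).
have := dot_seg p (bp t) z (- x); rewrite {1 2}/bpt wE -/D -/Q {1}/bpt !dot_pol_self => E.
have srt : s < rho t.
  rewrite -(@ltr_pXn2r _ 2) // ?nnegrE ?ltW // E.
  have : x * (x * (Q + 1)) < x * D by rewrite ltr_pM2l.
  by rewrite sqrrN; snra.
have iw : K° (seg (bp t) z (- x)).
  rewrite /bpt wE; apply/(interior_radP Kb pK) => //; first exact: ltW.
  exact: lt_le_trans (He u ut).
have x1 : 0 < 1 + x by slra.
have : K° (seg (seg (bp t) z (- x)) z (x / (1 + x))).
  apply: interior_seg => //; rewrite divr_ge0; [|exact: ltW|exact: ltW].
  by rewrite /= ltr_pdivrMr //; slra.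
rewrite seg_back ?gt_eqF //.
by move=> /(interior_radP Kb pK) => /(_ (ltW r0)); rewrite ltxx.
Qed.

Lemma locmin_equilibrium t : (\forall u \near t, rho t <= rho u) ->
  equilibrium K p (bp t).
Proof.
move=> lm; split; first exact: boundary_pol.
by split; [exact: bpt_in|left => z Kz; exact: locmin_supports].
Qed.

(** Of the two sides of a supporting line on which [K] may lie, the far one is excluded by [p]
    itself. *)
Lemma equilibrium_supports q : equilibrium K p q ->
  forall z, K z -> dot (z - q) (q - p) <= 0.
Proof.
move=> [/(boundary_radP Kb pK)[t ->] [_ [//|H]]] z Kz; exfalso.
have := H p (Kp pK); have r0 := rad_gt0 Kb pK t.
have -> : dot (p - pol p (rho t) t) (pol p (rho t) t - p) =
  - dot (pol p (rho t) t - p) (pol p (rho t) t - p) by rewrite /dot /=; ring.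
by rewrite dot_pol_self; have := exprn_gt0 2 r0; slra.
Qed.

(** The half-plane of [equilibrium_supports] in polar coordinates, the form in which supporting
    lines enter the area estimates. *)
Lemma equilibrium_rad_le t u : equilibrium K p (bp t) -> 0 < cos (u - t) ->
  rho u * cos (u - t) <= rho t.
Proof.
move=> /equilibrium_supports H cu; have := H _ (bpt_in u).
have -> : dot (bp u - bp t) (bp t - p) =
  dot (bp u - p) (bp t - p) - dot (bp t - p) (bp t - p) by rewrite /dot /=; ring.
rewrite /bpt dot_pol_self dot_pol subr_le0 mulrAC expr2 ler_pM2r //.
exact: rad_gt0.
Qed.

(** Boundary charts have their own parameter, while minimality of [rho] concerns angles. A boundary
    point near [bp t] has an angle near [t] and the radius [rho] of that angle, so the minimum
    carries over to any curve through [bp t]. *)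
Lemma near_boundary_rad (g : R -> R * R) t : {for 0, continuous g} -> g 0 = bp t ->
  (\forall u \near t, rho t <= rho u) ->
  exists2 e : R, 0 < e & forall x, `|x| < e -> boundary K (g x) ->
    sqd p g 0 <= sqd p g x.
Proof.
move=> cg g0 /nbhs_ball_real[e e0 He]; have r0 := rad_gt0 Kb pK t.
have N : nbhs (g 0) [set z | exists t' s', [/\ `|t' - t| < Num.min e pi,
   `|s' - rho t| < Num.min e pi, 0 < s' & z = pol p s' t']].
  by rewrite g0; apply: pol_near; rewrite // lt_min e0 pi_gt0.
have /nbhs_ball_real[d d0 Hd] := cg _ N.
exists d => // x xd bx; have [] := Hd x; first by rewrite subr0.
move=> u [s [ut _ s0 gE]].
have su : s = rho u.
  move: bx; rewrite gE => -[h1 h2]; apply/eqP; rewrite eq_le; apply/andP; split.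
    apply/(in_radP Kb pK); first exact: ltW.
    by have := h1; rewrite -(closure_id K).1 //; exact: body_closed Kb.
  rewrite leNgt; apply/negP => h; apply: h2.
  by apply/(interior_radP Kb pK) => //; exact: ltW.
have h : rho t <= rho u by apply: He; move: ut; rewrite lt_min => /andP[].
by rewrite /sqd g0 gE /bpt !dot_pol_self su ler_pXn2r // nnegrE ltW ?rad_gt0.
Qed.

End LocalExtrema.

(** * Stable points as local minima of the radial function *)

Section SmoothAux.
Variable R : realType.

Lemma is_derive_shift (g : R -> R * R) (c k t : R) n : smooth_curve g ->
  is_derive t 1 (fun t : R => k ^+ n *: (g^`(n))%classic (c + k * t))
   (k ^+ n.+1 *: (g^`(n.+1))%classic (c + k * t)).
Proof.
move=> sg; have [d1 d2] := (is_derive_pair _ _ _).1 (smooth_is_derive n (c + k * t) sg).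
have dl : is_derive t (1 : R) (fun t : R => c + k * t) k.
  by apply: is_derive_eq; rewrite /GRing.scale /=; ring.
apply/is_derive_pair; split.
  have h := is_deriveZ (k ^+ n) (@is_derive1_comp R
    (fun s => ((g^`(n))%classic s).1) (fun t => c + k * t) t _ _ d1 dl).
  apply: (@is_derive_eq _ _ _ _ _ _ _ _ h).
  by move: (_ (c + k * t)) => X; rewrite /= exprSr /GRing.scale /=; ring.
have h := is_deriveZ (k ^+ n) (@is_derive1_comp R
  (fun s => ((g^`(n))%classic s).2) (fun t => c + k * t) t _ _ d2 dl).
apply: (@is_derive_eq _ _ _ _ _ _ _ _ h).
by move: (_ (c + k * t)) => X; rewrite /= exprSr /GRing.scale /=; ring.
Qed.

Lemma derive1_shift (g : R -> R * R) (c k : R) n : smooth_curve g ->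
  ((fun s => g (c + k * s))^`(n))%classic =
  (fun t => k ^+ n *: (g^`(n))%classic (c + k * t)).
Proof.
move=> sg; elim: n => [|n IH]; apply/funext => t; first by rewrite expr0 scale1r.
rewrite derive1nS IH derive1E.
exact: (@derive_val _ _ _ _ _ _ _ (is_derive_shift c k t n sg)).
Qed.

Lemma smooth_curve_shift (g : R -> R * R) (c k : R) : smooth_curve g ->
  smooth_curve (fun s => g (c + k * s)) /\
  (fun s => g (c + k * s))^`()%classic 0 = k *: g^`()%classic c.
Proof.
move=> sg; split.
  move=> n t; rewrite derive1_shift //.
  exact: (@ex_derive _ _ _ _ _ _ _ (is_derive_shift c k t n sg)).
have /(congr1 (@^~ 0)) := derive1_shift c k 1 sg.
by rewrite expr1 mulr0 addr0.
Qed.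

Lemma cauchy_schwarz_dot (u v : R * R) : u != 0 -> v != 0 ->
  0 < enorm u * enorm v /\ -1 <= dot u v / (enorm u * enorm v) <= 1.
Proof.
move=> u0 v0.
have du : 0 < dot u u by have := dot_sub_gt0 u0; rewrite subr0.
have dv : 0 < dot v v by have := dot_sub_gt0 v0; rewrite subr0.
have e0 : 0 < enorm u * enorm v by rewrite mulr_gt0 // sqrtr_gt0.
split => //; rewrite -ler_norml normrM normfV (gtr0_norm e0) ler_pdivrMr // mul1r.
rewrite -(@ler_pXn2r _ 2) ?nnegrE //; last exact: ltW.
rewrite exprMn /enorm sqr_sqrtr ?(ltW du) // sqr_sqrtr ?(ltW dv) //.
rewrite -normrX ger0_norm ?sqr_ge0 // -subr_ge0.
have -> : dot u u * dot v v - dot u v ^+ 2 = (u.1 * v.2 - u.2 * v.1) ^+ 2.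
  by rewrite /dot; ring.
exact: sqr_ge0.
Qed.

Lemma acuteP (u v : R * R) : u != 0 -> v != 0 -> acute u v <-> 0 < dot u v.
Proof.
move=> u0 v0; have [e0 h] := cauchy_schwarz_dot u0 v0; rewrite /acute /angle.
have pi0 := @pi_gt0 R.
set c := dot u v / _ in h *.
have -> : (0 < dot u v) = (0 < c) by rewrite pmulr_lgt0 // invr_gt0.
have a0 := acos_ge0 h; have a1 := acos_lepi h.
have ca : cos (acos c) = c by rewrite acosK // in_itv.
split=> [lt|c0].
  by rewrite -ca; apply: cos_gt0_pihalf; rewrite lt andbT; slra.
rewrite ltNge; apply/negP => le.
have := @cos_ge0_pihalf R (pi - acos c) ltac:(slra).
have -> : pi - acos c = - (acos c) + pi by ring.
rewrite cosDpi cosN ca; slra.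
Qed.

Lemma param_arc (N : nat) (t : nat -> R) (s : R) :
  (forall i, (i < N)%N -> t i < t i.+1) -> t 0%N <= s < t N ->
  exists2 i, (i < N)%N & t i <= s < t i.+1.
Proof.
elim: N => [|N IH] tm /andP[s0 s1]; first slra.
have [h|h] := ltP s (t N); last by exists N => //; rewrite h.
have [||i iN it] := IH; [|by rewrite s0|].
  by move=> i iN; apply: tm; exact: ltnW.
by exists i => //; exact: ltnW.
Qed.

End SmoothAux.

Section StableMinima.
Variable R : realType.
Variables (K : set (R * R)) (p : R * R).
Hypotheses (Kb : convex_body K) (pK : K° p).
Implicit Types (q z a b : R * R) (s t u : R).

Local Notation rho := (rad K p).
Local Notation bp := (bpt K p).

Lemma bpt_neq t : bp t != p.
Proof.
apply/eqP => h; have := dot_pol_self p (rho t) t; rewrite -[pol _ _ _]/(bp t) h subrr.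
by have := exprn_gt0 2 (rad_gt0 Kb pK t); rewrite /dot /=; slra.
Qed.

Lemma boundary_in q : boundary K q -> K q.
Proof. by move=> [h _]; move: h; rewrite -(closure_id K).1 //; exact: body_closed Kb. Qed.

Lemma boundary_chart_near q g : boundary_chart K q g ->
  [/\ smooth_curve g, g 0 = q, {for 0, continuous g}, g^`()%classic 0 != 0 &
   exists2 e : R, 0 < e & forall t, `|t| < e -> boundary K (g t)].
Proof.
case=> sg g0 [e e0 [g'0 _ [U _ [_ gU]]]]; split => //.
- exact: is_derive_pair_continuous (smooth_is_derive 0 0 sg).
- by apply: g'0; rewrite oppr_lt0 e0.
exists e => // t te.
have : (boundary K `&` U) (g t) by rewrite -gU; exists t => //; rewrite /= in_itv /= -ltr_norml.
by case.
Qed.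

(** At a smooth point the second derivative in the chart is nonnegative by minimality and nonzero by
    nondegeneracy. A nonsmooth point is impossible: a boundary arc issued from it makes an acute
    angle with [p - bp t], so the distance would decrease along it. *)
Lemma locmin_stable t : piecewise_smooth_boundary K -> nondegenerate K p (bp t) ->
  (\forall u \near t, rho t <= rho u) -> stable K p (bp t).
Proof.
move=> [gam [N [T [N0 arcs loop inj gamE]]]] [sm nsm] lm.
split; first exact: locmin_equilibrium.
have [S|S] := pselect (smooth_point K (bp t)).
  have [g cg dn0] := sm S; exists g => //.
  have [sg g0 cg0 g'0 [e e0 He]] := boundary_chart_near cg.
  have [d d0 Hd] := near_boundary_rad Kb pK cg0 g0 lm.
  have lmF : \forall x \near (0 : R), sqd p g 0 <= sqd p g x.
    apply/nbhs_ball_real; exists (Num.min d e); first by rewrite lt_min d0.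
    move=> x; rewrite subr0 lt_min => /andP[xd xe]; apply: Hd => //; exact: He.
  have s10 : sqd1 p g 0 = 0.
    apply/eqP; rewrite -oppr_eq0; apply/eqP.
    apply: (is_derive_locmax (f := fun x => - sqd p g x)).
      by apply: is_deriveN; exact: is_derive_sqd.
    by apply: filterS lmF => x; rewrite lerN2.
  have gp : g 0 != p by rewrite g0 bpt_neq.
  have [s0 dE] := dist_deriv2E sg gp s10.
  have s2 : 0 <= sqd2 p g 0.
    rewrite leNgt; apply/negP => h.
    have [||//||x x0 Hx] := @strict_min_deriv2 R (fun x => - sqd p g x) (fun x => - sqd1 p g x) (- sqd2 p g 0).
    - by move=> x; apply: is_deriveN; exact: is_derive_sqd.
    - by apply: is_deriveN; exact: is_derive_sqd1.
    - by rewrite s10 oppr0.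
    - by rewrite oppr_gt0.
    move/nbhs_ball_real : lmF => [y y0 Hy].
    pose w := Num.min x y / 2.
    have w0 : 0 < w by rewrite /w divr_gt0 // lt_min x0.
    have wx : w < x by rewrite /w; have := ge_min x x y; rewrite lexx /=; slra.
    have wy : w < y by rewrite /w; have := ge_min y x y; rewrite lexx orbT; slra.
    have := Hx w; rewrite gt_eqF // gtr0_norm // => /(_ isT wx).
    by have := Hy w; rewrite subr0 gtr0_norm // => /(_ wy); slra.
  move: dn0; rewrite dE lt_neqAle eq_sym => -> /=.
  by rewrite divr_ge0 // mulr_ge0 // sqrtr_ge0.
exfalso; have {sm} nsm := nsm S.
(* The parameter is taken before [T N], by [loop] if need be, so that the boundary continues beyond
   [s] on a single arc. *)
have [s /andP[s0 sN] sE] : exists2 s, T 0%N <= s < T N & gam s = bp t.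
  have : (gam @` `[T 0%N, T N]) (bp t) by rewrite gamE; exact: boundary_pol.
  move=> [s /=]; rewrite in_itv /= => /andP[s0]; rewrite le_eqVlt => /predU1P[->|sN] sE.
    exists (T 0%N); last by rewrite -loop.
    rewrite lexx /=.
    have : forall n, (n <= N)%N -> T 0%N <= T n /\ ((0 < n)%N -> T 0%N < T n).
      elim=> [|n IH] nN; first by rewrite lexx.
      have [h _] := IH (ltnW nN); have [h1 _] := arcs n nN.
      by split; [|move=> _]; slra.
    by move=> /(_ N (leqnn N)) [_]; apply.
  by exists s => //; rewrite s0.
have [i iN /andP[is0 is1]] := param_arc (fun i iN => (arcs i iN).1) (s := s) ltac:(by rewrite s0).
have [_ [g [sg gE]]] := arcs i iN.
pose h x := g (s + 1 * x).
have [sh h'0] := smooth_curve_shift s 1 sg.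
have h0 : h 0 = bp t.
  by rewrite /h mulr0 addr0 -sE; apply: (gE s _).1; rewrite is0 ltW.
have u0 : g^`()%classic s != 0 by apply: (gE s _).2; rewrite is0 ltW.
have TiN : T i.+1 <= T N.
  have : forall k, (i.+1 + k <= N)%N -> T i.+1 <= T (i.+1 + k)%N.
    elim=> [|k IH] kN; first by rewrite addn0.
    rewrite addnS; have [|l _] := arcs (i.+1 + k)%N; first by rewrite -addnS.
    by have := IH ltac:(by rewrite ltnW // -addnS); slra.
  by move=> /(_ (N - i.+1)%N); rewrite subnKC //; apply.
have T0i : T 0%N <= T i.
  have : forall k, (k <= N)%N -> T 0%N <= T k.
    elim=> [|k IH] kN; first by [].
    by have := IH (ltnW kN); have [l _] := arcs k kN; slra.
  by apply; exact: ltnW.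
have hb x : 0 <= x < T i.+1 - s -> boundary K (h x).
  move=> /andP[x0 x1]; rewrite -gamE; exists (s + 1 * x).
    by rewrite /= in_itv /= mul1r; apply/andP; split; slra.
  by symmetry; apply: (gE (s + 1 * x) _).1; rewrite mul1r; apply/andP; split; slra.
have td : tangent_direction K (bp t) (g^`()%classic s).
  split; first exact: u0.
  exists h; split; [exact: sh|exact: h0|by rewrite h'0 scale1r|].
  by exists (T i.+1 - s); [rewrite subr_gt0|exact: hb].
have := nsm _ td.
have pq : p - bp t != 0 by rewrite subr_eq0 eq_sym bpt_neq.
move/(acuteP pq u0) => dpos.
have ch : {for 0, continuous h} by exact: is_derive_pair_continuous (smooth_is_derive 0 0 sh).
have [d d0 Hd] := near_boundary_rad Kb pK ch h0 lm.
have dF := is_derive_sqd p 0 sh.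
have s1neg : 0 < - sqd1 p h 0.
  rewrite /sqd1 h'0 scale1r h0.
  have -> : dot (bp t - p) (g^`()%classic s) = - dot (p - bp t) (g^`()%classic s).
    by rewrite /dot /=; ring.
  by slra.
have [x x0 Hx] := @is_derive_pos R (fun x => - sqd p h x) _ (is_deriveN dF) s1neg.
pose m := Num.min x (Num.min d (T i.+1 - s)).
have m0 : 0 < m by rewrite !lt_min x0 d0 subr_gt0.
have : m <= x /\ m <= d /\ m <= T i.+1 - s.
  by rewrite /m !ge_min !lexx !orbT.
move=> [mx [md ms]].
have h2 : `|m / 2| < x by rewrite gtr0_norm; slra.
have h3 : `|m / 2| < d by rewrite gtr0_norm; slra.
have := (Hx (m / 2) h2).1 ltac:(slra).
have := Hd (m / 2) h3 (hb (m / 2) ltac:(slra)).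
by slra.
Qed.

(** The chart gives a strict minimum in its own parameter. To pass to angles, the chart is shown to
    cross the ray [t] transversally, so that every nearby ray meets it. *)
Lemma stable_strict_min t : stable K p (bp t) ->
  \forall u \near t, u != t -> rho t < rho u.
Proof.
move=> [eq [g cg dpos]].
have [sg g0 cg0 g'0 [e e0 He]] := boundary_chart_near cg.
have r0 := rad_gt0 Kb pK t.
have dh : is_derive (0 : R) (1 : R) (fun x => dot (g x - bp t) (bp t - p))
     (dot (g^`()%classic 0) (bp t - p)).
  have h1 := is_derive_subr (bp t) (smooth_is_derive 0 0 sg).
  have h2 : is_derive (0 : R) (1 : R) (fun _ : R => bp t - p) 0 by exact: is_derive_cst.
  have := is_derive_dot h1 h2; congr is_derive; rewrite /dot /=; ring.
have d0 : dot (g^`()%classic 0) (bp t - p) = 0.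
  apply: (is_derive_locmax dh).
  apply/nbhs_ball_real; exists e => // x; rewrite subr0 => xe.
  rewrite g0 subrr {2}/dot /= !mul0r addr0.
  by apply: (equilibrium_supports Kb pK eq); apply: boundary_in; exact: He.
have s10 : sqd1 p g 0 = 0.
  rewrite /sqd1 g0.
  have -> : dot (bp t - p) (g^`()%classic 0) = dot (g^`()%classic 0) (bp t - p).
    by rewrite /dot ![(g^`()%classic 0).1 * _]mulrC ![(g^`()%classic 0).2 * _]mulrC.
  by rewrite d0 mulr0.
have gp : g 0 != p by rewrite g0 bpt_neq.
have [s0 dE] := dist_deriv2E sg gp s10.
have s2 : 0 < sqd2 p g 0.
  move: dpos; rewrite dE pmulr_lgt0 // invr_gt0 mulr_gt0 // sqrtr_gt0 //.
have [f f0 Hf] := strict_min_deriv2 (fun x => is_derive_sqd p x sg) (is_derive_sqd1 p 0 sg) s10 s2.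
(* The component of [g x - p] normal to the direction [u], zero when [g x] is on the line of that
   direction through [p]. For [u = t] its derivative at 0 is nonzero, since the velocity is nonzero
   and orthogonal to [bp t - p]. *)
pose Y u x := (g x - p).2 * cos u - (g x - p).1 * sin u.
have [d1 d2] := (is_derive_pair _ _ _).1 (is_derive_subr p (smooth_is_derive 0 0 sg)).
set a := (g^`(0.+1))%classic 0 in d1 d2.
have aE : a = g^`()%classic 0 by [].
have dY : is_derive (0 : R) (1 : R) (Y t) (a.2 * cos t - a.1 * sin t).
  rewrite /Y; apply: is_derive_eq; rewrite /GRing.scale /=; ring.
have cs := cos2Dsin2 t.
have aYn0 : a.2 * cos t - a.1 * sin t != 0.
  apply: contra g'0 => /eqP h.
  have h2 : a.1 * cos t + a.2 * sin t = 0.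
    move: d0; rewrite -aE /dot /bpt /pol /= => h3.
    by apply: (@mulfI _ (rho t)); [rewrite gt_eqF|rewrite mulr0 -h3; ring].
  rewrite -aE [a]surjective_pairing xpair_eqE; apply/andP; split; apply/eqP.
    transitivity (a.1 * (cos t ^+ 2 + sin t ^+ 2)); first by rewrite cs mulr1.
    transitivity ((a.1 * cos t + a.2 * sin t) * cos t -
        (a.2 * cos t - a.1 * sin t) * sin t); first by ring.
    by rewrite h h2 !mul0r subr0.
  transitivity (a.2 * (cos t ^+ 2 + sin t ^+ 2)); first by rewrite cs mulr1.
  transitivity ((a.1 * cos t + a.2 * sin t) * sin t +
        (a.2 * cos t - a.1 * sin t) * cos t); first by ring.
  by rewrite h h2 !mul0r addr0.
have Y0 : Y t 0 = 0 by rewrite /Y g0 /bpt /pol /=; ring.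
have [y y0 Hy] : exists2 y, 0 < y & forall x, 0 < x < y -> Y t x * Y t (- x) < 0.
  case: (ltgtP (a.2 * cos t - a.1 * sin t) 0) aYn0 => // hs _.
    have [|y y0 H] := @is_derive_pos R (fun x => - Y t x) _ (is_deriveN dY).
      by rewrite oppr_gt0.
    exists y => // x /andP[x0 xy].
    have := (H x ltac:(by rewrite gtr0_norm)).1 x0.
    have := (H (- x) ltac:(by rewrite normrN gtr0_norm)).2 ltac:(by slra).
    by rewrite Y0; snra.
  have [y y0 H] := is_derive_pos dY hs.
  exists y => // x /andP[x0 xy].
  have := (H x ltac:(by rewrite gtr0_norm)).1 x0.
  have := (H (- x) ltac:(by rewrite normrN gtr0_norm)).2 ltac:(by slra).
  by rewrite Y0; snra.
have cgx : continuous g.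
  by move=> x; exact: is_derive_pair_continuous (smooth_is_derive 0 x sg).
(* Positivity of [D] keeps the crossing found below on the ray itself and not on its opposite. *)
pose D x := dot (g x - p) (bp t - p).
have [k k0 Hk] : exists2 k, 0 < k & forall x, `|x| < k -> 0 < D x.
  have cD : {for (0 : R), continuous D}.
    have h1 := is_derive_subr p (smooth_is_derive 0 0 sg).
    have h2 : is_derive (0 : R) (1 : R) (fun _ : R => bp t - p) 0 by exact: is_derive_cst.
    exact: is_derive_continuous (is_derive_dot h1 h2).
  have D0 : 0 < D 0 by rewrite /D g0 dot_pol_self exprn_gt0.
  move/cvgr_gt : cD => /(_ 0 D0) /nbhs_ball_real[k k0 H].
  by exists k => // x xk; apply: H; rewrite subr0.
pose m := Num.min (Num.min e f) (Num.min y k).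
have m0 : 0 < m by rewrite !lt_min e0 f0 y0 k0.
have [me [mf [my mk]]] : m <= e /\ m <= f /\ m <= y /\ m <= k.
  by rewrite /m !ge_min !lexx !orbT.
pose x := m / 2; have x0 : 0 < x by rewrite /x; slra.
have xm : x < m by rewrite /x; slra.
have YY : Y t x * Y t (- x) < 0 by apply: Hy; rewrite x0; slra.
have cY u' : {for t, continuous (fun u => Y u u')}.
  by apply: cvgB; (apply: cvgM; first exact: cvg_cst);
    [exact: continuous_cos|exact: continuous_sin].
have N1 : \forall u \near t, Y u x * Y u (- x) < 0.
  have h : Y u x * Y u (- x) @[u --> t] --> Y t x * Y t (- x).
    exact: (cvgM (cY x) (cY (- x))).
  by move/cvgr_lt : h => /(_ _ YY).
have N2 : \forall u \near t, 0 < cos (u - t).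
  have h : {for t, continuous (fun u => cos (u - t))}.
    apply: continuous_comp; last exact: continuous_cos.
    by apply: cvgB; [exact: cvg_id|exact: cvg_cst].
  by move/cvgr_gt : h; apply; rewrite subrr cos0.
have N3 : \forall u \near t, `|u - t| < 2 * pi.
  apply/nbhs_ball_real; exists (2 * pi) => //.
  by rewrite mulr_gt0 // pi_gt0.
near=> u => ut.
have YYu : Y u x * Y u (- x) < 0 by near: u.
have cut : 0 < cos (u - t) by near: u.
have u2 : `|u - t| < 2 * pi by near: u.
have cYu : continuous (Y u).
  move=> v; rewrite /Y; have cv := cgx v.
  have c1 : {for v, continuous (fun v => (g v - p).1)}.
    by apply: cvgB; [exact: (cvg_comp _ _ cv (@cvg_fst _ _ _ _ _))|exact: cvg_cst].
  have c2 : {for v, continuous (fun v => (g v - p).2)}.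
    by apply: cvgB; [exact: (cvg_comp _ _ cv (@cvg_snd _ _ _ _ _))|exact: cvg_cst].
  by apply: cvgB; apply: cvgM => //; exact: cvg_cst.
(* For [u] near [t] the values of [Y u] at [x] and [- x] have opposite signs, so the chart meets the
   line of direction [u] in between. *)
have [c cx Yc] : exists2 c, c \in `[- x, x]%R & Y u c = 0.
  apply: (IVT (f := Y u)); [slra|exact: continuous_subspaceT|].
  rewrite ge_min le_max; apply/andP; split; apply/orP.
    by case: (lerP (Y u (- x)) 0) => h; [left|right; snra].
  by case: (lerP 0 (Y u (- x))) => h; [left|right; snra].
have cm : `|c| < m by move: cx; rewrite in_itv /= -ler_norml; slra.
set s := (g c - p).1 * cos u + (g c - p).2 * sin u.
have csu := cos2Dsin2 u.
have gE : g c = pol p s u.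
  rewrite [LHS]surjective_pairing /pol; congr pair.
    transitivity (p.1 + (g c - p).1 * (cos u ^+ 2 + sin u ^+ 2)).
      by rewrite csu /=; ring.
    transitivity (p.1 + s * cos u - Y u c * sin u); first by rewrite /s /Y; ring.
    by rewrite Yc mul0r subr0.
  transitivity (p.2 + (g c - p).2 * (cos u ^+ 2 + sin u ^+ 2)).
    by rewrite csu /=; ring.
  transitivity (p.2 + s * sin u + Y u c * cos u); first by rewrite /s /Y; ring.
  by rewrite Yc mul0r addr0.
have sp : 0 < s.
  have := Hk c ltac:(slra); rewrite /D gE /bpt dot_pol -mulrA.
  by rewrite pmulr_lgt0 // mulr_gt0.
have sr : s = rho u.
  have [h1 h2] : boundary K (pol p s u) by rewrite -gE; apply: He; slra.
  apply/eqP; rewrite eq_le; apply/andP; split.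
    apply/(in_radP Kb pK); first exact: ltW.
    by apply: boundary_in; split.
  rewrite leNgt; apply/negP => h; apply: h2.
  by apply/(interior_radP Kb pK) => //; exact: ltW.
have cn0 : c != 0.
  apply/eqP => c0; move: gE; rewrite c0 g0 => /(pol_inj r0 sp) [].
    by rewrite distrC.
  by move=> _ /esym tu; rewrite tu eqxx in ut.
have := Hf c cn0 ltac:(slra).
rewrite /sqd gE g0 /bpt !dot_pol_self sr.
by rewrite ltr_pXn2r // nnegrE ltW // rad_gt0.
Unshelve. all: by end_near. Qed.

End StableMinima.

(** * Convex hulls of finitely many points *)

Section Hull.
Variable R : realType.
Variables (n : nat) (v : 'I_n -> R * R).
Implicit Types (p q z a b : R * R) (s t u : R).

Local Notation H := (convex_hull v).

Lemma hull_vertex i : H (v i).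
Proof.
exists (fun j => (j == i)%:R); split.
- by move=> j; exact: ler0n.
- by rewrite (bigD1 i) //= eqxx big1 ?addr0 // => j /negPf ->.
- rewrite (bigD1 i) //= eqxx scale1r big1 ?addr0 // => j /negPf ->.
  by rewrite scale0r.
Qed.

Lemma sum_pair (I : finType) (F : I -> R * R) :
  \sum_i F i = (\sum_i (F i).1, \sum_i (F i).2).
Proof.
by rewrite [LHS]surjective_pairing; congr pair; apply: big_morph.
Qed.

Lemma hull_sum1 (w : 'I_n -> R) : (\sum_i w i *: v i).1 = \sum_i w i * (v i).1.
Proof. by rewrite sum_pair. Qed.

Lemma hull_sum2 (w : 'I_n -> R) : (\sum_i w i *: v i).2 = \sum_i w i * (v i).2.
Proof. by rewrite sum_pair. Qed.

Lemma hull_dot (w : 'I_n -> R) q m : \sum_i w i = 1 ->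
  dot ((\sum_i w i *: v i) - q) m = \sum_i w i * dot (v i - q) m.
Proof.
move=> w1; rewrite /dot /= hull_sum1 hull_sum2.
rewrite -[q.1 in LHS]mul1r -[q.2 in LHS]mul1r -w1 !mulr_suml -!sumrB !mulr_suml -big_split /=.
by apply: eq_bigr => i _; ring.
Qed.

Lemma hull_convex : convex_set H.
Proof.
apply: seg_convex_set => a b t [w [w0 w1 ->]] [w' [w'0 w'1 ->]] /andP[t0 t1].
exists (fun i => (1 - t) * w i + t * w' i); split.
- by move=> i; rewrite addr_ge0 // mulr_ge0 // subr_ge0.
- by rewrite big_split /= -!mulr_sumr w1 w'1; ring.
- rewrite /seg !hull_sum1 !hull_sum2 [RHS]surjective_pairing hull_sum1 hull_sum2.
  congr pair.
    rewrite -sumrB mulr_sumr -big_split /=; apply: eq_bigr => i _; ring.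
  rewrite -sumrB mulr_sumr -big_split /=; apply: eq_bigr => i _; ring.
Qed.

(** Induction on a list of vertices, for the partial combination renormalized to weight 1: adding a
    vertex is one step along a segment. A partial weight 0 is treated apart, all its terms being
    zero. *)
Lemma hull_min (C : set (R * R)) : convex_set C -> (forall i, C (v i)) -> H `<=` C.
Proof.
move=> Cc Cv z [w [w0 w1 ->]].
suff F (s : seq 'I_n) : 0 < \sum_(i <- s) w i ->
    C ((\sum_(i <- s) w i)^-1 *: (\sum_(i <- s) w i *: v i)).
  have := F (index_enum 'I_n); rewrite w1 invr1 scale1r; apply; exact: ltr01.
elim: s => [|i s IH]; first by rewrite big_nil ltxx.
rewrite !big_cons => W0; set W := \sum_(_ <- s) _ in IH W0 *.
set V := \sum_(_ <- s) _ in IH *.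
have Wge : 0 <= W by apply: sumr_ge0.
have [W00|Wn0] := eqVneq W 0.
  have V0 : V = 0.
    rewrite /V big1_seq // => j /andP[_ js].
    have : w j = 0.
      have /eqP := W00; rewrite psumr_eq0 // => /allP /(_ j js) /eqP -> //.
    by move=> ->; rewrite scale0r.
  rewrite W00 V0 !addr0 scalerA mulVf ?scale1r //.
  by move: W0; rewrite W00 addr0 => /gt_eqF ->.
have Wp : 0 < W by rewrite lt_neqAle eq_sym Wn0.
have := convex_set_seg Cc (Cv i) (IH Wp) (t := W / (w i + W)).
have h : w i + W != 0 by rewrite gt_eqF.
move=> /(_ _)/wrap[].
  by rewrite divr_ge0 //= ?(ltW W0) // ler_pdivrMr // mul1r lerDr.
congr C; rewrite /seg [RHS]surjective_pairing /= /GRing.scale /=.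
by congr pair; field; rewrite Wn0 h.
Qed.

(** The hull is a continuous image of the simplex of weights, a closed subset of a compact cube. *)
Lemma hull_compact : compact H.
Proof.
pose f (w : 'rV[R]_n) : R * R := \sum_i w ord0 i *: v i.
pose A := [set w : 'rV[R]_n | forall i, (`[0, 1]%classic : set R) (w ord0 i)].
pose B := A `&` [set w : 'rV[R]_n | \sum_i w ord0 i = 1].
have cc i : continuous (fun w : 'rV[R]_n => w ord0 i) by exact: coord_continuous.
have cs : continuous (fun w : 'rV[R]_n => \sum_i w ord0 i).
  by apply: continuous_big => //; exact: add_continuous.
have -> : H = f @` B.
  apply/seteqP; split => z.
    move=> [w [w0 w1 ->]]; exists (\row_i w i); last first.
      by apply: eq_bigr => i _; rewrite mxE.
    have w1' i : w i <= 1.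
      by rewrite -w1 (bigD1 i) //= lerDl sumr_ge0.
    split; last by rewrite /= -[RHS]w1; apply: eq_bigr => i _; rewrite mxE.
    by move=> i; rewrite /= mxE in_itv /= w0 w1'.
  move=> [w [Aw /= w1] <-]; exists (fun i => w ord0 i); split => // i.
  by have := Aw i; rewrite /= in_itv /= => /andP[].
apply: continuous_compact.
  apply: continuous_subspaceT.
  have -> : f = fun w => (\sum_i w ord0 i * (v i).1, \sum_i w ord0 i * (v i).2).
    by apply/funext => w; rewrite /f sum_pair.
  apply: continuous_pair; apply: continuous_big => //; try exact: add_continuous.
    by move=> i _ w; have h := cvgM (cc i w) (cvg_cst (v i).1); exact: h.
  by move=> i _ w; have h := cvgM (cc i w) (cvg_cst (v i).2); exact: h.
apply: (@subclosed_compact _ _ A); last by move=> w [].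
  apply: closedI.
    have -> : A = \bigcap_i [set w : 'rV[R]_n | (`[0, 1]%classic : set R) (w ord0 i)].
      by apply/seteqP; split => w h i; [move=> _|]; exact: h.
    apply: closed_bigI => i _.
    apply: (@preimage_closed _ _ (fun w : 'rV[R]_n => w ord0 i)).
      by move=> w _; exact: (cc i w).
    exact: itv_closed.
  apply: (@preimage_closed _ _ (fun w : 'rV[R]_n => \sum_i w ord0 i) [set 1]).
    by move=> w _; exact: cs.
  exact: closed_eq.
exact: (@rV_compact R n (fun=> `[0, 1]%classic) (fun i => @segment_compact R 0 1)).
Qed.

Lemma hull_body p : H° p -> convex_body H.
Proof. by move=> ip; split; [exact: hull_compact|exact: hull_convex|exists p]. Qed.

End Hull.

(** * Straight arcs *)

Section LineArc.
Variable R : realType.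

Definition rot90 (m : R * R) : R * R := (- m.2, m.1).

Lemma rot90_decomposition (x m : R * R) : dot m m != 0 ->
  x.1 = dot x m / dot m m * m.1 - dot x (rot90 m) / dot m m * m.2 /\
  x.2 = dot x m / dot m m * m.2 + dot x (rot90 m) / dot m m * m.1.
Proof. by rewrite /dot /rot90 /= => m0; split; field. Qed.

Implicit Types (p q d : R * R) (t : R).

Definition line_arc q d t : R * R := (q.1 + t * d.1, q.2 + t * d.2).

Lemma line_arc0 q d : line_arc q d 0 = q.
Proof. by rewrite /line_arc !mul0r !addr0 -surjective_pairing. Qed.

Lemma is_derive_line_arc q d t : is_derive t 1 (line_arc q d) d.
Proof.
by apply/is_derive_pair; rewrite /line_arc /=; split;
  apply: is_derive_eq; rewrite /GRing.scale /=; ring.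
Qed.

Lemma derive1_line_arc q d : (line_arc q d)^`()%classic = (fun=> d).
Proof.
apply/funext => t; rewrite derive1E.
exact: (@derive_val _ _ _ _ _ _ _ (is_derive_line_arc q d t)).
Qed.

Lemma derive2_line_arc q d n : ((line_arc q d)^`(n.+2))%classic = (fun=> 0).
Proof.
elim: n => [|n IH]; apply/funext => t; rewrite derive1nS.
  by rewrite derive1n1 derive1_line_arc derive1_cst.
by rewrite IH derive1_cst.
Qed.

Lemma smooth_line_arc q d : smooth_curve (line_arc q d).
Proof.
case=> [|[|n]] t.
- exact: (@ex_derive _ _ _ _ _ _ _ (is_derive_line_arc q d t)).
- by rewrite derive1n1 derive1_line_arc; exact: derivable_cst.
- by rewrite derive2_line_arc; exact: derivable_cst.
Qed.

End LineArc.

(** * Equilibria of a polygon *)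

Section HullEquilibria.
Variable R : realType.
Variables (n : nat) (v : 'I_n -> R * R) (p : R * R).
Local Notation H := (convex_hull v).
Hypothesis iH : H° p.
Implicit Types (q z a b d : R * R) (s t u : R).

Let Hb : convex_body H := hull_body iH.

(** Near an equilibrium inside an edge the boundary is the edge itself: the perpendicular at [q]
    supports the hull, and nearby points strictly on its inner side lie between [p] and the edge. *)
Lemma chart_of_edge q (d : R) : equilibrium H p q -> 0 < d ->
  (forall t, `|t| < d -> H (line_arc q (rot90 (q - p)) t)) ->
  boundary_chart H q (line_arc q (rot90 (q - p))).
Proof.
move=> eq d0 Hd; set m := q - p; set g := line_arc q (rot90 m).
have sup := equilibrium_supports Hb iH eq.
have qp : q != p.
  by have /(boundary_radP Hb iH)[t ->] := eq.1; exact: bpt_neq.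
have m0 : 0 < dot m m by exact: dot_sub_gt0.
(* Coordinates with origin [q], in which the supporting line is [A = 0] and [p] is the point
   [A = -1], [B = 0]. *)
pose A z := dot (z - q) m / dot m m.
pose B z := dot (z - q) (rot90 m) / dot m m.
have zAB z : z = (q.1 + A z * m.1 - B z * m.2, q.2 + A z * m.2 + B z * m.1).
  have [h1 h2] := rot90_decomposition (z - q) (lt0r_neq0 m0).
  rewrite /A /B [LHS]surjective_pairing; congr pair.
    by rewrite -addrA -h1 /=; ring.
  by rewrite -addrA -h2 /=; ring.
have Ag t : A (g t) = 0.
  by rewrite /A /g /line_arc /rot90 {1}/dot /= (_ : _ + _ = 0) ?mul0r //; ring.
have Bg t : B (g t) = t.
  rewrite /B /g /line_arc /rot90 {1}/dot /=.
  have -> : (q.1 + t * - m.2 - q.1) * - m.2 + (q.2 + t * m.1 - q.2) * m.1 = t * dot m m.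
    by rewrite /dot; ring.
  by rewrite mulfK // gt_eqF.
split; first exact: smooth_line_arc.
  exact: line_arc0.
exists (d / 2); first by rewrite divr_gt0.
split.
- move=> t _; rewrite derive1_line_arc; apply: contraTneq m0 => h.
  have [h1 h2] : m.2 = 0 /\ m.1 = 0.
    by move: h => [/eqP]; rewrite oppr_eq0 => /eqP.
  by rewrite /dot h1 h2 !mul0r addr0 ltxx.
- by move=> s t _ _ st; rewrite -(Bg s) -(Bg t); congr B.
(* A point of this box with negative [A] lies on the segment from [p] to the point of the line with
   abscissa [B / (1 + A)]; the lower bound on [A] keeps that abscissa below [d] in absolute
   value. *)
exists [set z | - 2^-1 < A z /\ - (d / 2) < B z /\ B z < d / 2].
  have c1 : continuous A.
    move=> z; apply: cvgM; last exact: cvg_cst.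
    apply: cvgD; (apply: cvgM; last exact: cvg_cst).
      by apply: cvgB; [exact: cvg_fst|exact: cvg_cst].
    by apply: cvgB; [exact: cvg_snd|exact: cvg_cst].
  have c2 : continuous B.
    move=> z; apply: cvgM; last exact: cvg_cst.
    apply: cvgD; (apply: cvgM; last exact: cvg_cst).
      by apply: cvgB; [exact: cvg_fst|exact: cvg_cst].
    by apply: cvgB; [exact: cvg_snd|exact: cvg_cst].
  apply: openI; last apply: openI.
  - by apply: (open_comp (f := A) (D := [set x | - 2^-1 < x])) => [? _|]; [exact: c1|exact: open_gt].
  - by apply: (open_comp (f := B) (D := [set x | - (d / 2) < x])) => [? _|]; [exact: c2|exact: open_gt].
  - by apply: (open_comp (f := B) (D := [set x | x < d / 2])) => [? _|]; [exact: c2|exact: open_lt].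
split.
  have gq : g 0 = q by exact: line_arc0.
  by rewrite -gq /= Ag Bg; split; slra.
apply/seteqP; split => z.
  move=> [t /=]; rewrite in_itv /= => /andP[t1 t2] <-.
  split; last by rewrite -/g Ag Bg; split; slra.
  split; first by apply: subset_closure; apply: Hd; rewrite ltr_norml; apply/andP; split; slra.
  move=> /(near_seg p) /= [e e0 He].
  have := He (- (e / 2)) ltac:(by rewrite normrN gtr0_norm; slra).
  move=> /sup; rewrite -/m -/g.
  have -> : dot (seg (g t) p (- (e / 2)) - q) m = (e / 2) * dot m m + (1 + e / 2) * (A (g t) * dot m m).
    rewrite /A divfK ?gt_eqF // /m /seg /dot /=; ring.
  by rewrite Ag mul0r mulr0 addr0 leNgt mulr_gt0 //; slra.
move=> [bz [A1 [B1 B2]]]; exists (B z); first by rewrite /= in_itv /= B1.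
have A0 : A z <= 0.
  rewrite /A pmulr_lle0 ?invr_gt0 //; apply: sup.
  exact: boundary_in bz.
move: A0; rewrite le_eqVlt => /predU1P[A0|A0].
  have := zAB z; rewrite A0; move: (B z) => y ->.
  by rewrite /g /line_arc /rot90 /=; congr pair; ring.
exfalso; case: bz => _; apply.
have k0 : 0 < 1 + A z by slra.
have Hm : H (g (B z / (1 + A z))).
  apply: Hd; rewrite normrM normfV (gtr0_norm k0) ltr_pdivrMr // ltr_norml.
  by apply/andP; split; snra.
have := interior_seg Hb iH Hm (t := 1 + A z) ltac:(by slra).
congr (_ _); rewrite [RHS]zAB /seg /g /line_arc /rot90 /=.
have kn : 1 + A z != 0 by rewrite gt_eqF.
by congr pair; rewrite /m /=; field.
Qed.

(** Along the perpendicular the squared distance is [(1 + t ^+ 2) * dot (q - p) (q - p)], whose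
    second derivative is positive. *)
Lemma stable_of_edge q (d : R) : equilibrium H p q -> 0 < d ->
  (forall t, `|t| < d -> H (line_arc q (rot90 (q - p)) t)) -> stable H p q.
Proof.
move=> eq d0 Hd; split => //; exists (line_arc q (rot90 (q - p))).
  exact: chart_of_edge Hd.
have qp : q != p.
  by have /(boundary_radP Hb iH)[t ->] := eq.1; exact: bpt_neq.
have g0 := line_arc0 q (rot90 (q - p)).
have [||s0 ->] := dist_deriv2E (@smooth_line_arc R q (rot90 (q - p))) (p := p).
- by rewrite g0.
- by rewrite /sqd1 g0 derive1_line_arc /dot /rot90 /=; ring.
rewrite divr_gt0 // ?mulr_gt0 ?sqrtr_gt0 //.
rewrite /sqd2 derive1_line_arc derive2_line_arc.
rewrite g0 (_ : _ + _ = dot (q - p) (q - p)); first exact: dot_sub_gt0.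
by rewrite /dot /rot90 /=; ring.
Qed.

(** The vertices with positive weight in [q] all lie on the supporting line and, as none of them is
    [q], on both sides of [q]; so [q] is inside an edge. *)
Lemma nonvertex_stable q : equilibrium H p q -> (forall i, v i != q) ->
  stable H p q.
Proof.
move=> eq vq; have sup := equilibrium_supports Hb iH eq.
have Hq : H q by case: eq => _ [].
set m := q - p in sup.
have qp : q != p.
  by have /(boundary_radP Hb iH)[t ->] := eq.1; exact: bpt_neq.
have m0 : 0 < dot m m by exact: dot_sub_gt0.
case: (Hq) => w [w0 w1 qE].
have wd i : w i * dot (v i - q) m = 0.
  have : \sum_i w i * - dot (v i - q) m = 0.
    transitivity (- \sum_i w i * dot (v i - q) m).
      by rewrite -sumrN; apply: eq_bigr => j _; rewrite mulrN.
    by rewrite -(hull_dot v q m w1) -qE subrr /dot /=; ring.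
  have wp j : true -> 0 <= w j * - dot (v j - q) m.
    by rewrite mulr_ge0 // oppr_ge0 sup //; exact: hull_vertex.
  move=> /(psumr_eq0P wp) /(_ i isT) /eqP.
  by rewrite mulrN oppr_eq0 => /eqP.
have wy : \sum_i w i * dot (v i - q) (rot90 m) = 0.
  by rewrite -(hull_dot v q _ w1) -qE subrr /dot /=; ring.
have onE i : 0 < w i -> v i = line_arc q (rot90 m) (dot (v i - q) (rot90 m) / dot m m) /\
    dot (v i - q) (rot90 m) != 0.
  move=> wi; have d0 : dot (v i - q) m = 0.
    by have /eqP := wd i; rewrite mulf_eq0 gt_eqF //= => /eqP.
  have [h1 h2] := rot90_decomposition (v i - q) (lt0r_neq0 m0).
  rewrite d0 !mul0r in h1 h2.
  have E : v i = line_arc q (rot90 m) (dot (v i - q) (rot90 m) / dot m m).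
    rewrite [LHS]surjective_pairing /line_arc; congr pair.
      have -> : (v i).1 = q.1 + (v i - q).1 by rewrite /=; ring.
      by rewrite h1 /rot90 /=; ring.
    have -> : (v i).2 = q.2 + (v i - q).2 by rewrite /=; ring.
    by rewrite h2 /rot90 /=; ring.
  split => //; apply: contra (vq i) => /eqP h; rewrite E h mul0r.
  by rewrite /line_arc !mul0r !addr0 -surjective_pairing.
have [i wi] : exists i, 0 < w i.
  apply: contrapT => /forallNP h; have : \sum_i w i = 0.
    apply: big1 => i _; apply/eqP; rewrite eq_le w0 andbT leNgt; apply/negP; exact: h.
  by rewrite w1; slra.
have [j [wj yj]] : exists j, 0 < w j /\ 0 < dot (v j - q) (rot90 m).
  apply: contrapT => /forallNP h.
  have wp k : true -> 0 <= w k * - dot (v k - q) (rot90 m).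
    move=> _; have [wk|wk] := ltP 0 (w k); last first.
      by have -> : w k = 0; [apply/eqP; rewrite eq_le wk w0|rewrite mul0r].
    rewrite mulr_ge0 // oppr_ge0 leNgt; apply/negP => hk; by apply: (h k).
  have : \sum_i w i * - dot (v i - q) (rot90 m) = 0.
    transitivity (- \sum_i w i * dot (v i - q) (rot90 m)); last by rewrite wy oppr0.
    by rewrite -sumrN; apply: eq_bigr => k _; rewrite mulrN.
  move=> /(psumr_eq0P wp) /(_ i isT) /eqP.
  by rewrite mulf_eq0 oppr_eq0 gt_eqF //= => h0; have [_] := onE i wi; rewrite h0.
have [k [wk yk]] : exists k, 0 < w k /\ dot (v k - q) (rot90 m) < 0.
  apply: contrapT => /forallNP h.
  have wp l : true -> 0 <= w l * dot (v l - q) (rot90 m).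
    move=> _; have [wk|wk] := ltP 0 (w l); last first.
      by have -> : w l = 0; [apply/eqP; rewrite eq_le wk w0|rewrite mul0r].
    rewrite mulr_ge0 // leNgt; apply/negP => hk; by apply: (h l).
  move: wy => /(psumr_eq0P wp) /(_ i isT) /eqP.
  by rewrite mulf_eq0 gt_eqF //= => h0; have [_] := onE i wi; rewrite h0.
have [vj _] := onE j wj; have [vk _] := onE k wk.
set a := _ / dot m m in vj; set b := _ / dot m m in vk.
have a0 : 0 < a by rewrite /a divr_gt0.
have b0 : b < 0 by rewrite /b pmulr_llt0 // invr_gt0.
apply: (@stable_of_edge q (Num.min a (- b))) => //.
  by rewrite lt_min a0 oppr_gt0.
move=> t; rewrite lt_min => /andP[ta tb].
have ab : a - b != 0 by rewrite gt_eqF //; slra.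
have := body_seg Hb (hull_vertex v k) (hull_vertex v j) (t := (t - b) / (a - b)).
move=> /(_ _)/wrap[].
  rewrite divr_ge0 ?ler_pdivrMr ?mul1r; move: ta tb; rewrite !ltr_norml; slra.
congr (H _); rewrite vj vk /line_arc /seg /=.
by congr pair; field.
Qed.

(** The l1 norm is a maximum of four linear forms, so that it can be handled by differentiating the
    forms one at a time, as in [corner_velocity]. *)
Definition nrm1 (x : R * R) : R := `|x.1| + `|x.2|.

(** Strictness at the finitely many other vertices gives a uniform cone: [M] dominates every ratio
    of [nrm1] to the depth below the perpendicular, and convex combinations inherit the bound. *)
Lemma corner_bound k : let q := v k in
  (forall i, v i != q -> dot (v i - q) (q - p) < 0) ->
  exists2 c : R, 0 < c & forall z, H z -> dot (z - q) (q - p) <= - c * nrm1 (z - q).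
Proof.
move=> q hv; pose D i := - dot (v i - q) (q - p).
pose M := 1 + \sum_i nrm1 (v i - q) / D i.
have N0 x : 0 <= nrm1 x by rewrite /nrm1 addr_ge0.
have D0 i : 0 <= D i.
  rewrite /D; have [->|/hv h] := eqVneq (v i) q; last by rewrite oppr_ge0 ltW.
  by rewrite subrr /dot /= !mul0r addr0 oppr0.
have M0 : 0 < M.
  by rewrite /M ltr_pwDl // sumr_ge0 // => i _; rewrite divr_ge0.
have ND i : nrm1 (v i - q) <= M * D i.
  have [->|vi] := eqVneq (v i) q.
    by rewrite subrr /nrm1 /= normr0 addr0 mulr_ge0 // ltW.
  have Dp : 0 < D i by rewrite /D oppr_gt0 hv.
  rewrite -ler_pdivrMr // /M (bigD1 i) //=.
  have : 0 <= \sum_(j < n | j != i) nrm1 (v j - q) / D j.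
    by apply: sumr_ge0 => j _; rewrite divr_ge0.
  by slra.
exists M^-1; first by rewrite invr_gt0.
move=> z [w [w0 w1 zE]].
rewrite zE (hull_dot v q _ w1) -zE mulNr lerNr.
have -> : - \sum_i w i * dot (v i - q) (q - p) = \sum_i w i * D i.
  by rewrite -sumrN; apply: eq_bigr => i _; rewrite /D mulrN.
rewrite mulrC ler_pdivrMr // mulr_suml.
have e1 : (z - q).1 = \sum_i w i * (v i - q).1.
  have := hull_dot v q (1, 0) w1; rewrite -zE /dot /= !mulr1 !mulr0 addr0 => ->.
  by apply: eq_bigr => i _; rewrite mulr1 mulr0 addr0.
have e2 : (z - q).2 = \sum_i w i * (v i - q).2.
  have := hull_dot v q (0, 1) w1; rewrite -zE /dot /= !mulr1 !mulr0 add0r => ->.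
  by apply: eq_bigr => i _; rewrite mulr1 mulr0 add0r.
rewrite /nrm1 e1 e2.
apply: (@le_trans _ _ (\sum_i w i * nrm1 (v i - q))).
  rewrite /nrm1; under [leRHS]eq_bigr do rewrite mulrDr.
  rewrite big_split /= lerD //; apply: le_trans (ler_norm_sum _ _ _) _;
    apply: ler_sum => i _; rewrite normrM ger0_norm //.
apply: ler_sum => i _; rewrite -mulrA ler_wpM2l //.
by rewrite mulrC.
Qed.

Lemma one_sided_derivative_le0 (f : R -> R) (a e : R) : is_derive (0 : R) 1 f a ->
  f 0 = 0 -> 0 < e -> (forall t, 0 <= t < e -> f t <= 0) -> a <= 0.
Proof.
move=> df f0 e0 fe; rewrite leNgt; apply/negP => a0.
have [d d0 Hd] := is_derive_pos df a0.
pose t := Num.min d e / 2.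
have t0 : 0 < t by rewrite /t divr_gt0 // lt_min d0.
have td : t < d by rewrite /t; have := ge_min d d e; rewrite lexx /=; slra.
have te : t < e by rewrite /t; have := ge_min e d e; rewrite lexx orbT; slra.
have := (Hd t ltac:(by rewrite gtr0_norm)).1 t0.
by have := fe t ltac:(slra); rewrite f0; slra.
Qed.

(** [nrm1] is not differentiable, but the cone inequality implies its linear versions with
    coefficients [a] and [b] in [-1, 1], which pass to the one-sided derivative. The signs of the
    coordinates of [u] then choose [a] and [b]. *)
Lemma corner_velocity k (g : R -> R * R) (u : R * R) (c e : R) : let q := v k in
  (forall z, H z -> dot (z - q) (q - p) <= - c * nrm1 (z - q)) -> 0 < c ->
  is_derive (0 : R) 1 g u -> g 0 = q -> 0 < e -> (forall t, 0 <= t < e -> H (g t)) ->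
  dot u (q - p) <= - c * nrm1 u.
Proof.
move=> q hc c0 dg g0 e0 Hg.
have key (a b : R) : `|a| <= 1 -> `|b| <= 1 -> dot u (q - p) + c * (a * u.1 + b * u.2) <= 0.
  move=> a1 b1.
  have dh := is_derive_subr q dg.
  have [d1 d2] := (is_derive_pair _ _ _).1 dh.
  have dc : is_derive (0 : R) (1 : R) (fun _ : R => q - p) 0 by exact: is_derive_cst.
  have d3 := is_derive_dot dh dc.
  have d4 : is_derive (0 : R) (1 : R) (fun t => dot (g t - q) (q - p) +
      c * (a * (g t - q).1 + b * (g t - q).2)) (dot u (q - p) + c * (a * u.1 + b * u.2)).
    have h := is_deriveD d3 (is_deriveZ c (is_deriveD (is_deriveZ a d1) (is_deriveZ b d2))).
    apply: (@is_derive_eq _ _ _ _ _ _ _ _ h).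
    rewrite /GRing.scale /=; congr (_ + _).
    by rewrite /dot /= !mulr0 !addr0.
  apply: (one_sided_derivative_le0 d4 _ e0).
    by rewrite g0 subrr /dot /=; ring.
  move=> t te; have := hc _ (Hg t te).
  set x := g t - q => h.
  have : a * x.1 + b * x.2 <= nrm1 x.
    apply: lerD; apply: le_trans (ler_norm _) _; rewrite normrM -[leRHS]mul1r;
      exact: ler_wpM2r.
  by move=> /(ler_wpM2l (ltW c0)); slra.
have [h1|h1] := leP 0 u.1; have [h2|h2] := leP 0 u.2.
- have := key 1 1 ltac:(by rewrite normr1) ltac:(by rewrite normr1).
  by rewrite /nrm1 (ger0_norm h1) (ger0_norm h2); slra.
- have := key 1 (-1) ltac:(by rewrite normr1) ltac:(by rewrite normrN normr1).
  by rewrite /nrm1 (ger0_norm h1) (ltr0_norm h2); slra.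
- have := key (-1) 1 ltac:(by rewrite normrN normr1) ltac:(by rewrite normr1).
  by rewrite /nrm1 (ltr0_norm h1) (ger0_norm h2); slra.
- have := key (-1) (-1) ltac:(by rewrite normrN normr1) ltac:(by rewrite normrN normr1).
  by rewrite /nrm1 (ltr0_norm h1) (ltr0_norm h2); slra.
Qed.

Lemma nrm1_gt0 (x : R * R) : x != 0 -> 0 < nrm1 x.
Proof.
move=> x0; rewrite lt_neqAle addr_ge0 // andbT eq_sym; apply: contra x0.
rewrite /nrm1 paddr_eq0 // !normr_eq0 => /andP[/eqP h1 /eqP h2].
by rewrite [x]surjective_pairing h1 h2.
Qed.

(** A smooth chart through the vertex can be traversed both ways, so its velocity and the opposite
    vector would both satisfy the inequality of [corner_velocity], which forces them to vanish. The
    same inequality makes every tangent direction acute. *)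
Lemma vertex_nondegenerate k : equilibrium H p (v k) ->
  (forall i, v i != v k -> dot (v i - v k) (v k - p) < 0) ->
  nondegenerate H p (v k).
Proof.
move=> eq hv; have [c c0 hc] := corner_bound hv.
have vp : v k != p.
  by have /(boundary_radP Hb iH)[t ->] := eq.1; exact: bpt_neq.
split.
  move=> [g cg]; exfalso.
  have [sg g0 cg0 g'0 [e e0 He]] := boundary_chart_near cg.
  have dg := smooth_is_derive 0 0 sg.
  have h1 := corner_velocity hc c0 dg g0 e0
    (fun t te => boundary_in Hb (He t ltac:(by rewrite ltr_norml; slra))).
  have [sg' g'E] := smooth_curve_shift 0 (-1) sg.
  have dg' := smooth_is_derive 0 0 sg'.
  have g0' : g (0 + -1 * 0) = v k by rewrite mulr0 addr0.
  rewrite derive1n1 g'E in dg'.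
  have Hg' t : 0 <= t < e -> H (g (0 + -1 * t)).
    by move=> te; apply/(boundary_in Hb)/He; rewrite ltr_norml; slra.
  have h2 := @corner_velocity k (fun s => g (0 + -1 * s)) _ c e hc c0 dg' g0' e0 Hg'.
  move: h1 h2; rewrite derive1n1.
  have := nrm1_gt0 g'0; set x := g^`()%classic 0 => x0.
  have -> : dot (-1 *: x) (v k - p) = - dot x (v k - p).
    by rewrite /dot /= /GRing.scale /=; ring.
  have -> : nrm1 (-1 *: x) = nrm1 x by rewrite /nrm1 /= !scaleN1r !normrN.
  have := mulr_gt0 c0 x0; rewrite !mulNr; slra.
move=> _ u [u0 [g [sg g0 g'0 [e e0 He]]]].
have dg := smooth_is_derive 0 0 sg.
have := corner_velocity hc c0 dg g0 e0 (fun t te => boundary_in Hb (He t te)).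
rewrite derive1n1 g'0 => h.
apply/acuteP => //; first by rewrite subr_eq0 eq_sym.
have -> : dot (p - v k) u = - dot u (v k - p) by rewrite /dot /=; ring.
have := mulr_gt0 c0 (nrm1_gt0 u0); move: h; rewrite mulNr; slra.
Qed.

Lemma hull_only_nondegenerate :
  (forall k, equilibrium H p (v k) ->
     forall i, v i != v k -> dot (v i - v k) (v k - p) < 0) ->
  only_nondegenerate H p.
Proof.
move=> hv q eq; have [[k kq]|/forallNP nv] := pselect (exists k, v k = q).
  by subst q; apply: vertex_nondegenerate => //; exact: hv.
have [_ [g cg dg]] : stable H p q by apply: nonvertex_stable => // i; apply/eqP; exact: nv.
split; first by move=> _; exists g => //; rewrite gt_eqF.
by move=> h; exfalso; apply: h; exists g.
Qed.

End HullEquilibria.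

(** * Chords and edges in polar coordinates *)

Section RayCrossing.
Variable R : realType.
Implicit Types (p : R * R) (a b t r s A B : R).

Lemma seg0 (x y : R * R) : seg x y 0 = x.
Proof. by rewrite /seg !mul0r !addr0 -surjective_pairing. Qed.

Lemma seg1 (x y : R * R) : seg x y 1 = y.
Proof. by rewrite /seg [RHS]surjective_pairing; congr pair; ring. Qed.

Lemma pair_subr_eq0 (x y : R * R) : x.1 - y.1 = 0 -> x.2 - y.2 = 0 -> x = y.
Proof.
by case: x y => [x1 x2] [y1 y2] /= /eqP + /eqP; rewrite !subr_eq0 => /eqP -> /eqP ->.
Qed.

(** The polar equation of a chord. If [r] is the radius of the crossing point, the triangles on its
    two sides add up: [A * r * sin (b - a) + r * s * sin (t - b) = A * s * sin (t - a)]. *)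
Lemma seg_ray p A s a b t : A * sin (b - a) + s * sin (t - b) != 0 ->
  seg (pol p A a) (pol p s t) (A * sin (b - a) / (A * sin (b - a) + s * sin (t - b))) =
  pol p (A * s * sin (t - a) / (A * sin (b - a) + s * sin (t - b))) b.
Proof.
move=> D0; rewrite /seg /pol /=; move: D0; set D := _ + _ => D0.
congr pair; apply/eqP; rewrite -subr_eq0 -(mulIr_eq0 _ (mulIf D0)); apply/eqP.
  transitivity ((A * cos a) * D + A * sin (b - a) * (s * cos t - A * cos a) -
    A * s * sin (t - a) * cos b); first by field.
  by rewrite /D !sinB; ring.
transitivity ((A * sin a) * D + A * sin (b - a) * (s * sin t - A * sin a) -
    A * s * sin (t - a) * sin b); first by field.
by rewrite /D !sinB; ring.
Qed.

Lemma ray_cross_gt0 A s a b t : 0 < A -> 0 < s -> a <= b <= t -> a < t < a + pi ->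
  0 < A * sin (b - a) + s * sin (t - b).
Proof.
move=> A0 s0 /andP[ab bt] /andP[at_ ta].
have h1 : 0 <= sin (b - a) by apply: sin_ge0_pi; lra.
have h2 : 0 <= sin (t - b) by apply: sin_ge0_pi; lra.
have [ba|ab'] := leP b a.
  have : 0 < sin (t - b) by apply: sin_gt0_pi; lra.
  by move=> /(mulr_gt0 s0); have := mulr_ge0 (ltW A0) h1; lra.
have : 0 < sin (b - a) by apply: sin_gt0_pi; lra.
by move=> /(mulr_gt0 A0); have := mulr_ge0 (ltW s0) h2; lra.
Qed.

Lemma ray_cross (K : set (R * R)) p A s a b t : convex_set K ->
  K (pol p A a) -> K (pol p s t) -> 0 < A -> 0 < s ->
  a <= b <= t -> a < t < a + pi ->
  K (pol p (A * s * sin (t - a) / (A * sin (b - a) + s * sin (t - b))) b).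
Proof.
move=> Kc Ka Ks A0 s0 abt ta; have D0 := ray_cross_gt0 A0 s0 abt ta.
rewrite -seg_ray ?gt_eqF //; apply: convex_set_seg => //.
have h1 : 0 <= A * sin (b - a).
  by rewrite mulr_ge0 ?(ltW A0) // sin_ge0_pi //; lra.
have h2 : 0 <= s * sin (t - b).
  by rewrite mulr_ge0 ?(ltW s0) // sin_ge0_pi //; lra.
by rewrite divr_ge0 ?(ltW D0) //= ler_pdivrMr // mul1r lerDl.
Qed.

Lemma sin_le0_2pi (x : R) : pi <= x <= 2 * pi -> sin x <= 0.
Proof.
move=> h; have -> : x = (x - pi) + pi by ring.
by rewrite sinDpi oppr_le0; apply: sin_ge0_pi; lra.
Qed.

Lemma cos_le0_itv (x : R) : pi / 2 <= x <= 3 * pi / 2 -> cos x <= 0.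
Proof.
move=> h; have -> : x = (x - pi) + pi by ring.
by rewrite cosDpi oppr_le0; apply: cos_ge0_pihalf; lra.
Qed.

End RayCrossing.

Section RadialEdge.
Variable R : realType.
Variables (K : set (R * R)) (p : R * R).
Hypotheses (Kb : convex_body K) (pK : K° p).
Implicit Types (q z : R * R) (s t a b r : R).
Local Notation rho := (rad K p).
Local Notation bp := (bpt K p).

Lemma chord_bound s t a b : 0 < s -> K (pol p s t) -> a < b < a + pi ->
  b <= t <= a + 2 * pi ->
  s * (rho b * sin (b - t) + rho a * sin (t - a)) <= rho a * rho b * sin (b - a).
Proof.
move=> s0 Ks ab bt; have A0 := rad_gt0 Kb pK a; have B0 := rad_gt0 Kb pK b.
have Kc : convex_set K by case: Kb.
have pi0 := @pi_gt0 R.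
have sd : 0 < sin (b - a) by apply: sin_gt0_pi; lra.
have AB : 0 < rho a * rho b * sin (b - a) by rewrite !mulr_gt0.
have sbt : sin (b - t) = - sin (t - b) by rewrite -sinN opprB.
have [t1|t1] := ltP t (a + pi).
  have D0 := @ray_cross_gt0 R (rho a) s a b t A0 s0 ltac:(lra) ltac:(lra).
  have P : 0 <= rho a * s * sin (t - a) / (rho a * sin (b - a) + s * sin (t - b)).
    rewrite divr_ge0 ?(ltW D0) // mulr_ge0 ?(ltW (mulr_gt0 A0 s0)) //.
    by apply: sin_ge0_pi; lra.
  have := ray_cross Kc (bpt_in Kb pK a) Ks A0 s0 (b := b) ltac:(lra) ltac:(lra).
  move=> /(rad_ge Kb pK P).
  rewrite ler_pdivrMr // sbt => h; nra.
have [t2|t2] := leP t (b + pi).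
  have h1 : sin (t - a) <= 0 by apply: sin_le0_2pi; lra.
  have h2 : 0 <= sin (t - b) by apply: sin_ge0_pi; lra.
  apply: le_trans (ltW AB); rewrite pmulr_rle0 // sbt.
  have := mulr_ge0 (ltW B0) h2; have := mulr_ge0_le0 (ltW A0) h1; lra.
have tE : t = (t - 2 * pi) + 2 * pi by ring.
set u := t - 2 * pi in tE.
have Ku : K (pol p s u) by move: Ks; rewrite tE pol_2pi.
have D0 := @ray_cross_gt0 R s (rho b) u a b s0 B0 ltac:(rewrite /u; lra) ltac:(rewrite /u; lra).
have P : 0 <= s * rho b * sin (b - u) / (s * sin (a - u) + rho b * sin (b - a)).
  rewrite divr_ge0 ?(ltW D0) // mulr_ge0 ?(ltW (mulr_gt0 s0 B0)) //.
  by apply: sin_ge0_pi; rewrite /u; lra.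
have := ray_cross Kc Ku (bpt_in Kb pK b) s0 B0 (b := a) ltac:(rewrite /u; lra) ltac:(rewrite /u; lra).
move=> /(rad_ge Kb pK P).
rewrite ler_pdivrMr //.
have -> : sin (b - t) = sin (b - u).
  have -> : b - u = (b - t) + pi *+ 2 by rewrite mulr2n /u; ring.
  by rewrite sinD2pi.
have -> : sin (t - a) = - sin (a - u).
  have -> : t - a = - (a - u) + pi *+ 2 by rewrite mulr2n /u; ring.
  by rewrite sinD2pi sinN.
by move=> h; nra.
Qed.

Variables (a b : R).
Hypothesis ab : a < b < a + pi.
Hypothesis below : forall s t, K (pol p s t) ->
  s * (rho b * sin (b - t) + rho a * sin (t - a)) <= rho a * rho b * sin (b - a).

(** Under [below] the chord from [bp a] to [bp b] is an edge: a point of [K] on that line has the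
    largest radius that its direction allows. *)
Lemma edge_rad r t : 0 < r -> K (pol p r t) -> a <= t <= b ->
  r * (rho b * sin (b - t) + rho a * sin (t - a)) = rho a * rho b * sin (b - a) ->
  pol p r t = bp t.
Proof.
have ab' := ab; move=> r0 Kr t1 E; congr pol.
have A0 := rad_gt0 Kb pK a; have B0 := rad_gt0 Kb pK b.
have D0 := @ray_cross_gt0 R (rho a) (rho b) a t b A0 B0 t1 ab.
apply/eqP; rewrite eq_le (rad_ge Kb pK (ltW r0) Kr) /=.
by rewrite -(ler_pM2r D0) [X in _ <= r * X]addrC E addrC below //; exact: bpt_in.
Qed.

Lemma edge_at t : a <= t <= b ->
  exists2 l, 0 <= l <= 1 & seg (bp a) (bp b) l = bp t.
Proof.
have ab' := ab; move=> t1; have A0 := rad_gt0 Kb pK a; have B0 := rad_gt0 Kb pK b.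
have Kc : convex_set K by case: Kb.
have D0 := @ray_cross_gt0 R (rho a) (rho b) a t b A0 B0 t1 ab.
exists (rho a * sin (t - a) / (rho a * sin (t - a) + rho b * sin (b - t))).
  have h1 : 0 <= rho a * sin (t - a).
    by rewrite mulr_ge0 ?(ltW A0) // sin_ge0_pi //; lra.
  have h2 : 0 <= rho b * sin (b - t).
    by rewrite mulr_ge0 ?(ltW B0) // sin_ge0_pi //; lra.
  by rewrite divr_ge0 ?(ltW D0) //= ler_pdivrMr // mul1r lerDl.
rewrite /bpt seg_ray ?gt_eqF //; apply: edge_rad => //.
- by rewrite divr_gt0 // !mulr_gt0 // sin_gt0_pi //; lra.
- by apply: ray_cross => //; exact: bpt_in.
- by rewrite [X in _ * X = _]addrC divfK // gt_eqF.
Qed.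

Lemma edge_point l : 0 <= l < 1 ->
  exists2 t, a <= t < b & seg (bp a) (bp b) l = bp t.
Proof.
have ab' := ab; move=> l1; have A0 := rad_gt0 Kb pK a; have B0 := rad_gt0 Kb pK b.
have [t [r [t1 r0 zE]]] := polar_exists p (seg (bp a) (bp b) l) a.
have sd : 0 < sin (b - a) by apply: sin_gt0_pi; lra.
have [e1 e2] : r * cos t = (1 - l) * (rho a * cos a) + l * (rho b * cos b) /\
    r * sin t = (1 - l) * (rho a * sin a) + l * (rho b * sin b).
  move: zE; rewrite /seg /bpt /pol /= => -[h1 h2]; split.
    by apply: (addrI p.1); rewrite -h1; ring.
  by apply: (addrI p.2); rewrite -h2; ring.
have s1 : r * sin (t - a) = l * rho b * sin (b - a).
  rewrite !sinB; transitivity ((r * sin t) * cos a - (r * cos t) * sin a); first by ring.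
  by rewrite e1 e2; ring.
have s2 : r * sin (b - t) = (1 - l) * rho a * sin (b - a).
  rewrite !sinB; transitivity (sin b * (r * cos t) - cos b * (r * sin t)); first by ring.
  by rewrite e1 e2; ring.
have l0 : 0 <= l by case/andP: l1.
have l1' : 0 < 1 - l by lra.
have s2p : 0 < r * sin (b - t) by rewrite s2 !mulr_gt0.
have rp : 0 < r.
  by rewrite lt_neqAle r0 andbT eq_sym; apply: contraTneq s2p => ->; rewrite mul0r ltxx.
have s2' : 0 < sin (b - t) by rewrite -(pmulr_rgt0 _ rp).
have s1' : 0 <= sin (t - a).
  by rewrite -(pmulr_rge0 _ rp) s1 !mulr_ge0 // ltW.
have pi0 := @pi_gt0 R.
have ta : t <= a + pi.
  rewrite leNgt; apply/negP => h.
  have : 0 < sin (t - a - pi) by apply: sin_gt0_pi; lra.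
  have E : sin (t - a) = - sin (t - a - pi) by rewrite -sinDpi subrK.
  by move: s1'; rewrite E; lra.
have tb : t < b.
  rewrite ltNge; apply/negP => h.
  have : 0 <= sin (t - b) by apply: sin_ge0_pi; lra.
  by move: s2'; rewrite -opprB sinN; lra.
exists t; first by lra.
rewrite zE; apply: edge_rad => //; last 1 first.
- rewrite mulrDr mulrCA s2 [X in _ + X]mulrCA s1; ring.
- rewrite -zE; apply: body_seg => //; [exact: bpt_in|exact: bpt_in|lra].
- lra.
Qed.

End RadialEdge.

(** * The boundary arcs of a polygon *)

Section HullBoundary.
Variable R : realType.
Variables (n : nat) (v : 'I_n -> R * R) (p : R * R).
Local Notation H := (convex_hull v).
Hypothesis iH : H° p.
Implicit Types (q z a b d : R * R) (s t u : R).
Local Notation rho := (rad H p).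
Local Notation bp := (bpt H p).

Let Hb : convex_body H := hull_body iH.

(** As [p] is interior, the vertices surround it; this bounds the angular gaps between them. *)
Lemma vertex_not_halfplane (m : R) : exists i, 0 < dot (v i - p) (cos m, sin m).
Proof.
apply: contrapT => /forallNP h; have [r r0 Hr] := interior_pol iH.
have : H (pol p (r / 2) m) by apply: Hr; rewrite gtr0_norm; lra.
move=> [w [w0 w1 E]].
have : dot (pol p (r / 2) m - p) (cos m, sin m) = r / 2.
  rewrite /dot /pol /=; have cs := cos2Dsin2 m.
  transitivity (r / 2 * (cos m ^+ 2 + sin m ^+ 2)); first by ring.
  by rewrite cs mulr1.
rewrite E (hull_dot v p _ w1) => E2.
have : \sum_i w i * dot (v i - p) (cos m, sin m) <= 0.
  by apply: sumr_le0 => i _; rewrite mulr_ge0_le0 // leNgt; apply/negP; exact: h.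
by rewrite E2; lra.
Qed.

Let angP i : exists ts : R * R, [/\ 0 <= ts.1 < 2 * pi, 0 <= ts.2 & v i = pol p ts.2 ts.1].
Proof.
have [t [s [t2 s0 vE]]] := polar_exists p (v i) 0.
by exists (t, s); split => //; rewrite /=; lra.
Qed.

Let ang i : R := (xget (0, 0) [set ts : R * R | [/\ 0 <= ts.1 < 2 * pi, 0 <= ts.2 & v i = pol p ts.2 ts.1]]).1.

Let ang_spec i : 0 <= ang i < 2 * pi /\ (v i != p -> exists2 s, 0 < s & v i = pol p s (ang i)).
Proof.
rewrite /ang; case: xgetP => [[t s] _ /= [t2 s0 vE]|]; last first.
  by have [ts h] := angP i; move=> /(_ ts).
split => // vp; exists s => //; rewrite lt_neqAle s0 andbT eq_sym.
apply: contra vp => /eqP s00.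
by rewrite vE s00 /pol !mul0r !addr0 -surjective_pairing.
Qed.

(** Only the directions of the vertices matter: a vertex may be interior to the hull or share its
    ray with another, but over the gap between consecutive directions the boundary is still one
    segment. *)
Let L := sort <=%R (undup [seq ang i | i <- enum 'I_n & v i != p]).
Let N := size L.
Let th i : R := if (i < N)%N then nth 0 L i else nth 0 L 0 + 2 * pi.

Let L_mem i : v i != p -> ang i \in L.
Proof.
move=> vp; rewrite mem_sort mem_undup; apply: map_f.
by rewrite mem_filter vp mem_enum.
Qed.

Let N0 : (0 < N)%N.
Proof.
have [i hi] := vertex_not_halfplane 0.
have vp : v i != p.
  apply: contraTneq hi => ->; rewrite subrr /dot /= !mul0r addr0; by rewrite ltxx.
have := L_mem vp; rewrite /N; case: (L) => //.
Qed.

Let L_range t : t \in L -> 0 <= t < 2 * pi.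
Proof.
by rewrite mem_sort mem_undup => /mapP[i _ ->]; exact: (ang_spec i).1.
Qed.

Let th_range i : (i < N)%N -> 0 <= th i < 2 * pi.
Proof. by move=> iN; rewrite /th iN; apply: L_range; exact: mem_nth. Qed.

Let thN : th N = th 0%N + 2 * pi.
Proof. by rewrite /th ltnn N0. Qed.

Let th_lt i : (i < N)%N -> th i < th i.+1.
Proof.
move=> iN; have h := th_range iN; have h0 := th_range N0.
have [iN1|iN1] := ltnP i.+1 N; last first.
  have -> : i.+1 = N by apply/eqP; rewrite eqn_leq iN1 iN.
  by rewrite thN; lra.
rewrite /th iN iN1; apply: (sorted_ltn_nth lt_trans) => //.
by rewrite sort_lt_sorted undup_uniq.
Qed.

Let th_mono i j : (i <= j)%N -> (j <= N)%N -> th i <= th j.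
Proof.
move=> ij jN; elim: j ij jN => [|j IH]; first by rewrite leqn0 => /eqP ->.
rewrite leq_eqVlt ltnS => /predU1P[-> //|ij] jN.
by apply: le_trans (IH ij (ltnW jN)) _; apply: ltW; exact: th_lt.
Qed.

Let th_vertex i : v i != p -> exists2 j, (j < N)%N & th j = ang i.
Proof.
move=> /L_mem h; exists (index (ang i) L); first by rewrite index_mem.
by rewrite /th index_mem h nth_index.
Qed.

(** A gap of at least [pi] would leave every vertex in the closed half-plane opposite to its
    bisector [m]. *)
Let th_gap i : (i < N)%N -> th i.+1 < th i + pi.
Proof.
move=> iN; rewrite ltNge; apply/negP => gap.
set m := (th i + th i.+1) / 2.
have [k hk] := vertex_not_halfplane m.
have vp : v k != p.
  apply: contraTneq hk => ->; rewrite subrr /dot /= !mul0r addr0; by rewrite ltxx.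
have [_ /(_ vp)[s s0 vE]] := ang_spec k.
have [j jN jE] := th_vertex vp.
have : 0 < s * cos (th j - m).
  move: hk; rewrite vE -jE /dot /pol /= cosB; congr (_ < _); ring.
rewrite pmulr_rgt0 // ltNge => /negP; apply.
have h0 := th_range N0; have hi := th_mono (leq0n i) (ltnW iN).
have hi1 : th i.+1 <= th N by apply: th_mono.
rewrite thN in hi1.
have [ji|ij] := leqP j i.
  have h1 := th_mono ji (ltnW iN); have h2 := th_mono (leq0n j) (ltnW jN).
  by rewrite -cosN; apply: cos_le0_itv; rewrite /m; lra.
have h1 := th_mono ij (ltnW jN).
have h2 : th j <= th N by apply: th_mono => //; exact: ltnW.
rewrite thN in h2.
by apply: cos_le0_itv; rewrite /m; lra.
Qed.

(** The bound is linear in the point, so it suffices to test it at the vertices. None of their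
    directions lies strictly inside the gap, hence [chord_bound] applies to them, after one full
    turn if they precede it. *)
Let edge_below i : (i < N)%N -> forall s t, H (pol p s t) ->
  s * (rho (th i.+1) * sin (th i.+1 - t) + rho (th i) * sin (t - th i)) <=
  rho (th i) * rho (th i.+1) * sin (th i.+1 - th i).
Proof.
move=> iN s t; set a := th i; set b := th i.+1.
have ab : a < b < a + pi by rewrite th_lt //= th_gap.
have A0 := rad_gt0 Hb iH a; have B0 := rad_gt0 Hb iH b.
(* A normal vector of the chord, which turns the left side into a scalar product with the point. *)
pose M : R * R := (rho b * sin b - rho a * sin a, rho a * cos a - rho b * cos b).
have ME s' t' : s' * (rho b * sin (b - t') + rho a * sin (t' - a)) = dot (pol p s' t' - p) M.
  by rewrite /dot /pol /M /= !sinB; ring.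
rewrite ME => -[w [w0 w1 ->]]; rewrite (hull_dot v p _ w1).
rewrite -[leRHS]mul1r -w1 mulr_suml; apply: ler_sum => k _; rewrite ler_wpM2l //.
have [->|vp] := eqVneq (v k) p.
  rewrite subrr /dot /= !mul0r addr0 mulr_ge0 // ?mulr_ge0 ?ltW //.
  by apply: sin_gt0_pi; lra.
have [_ /(_ vp)[r r0 vE]] := ang_spec k.
have Hv : H (pol p r (ang k)) by rewrite -vE; exact: hull_vertex.
rewrite vE -ME.
have [j jN jE] := th_vertex vp.
have hi := th_mono (leq0n i) (ltnW iN).
have hi1 : b <= th N by apply: th_mono.
rewrite thN in hi1.
have [ji|ij] := leqP j i.
  have h1 := th_mono ji (ltnW iN); have h2 := th_mono (leq0n j) (ltnW jN).
  have Hv' : H (pol p r (ang k + 2 * pi)) by rewrite pol_2pi.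
  have := chord_bound Hb iH r0 Hv' ab; rewrite -jE => /(_ ltac:(rewrite /a; lra)).
  have -> : b - (th j + 2 * pi) = (b - th j) - pi *+ 2 by rewrite mulr2n; ring.
  have -> : th j + 2 * pi - a = (th j - a) + pi *+ 2 by rewrite mulr2n; ring.
  by rewrite sinD2pi -[in sin (b - th j)](subrK (pi *+ 2) (b - th j)) sinD2pi.
have h1 := th_mono ij (ltnW jN).
have h2 : th j <= th N by apply: th_mono => //; exact: ltnW.
rewrite thN in h2.
rewrite -/b in h1.
by apply: (chord_bound Hb iH) => //; rewrite -jE /a; lra.
Qed.

Let W i := bp (th i).
Let gam (s : R) : R * R := let i := Num.truncn s in seg (W i) (W i.+1) (s - i%:R).

Let gamE (i : nat) (s : R) : i%:R <= s <= i.+1%:R -> gam s = seg (W i) (W i.+1) (s - i%:R).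
Proof.
move=> /andP[s0]; rewrite le_eqVlt => /predU1P[->|s1].
  rewrite /gam natrK subrr.
  have -> : i.+1%:R - i%:R = 1 :> R by rewrite -natrB // subSnn.
  by rewrite seg0 seg1.
by rewrite /gam (truncn_def (n := i)) // s0.
Qed.

Let gam_bp (i : nat) (s : R) : (i < N)%N -> i%:R <= s < i.+1%:R ->
  exists2 t, th i <= t < th i.+1 & gam s = bp t.
Proof.
move=> iN s1; rewrite (@gamE i) /W; last by case/andP: s1 => -> /ltW ->.
apply: (edge_point Hb iH); [by rewrite th_lt //= th_gap|exact: edge_below|].
by move: s1; rewrite -natr1; lra.
Qed.

Let window (t : R) (k : nat) : (k <= N)%N -> th 0%N <= t < th k ->
  exists2 i, (i < k)%N & th i <= t < th i.+1.
Proof. by move=> kN; apply: param_arc => i ik; apply: th_lt; exact: leq_trans kN. Qed.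

Lemma hull_piecewise_smooth : piecewise_smooth_boundary H.
Proof.
have pi0 := @pi_gt0 R.
exists gam, N, (fun i => i%:R); split.
- exact: N0.
- move=> i iN; split; first by rewrite ltr_nat.
  pose d := ((W i.+1).1 - (W i).1, (W i.+1).2 - (W i).2).
  exists (line_arc ((W i).1 - i%:R * d.1, (W i).2 - i%:R * d.2) d).
  split; first exact: smooth_line_arc.
  move=> s s1; split.
    by rewrite (gamE s1) /line_arc /seg /=; congr pair; rewrite /d /=; ring.
  rewrite derive1_line_arc; apply/negP => /eqP [d1 d2].
  have : W i.+1 = W i by exact: pair_subr_eq0.
  rewrite /W /bpt => /(pol_inj (rad_gt0 Hb iH _) (rad_gt0 Hb iH _)) [].
    have h1 := th_lt iN; have h2 := th_gap iN; rewrite gtr0_norm; lra.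
  by move=> _ E; have := th_lt iN; rewrite E ltxx.
- have N1 : (N.-1 < N)%N by rewrite prednK // N0.
  have NE : N = N.-1.+1 by rewrite prednK // N0.
  rewrite (@gamE N.-1); last by rewrite -NE lexx ler_nat leq_pred.
  rewrite (@gamE 0%N); last by rewrite lexx ler_nat.
  rewrite -NE subrr seg0.
  have -> : N%:R - N.-1%:R = 1 :> R by rewrite -natrB ?leq_pred // {1}NE subSnn.
  by rewrite seg1 /W thN /bpt rad_2pi pol_2pi.
(* Injectivity goes through angles: the angle of a boundary point determines its edge, on which the
   parametrization is affine. *)
- have key (s : R) : 0 <= s < N%:R -> exists i, [/\ (i < N)%N, i%:R <= s < i.+1%:R &
     exists2 t, th i <= t < th i.+1 & gam s = bp t].
    move=> /andP[s0 sN]; exists (Num.truncn s); have h := truncn_itv s0.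
    have h2 : (Num.truncn s < N)%N by rewrite truncn_lt_nat.
    by split => //; exact: gam_bp.
  move=> s s'; rewrite !inE /= !in_itv /= => /key[i [iN is1 [t ti E]]] /key[i' [i'N is1' [t' ti' E']]] ss.
  have hi := th_mono (leq0n i) (ltnW iN); have hi1 : th i.+1 <= th N by apply: th_mono.
  have hi' := th_mono (leq0n i') (ltnW i'N); have hi1' : th i'.+1 <= th N by apply: th_mono.
  have tt : t = t'.
    move: ss; rewrite E E' /bpt => /(pol_inj (rad_gt0 Hb iH _) (rad_gt0 Hb iH _)) [] //.
    by rewrite thN in hi1 hi1'; rewrite ltr_norml; lra.
  have ii : i = i'.
    apply/eqP; rewrite eqn_leq; apply/andP; split; rewrite leqNgt; apply/negP => lt.
      by have := th_mono lt (ltnW iN); rewrite tt in ti; lra.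
    by have := th_mono lt (ltnW i'N); rewrite tt in ti; lra.
  subst i'; move: ss; rewrite (@gamE i) ?(@gamE i s'); last 2 first.
    by case/andP: is1' => -> /ltW ->.
    by case/andP: is1 => -> /ltW ->.
  rewrite /seg => -[/addrI h1 /addrI h2].
  have [d1|d1] := eqVneq ((W i.+1).1 - (W i).1) 0; last first.
    by move/(mulIf d1)/addIr : h1.
  have [d2|d2] := eqVneq ((W i.+1).2 - (W i).2) 0; last first.
    by move/(mulIf d2)/addIr : h2.
  have : W i.+1 = W i by exact: pair_subr_eq0.
  rewrite /W /bpt => /(pol_inj (rad_gt0 Hb iH _) (rad_gt0 Hb iH _)) [].
    have g1 := th_lt iN; have g2 := th_gap iN; rewrite gtr0_norm; lra.
  by move=> _ E2; have := th_lt iN; rewrite E2 ltxx.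
apply/seteqP; split => z.
  move=> [s /=]; rewrite in_itv /= => /andP[s0]; rewrite le_eqVlt => /predU1P[->|sN] <-.
    have N1 : (N.-1 < N)%N by rewrite prednK // N0.
    have NE : N = N.-1.+1 by rewrite prednK // N0.
    rewrite (@gamE N.-1); last by rewrite -NE lexx ler_nat leq_pred.
    have -> : N%:R - N.-1%:R = 1 :> R by rewrite -natrB ?leq_pred // {1}NE subSnn.
    by rewrite seg1; exact: boundary_pol.
  have h := truncn_itv s0.
  have h2 : (Num.truncn s < N)%N by rewrite truncn_lt_nat.
  by have [t _ ->] := gam_bp h2 h; exact: boundary_pol.
move=> /(boundary_radP Hb iH)[t ->].
have [u [s [u1 s0 E]]] := polar_exists p (bp t) (th 0%N).
have sp : 0 < s.
  rewrite lt_neqAle s0 andbT eq_sym; apply: contra (bpt_neq Hb iH t) => /eqP s00.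
  by rewrite E s00 /pol !mul0r !addr0 -surjective_pairing.
have su : s = rho u.
  have : boundary H (pol p s u) by rewrite -E; exact: boundary_pol.
  move=> bz; apply/eqP; rewrite eq_le (rad_ge Hb iH) //=; last exact: boundary_in bz.
  rewrite leNgt; apply/negP => h; case: bz => _; apply.
  by apply/(interior_radP Hb iH).
have [i iN i1] := @window u N (leqnn N) ltac:(by rewrite thN).
have ab : th i < th i.+1 < th i + pi by rewrite th_lt //= th_gap.
have [l l1 El] := edge_at Hb iH ab (edge_below iN) (t := u) ltac:(lra).
exists (i%:R + l).
  rewrite /= in_itv /=; apply/andP; split; first by rewrite addr_ge0 ?ler0n //; lra.
  have : i.+1%:R <= N%:R :> R by rewrite ler_nat.
  by rewrite -natr1; lra.
rewrite (@gamE i); last by rewrite -natr1; lra.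
rewrite addrAC subrr add0r; transitivity (bp u); first exact: El.
by rewrite {1}/bpt -su -E.
Qed.

End HullBoundary.

(** * Sorted enumerations of finite sets of angles *)

Section FiniteRealSets.
Local Open Scope card_scope.
Variable R : realType.
Implicit Types (B : set R) (L : seq R).

Lemma seq_set_card (s : seq R) : uniq s ->
  [set` s] #= `I_(size s).
Proof.
move=> us; have E : [set` s] = nth 0 s @` `I_(size s).
  apply/seteqP; split => x /=.
    by move=> xs; exists (index x s); rewrite ?index_mem // nth_index.
  by move=> [i /= i1 <-]; exact: mem_nth.
rewrite E; apply: inj_card_eq => i j; rewrite !inE /= => i1 j1 /eqP.
by rewrite nth_uniq // => /eqP.
Qed.

Lemma sorted_enum B n : B #= `I_n ->
  exists L, [/\ sorted <%R L, size L = n & forall t, B t <-> t \in L].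
Proof.
move=> Bn; have /finite_seqP[s sE] : finite_set B by apply/finite_setP; exists n.
exists (sort <=%R (undup s)).
have mE t : B t <-> t \in sort <=%R (undup s) by rewrite sE mem_sort mem_undup.
split => //; first by rewrite sort_lt_sorted undup_uniq.
have := @seq_set_card (sort <=%R (undup s)).
rewrite sort_uniq undup_uniq => /(_ isT).
have -> : [set` sort <=%R (undup s)] = B by apply/seteqP; split => t /mE.
by move=> h; apply/esym/card_eq_II; rewrite -(card_eql Bn).
Qed.

Lemma sorted_sub B n : `I_n #<= B ->
  exists L, [/\ sorted <%R L, size L = n & forall t, t \in L -> B t].
Proof.
move=> /pcard_leP/injfunPex[f fB fi].
exists (sort <=%R [seq f i | i <- iota 0 n]); split.
- rewrite sort_lt_sorted map_inj_in_uniq ?iota_uniq // => i j.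
  by rewrite !mem_iota !add0n => /andP[_ i1] /andP[_ j1] ff; apply: fi; rewrite ?inE.
- by rewrite size_sort size_map size_iota.
move=> t; rewrite mem_sort => /mapP[i]; rewrite mem_iota add0n => /andP[_ i1] ->.
exact: fB.
Qed.

(** Index [size L] gives the first angle one turn later, so that the gaps between consecutive values
    make up a full circle. *)
Definition cyc_nth L (i : nat) : R :=
  if (i < size L)%N then nth 0 L i else nth 0 L 0 + 2 * pi.

Lemma cyc_nth_lt L a i : sorted <%R L -> (forall t, t \in L -> a <= t < a + 2 * pi) ->
  (i < size L)%N -> cyc_nth L i < cyc_nth L i.+1.
Proof.
move=> sL La iL; have L0 : (0 < size L)%N by apply: leq_trans iL.
rewrite /cyc_nth iL; case: ltnP => h.
  exact: (sorted_ltn_nth lt_trans).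
have := La _ (mem_nth 0 iL); have := La _ (mem_nth 0 L0); slra.
Qed.

Lemma seq_mono_le (N : nat) (th : nat -> R) : (forall i, (i < N)%N -> th i < th i.+1) ->
  forall i j, (i <= j)%N -> (j <= N)%N -> th i <= th j.
Proof.
move=> lt i j; elim: j => [|j IH]; first by rewrite leqn0 => /eqP ->.
rewrite leq_eqVlt ltnS => /predU1P[-> //|ij] jN.
by apply: le_trans (IH ij (ltnW jN)) _; apply: ltW; exact: lt.
Qed.

End FiniteRealSets.

(** * Extrema on an interval *)

Section Extrema1D.
Local Open Scope card_scope.
Variable R : realType.
Implicit Types (f : R -> R) (a b c : R).

Lemma interior_max f a b c d : continuous f -> a < b -> a <= c <= b -> f a < f c ->
  a <= d <= b -> f b < f d ->
  exists2 m, a < m < b & forall u, a <= u <= b -> f u <= f m.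
Proof.
move=> cf ab c1 fc d1 fd.
have [m m1 Hm] := EVT_max (ltW ab) (continuous_subspaceT cf).
have {}Hm u : a <= u <= b -> f u <= f m by move=> h; apply: Hm; rewrite in_itv.
exists m => //; move: m1; rewrite in_itv /= => /andP[am mb].
rewrite !lt_neqAle am mb !andbT; apply/andP; split; apply/eqP => E.
  by have := Hm c c1; rewrite -E; slra.
by have := Hm d d1; rewrite E; slra.
Qed.

Lemma interior_min f a b c : continuous f -> a < b -> a <= c <= b -> f c < f a ->
  f c < f b -> exists2 m, a < m < b & forall u, a <= u <= b -> f m <= f u.
Proof.
move=> cf ab c1 fa fb.
have cN : continuous (fun x => - f x) by move=> x; apply: cvgN; exact: cf.
have [||m m1 Hm] := interior_max cN ab c1 _ c1 _; rewrite ?ltrN2 //.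
by exists m => // u /Hm; rewrite lerN2.
Qed.

Lemma near_of_itv (P : R -> Prop) a b m : a < m < b -> (forall u, a <= u <= b -> P u) ->
  \forall u \near m, P u.
Proof.
move=> m1 H; apply/nbhs_ball_real; exists (Num.min (m - a) (b - m)).
  by rewrite lt_min; slra.
by move=> u; rewrite lt_min !ltr_norml => /andP[h1 h2]; apply: H; slra.
Qed.

Lemma strict_min_right f a b : (\forall u \near a, u != a -> f a < f u) -> a < b ->
  exists2 c, a < c < b & f a < f c.
Proof.
move=> /nbhs_ball_real[e e0 He] ab.
pose d := Num.min e (b - a) / 2.
have d0 : 0 < d by rewrite /d divr_gt0 // lt_min e0 subr_gt0.
have de : d < e by rewrite /d; have := ge_min e e (b - a); rewrite lexx /=; slra.
have db : d < b - a by rewrite /d; have := ge_min (b - a) e (b - a); rewrite lexx orbT; slra.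
exists (a + d); first slra.
apply: He; first by rewrite addrAC subrr add0r gtr0_norm.
by rewrite -subr_eq0 addrAC subrr add0r gt_eqF.
Qed.

Lemma strict_min_left f a b : (\forall u \near b, u != b -> f b < f u) -> a < b ->
  exists2 c, a < c < b & f b < f c.
Proof.
move=> /nbhs_ball_real[e e0 He] ab.
pose d := Num.min e (b - a) / 2.
have d0 : 0 < d by rewrite /d divr_gt0 // lt_min e0 subr_gt0.
have de : d < e by rewrite /d; have := ge_min e e (b - a); rewrite lexx /=; slra.
have db : d < b - a by rewrite /d; have := ge_min (b - a) e (b - a); rewrite lexx orbT; slra.
exists (b - d); first slra.
apply: He; first by rewrite addrAC subrr add0r normrN gtr0_norm.
by rewrite -subr_eq0 addrAC subrr add0r oppr_eq0 gt_eqF.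
Qed.

(** Strict minima at both ends push the maximum inside. A descent before [m] or an ascent after it
    would enclose an interior local minimum. *)
Lemma unimodal f a b : continuous f -> a < b ->
  (\forall u \near a, u != a -> f a < f u) -> (\forall u \near b, u != b -> f b < f u) ->
  (forall m, a < m < b -> ~ \forall u \near m, f m <= f u) ->
  exists m, [/\ a < m < b, forall u, a <= u <= b -> f u <= f m,
    forall x y, a <= x <= y -> y <= m -> f x <= f y &
    forall x y, m <= x <= y -> y <= b -> f y <= f x].
Proof.
move=> cf ab sa sb nomin.
have [c c1 fc] := strict_min_right sa ab; have [d d1 fd] := strict_min_left sb ab.
have [m m1 Hm] := interior_max cf ab (c := c) (d := d) ltac:(slra) fc ltac:(slra) fd.
exists m; split => //.
  move=> x y x1 ym; rewrite leNgt; apply/negP => fyx.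
  have xy : x < y.
    by rewrite lt_neqAle; apply/andP; split; [apply: contraTneq fyx => ->; rewrite ltxx|slra].
  have fm : f y < f m by have := Hm x ltac:(slra); slra.
  have ym' : y < m.
    by rewrite lt_neqAle ym andbT; apply: contraTneq fm => ->; rewrite ltxx.
  have lt1 : x < m by slra.
  have [k k1 Hk] := interior_min cf lt1 (c := y) ltac:(slra) fyx fm.
  by apply: (nomin k); [slra|exact: near_of_itv k1 Hk].
move=> x y x1 yb; rewrite leNgt; apply/negP => fxy.
have xy : x < y.
  by rewrite lt_neqAle; apply/andP; split; [apply: contraTneq fxy => ->; rewrite ltxx|slra].
have fm : f x < f m by have := Hm y ltac:(slra); slra.
have xm : m < x.
  rewrite lt_neqAle; apply/andP; split; last slra.
  by apply: contraTneq fm => ->; rewrite ltxx.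
have lt1 : m < y by slra.
  have [k k1 Hk] := interior_min cf lt1 (c := x) ltac:(slra) fm fxy.
by apply: (nomin k); [slra|exact: near_of_itv k1 Hk].
Qed.

End Extrema1D.

(** * Counting stable points *)

Section StableAngles.
Local Open Scope card_scope.
Variable R : realType.
Variables (K : set (R * R)) (p : R * R).
Hypotheses (Kb : convex_body K) (pK : K° p).
Implicit Types (q z : R * R) (s t u a b : R).
Local Notation rho := (rad K p).
Local Notation bp := (bpt K p).

Definition stang t := stable K p (bp t).

Lemma bpt_2pi t : bp (t + 2 * pi) = bp t.
Proof. by rewrite /bpt rad_2pi pol_2pi. Qed.

Lemma bpt_inj t u : `|t - u| < 2 * pi -> bp t = bp u -> t = u.
Proof. by move=> tu /(pol_inj (rad_gt0 Kb pK _) (rad_gt0 Kb pK _))[]. Qed.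

Lemma bpt_window q a : boundary K q -> exists2 t, a <= t < a + 2 * pi & q = bp t.
Proof.
move=> /(boundary_radP Kb pK)[t ->].
have [u [s [u1 s0 E]]] := polar_exists p (bp t) a.
exists u => //; rewrite -/(bp t) E /bpt; congr pol.
have bz : boundary K (pol p s u) by rewrite -E; exact: boundary_pol.
apply/eqP; rewrite eq_le (rad_ge Kb pK) //=; last exact: boundary_in bz.
rewrite leNgt; apply/negP => h; case: bz => _; apply.
by apply/(interior_radP Kb pK).
Qed.

Lemma stable_set_angles a :
  [set q | stable K p q] #= [set t | a <= t < a + 2 * pi /\ stang t].
Proof.
have -> : [set q | stable K p q] = bp @` [set t | a <= t < a + 2 * pi /\ stang t].
  apply/seteqP; split => q /=.
    move=> sq; have [t t1 qE] := @bpt_window q a sq.1.1.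
    by exists t => //; split => //; rewrite /stang -qE.
  by move=> [t [_ st] <-].
apply: inj_card_eq => t u; rewrite !inE /= => -[t1 _] [u1 _]; apply: bpt_inj.
by rewrite ltr_norml; slra.
Qed.

Lemma stable_window S a : has_stable_points K p S -> (0 < S)%N -> stang a ->
  exists th : nat -> R, [/\ th 0%N = a, th S = a + 2 * pi,
    forall i, (i < S)%N -> th i < th i.+1,
    forall i, (i <= S)%N -> stang (th i) &
    forall i t, (i < S)%N -> th i < t < th i.+1 -> ~ stang t].
Proof.
move=> hS S0 sa; have pi0 := @pi_gt0 R.
have := hS; rewrite /has_stable_points (card_eql (stable_set_angles a)).
move=> /sorted_enum[L [sL sz LB]].
have La t : t \in L -> a <= t < a + 2 * pi by move=> /LB[].
have lt i : (i < S)%N -> cyc_nth L i < cyc_nth L i.+1.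
  by move=> iS; apply: cyc_nth_lt sL La _; rewrite sz.
have mono := seq_mono_le lt.
have aL : a \in L by apply/LB; split => //; slra.
have i0 : (index a L < S)%N by rewrite -sz index_mem.
have E0 : cyc_nth L 0 = a.
  have h1 := mono 0%N (index a L) (leq0n _) (ltnW i0).
  have h2 : cyc_nth L (index a L) = a by rewrite /cyc_nth index_mem aL nth_index.
  have := La (nth 0 L 0) (mem_nth _ _); rewrite sz => /(_ S0).
  by move: h1; rewrite h2 /cyc_nth sz S0 => h1 h3; apply/eqP; rewrite eq_le; slra.
have ES : cyc_nth L S = a + 2 * pi.
  by move: E0; rewrite /cyc_nth sz ltnn S0 => ->.
exists (cyc_nth L); split => //.
  move=> i; rewrite leq_eqVlt => /predU1P[->|iS].
    by rewrite ES /stang bpt_2pi.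
  have : cyc_nth L i \in L by rewrite /cyc_nth sz iS mem_nth // sz.
  by move=> /LB[].
move=> i t iS t1 st.
have h0 := mono 0%N i (leq0n _) (ltnW iS).
have h1 : cyc_nth L i.+1 <= cyc_nth L S by apply: mono.
rewrite E0 in h0; rewrite ES in h1.
have tL : t \in L by apply/LB; split => //; slra.
have jS : (index t L < S)%N by rewrite -sz index_mem.
have jE : cyc_nth L (index t L) = t by rewrite /cyc_nth index_mem tL nth_index.
have [ji|ij] := leqP (index t L) i.
  by have := mono _ _ ji (ltnW iS); rewrite jE; slra.
by have := mono _ _ ij (ltnW jS); rewrite jE; slra.
Qed.

(** Each interval from [d i] to [d i.+1] contains a value lower than at both ends, hence an interior
    minimum of [rho], which is stable by nondegeneracy; disjoint intervals give distinct points. *)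
Lemma stable_count_ge n (d c : nat -> R) S :
  piecewise_smooth_boundary K -> only_nondegenerate K p ->
  (forall i, (i < n)%N -> d i < c i < d i.+1) -> d n = d 0%N + 2 * pi ->
  (forall i, (i < n)%N -> rho (c i) < rho (d i) /\ rho (c i) < rho (d i.+1)) ->
  has_stable_points K p S -> (n <= S)%N.
Proof.
move=> ps nd dc dn rdc hS.
have lt i : (i < n)%N -> d i < d i.+1 by move=> /dc; slra.
have mono := seq_mono_le lt.
have H i : exists m, (i < n)%N -> d i < m < d i.+1 /\ stang m.
  have [iN|] := boolP (i < n)%N; last by exists 0.
  have [h1 h2] := rdc i iN; have := dc i iN => h.
  have [m m1 Hm] := interior_min (rad_continuous Kb pK) (lt i iN) (c := c i) ltac:(slra) h1 h2.
  exists m => _; split => //.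
  have lm := near_of_itv m1 Hm.
  by apply: locmin_stable => //; apply: nd; exact: locmin_equilibrium.
have [m Hm] := choice H.
rewrite -card_le_II -(card_le_eqr hS).
have E : (fun i => bp (m i)) @` `I_n `<=` [set q | stable K p q].
  by move=> q [i /= iN <-]; exact: (Hm i iN).2.
have := subset_card_le E; apply: card_le_trans.
suff : (fun i => bp (m i)) @` `I_n #= `I_n by rewrite card_eq_sym card_eq_le => /andP[].
apply: inj_card_eq => i j; rewrite !inE /= => iN jN /bpt_inj ij.
have [mi _] := Hm i iN; have [mj _] := Hm j jN.
have mm : m i = m j.
  apply: ij.
  have := mono 0%N i (leq0n _) (ltnW iN); have := mono 0%N j (leq0n _) (ltnW jN).
  have := mono i.+1 n iN (leqnn n); have := mono j.+1 n jN (leqnn n).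
  by rewrite dn ltr_norml; slra.
apply/eqP; rewrite eqn_leq; apply/andP; split; rewrite leqNgt; apply/negP => lt'.
  by have := mono _ _ lt' (ltnW iN); slra.
by have := mono _ _ lt' (ltnW jN); slra.
Qed.

(** Stable points are strict minima, so a local maximum separates any two consecutive ones. With
    [m.+1] stable angles, the [m.+1] maxima would have distinct boundary points among the [m] points
    [P j]. *)
Lemma stable_count_le m (P : 'I_m -> R * R) :
  (forall t, (\forall u \near t, rho u <= rho t) -> exists j, bp t = P j) ->
  exists2 S, (S <= m)%N & has_stable_points K p S.
Proof.
move=> HP; set A := [set q | stable K p q].
apply: contrapT => nS.
(* The stable set is not known to be finite at this stage; comparing cardinals covers the infinite
   case too. *)
have big : `I_m.+1 #<= A.
  have [/finite_setP[k hk]|inf] := pselect (finite_set A).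
    rewrite (card_le_eqr hk) card_le_II ltnNge; apply/negP => km.
    by apply: nS; exists k.
  exact: card_le_trans (card_leT _) ((infiniteP _).1 inf).
move: big; rewrite (card_le_eqr (stable_set_angles 0)) => /sorted_sub[L [sL sz LB]].
have La t : t \in L -> 0 <= t < 0 + 2 * pi by move=> /LB[].
have lt i : (i < m.+1)%N -> cyc_nth L i < cyc_nth L i.+1.
  by move=> iS; apply: cyc_nth_lt sL La _; rewrite sz.
have mono := seq_mono_le lt.
have EN : cyc_nth L m.+1 = cyc_nth L 0 + 2 * pi by rewrite /cyc_nth sz ltnn.
have st i : (i <= m.+1)%N -> stang (cyc_nth L i).
  have st' j : (j < m.+1)%N -> stang (cyc_nth L j).
    by move=> jm; rewrite /cyc_nth sz jm; apply: (LB _ _).2; rewrite mem_nth // sz.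
  rewrite leq_eqVlt => /predU1P[->|]; last exact: st'.
  by rewrite EN /stang bpt_2pi; exact: st'.
have H i : exists t, (i < m.+1)%N -> cyc_nth L i < t < cyc_nth L i.+1 /\
    exists j, bp t = P j.
  have [iN|] := boolP (i < m.+1)%N; last by exists 0.
  have s1 := stable_strict_min Kb pK (st i (ltnW iN)).
  have s2 := stable_strict_min Kb pK (st i.+1 iN).
  have ab := lt i iN.
  have [c c1 fc] := strict_min_right s1 ab; have [d d1 fd] := strict_min_left s2 ab.
  have [k k1 Hk] := interior_max (rad_continuous Kb pK) ab (c := c) (d := d) ltac:(slra) fc ltac:(slra) fd.
  by exists k => _; split => //; apply: HP; exact: near_of_itv k1 Hk.
have [t Ht] := choice H.
have J (i : 'I_m.+1) : exists j, bp (t i) = P j by exact: (Ht i (ltn_ord i)).2.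
have [f Hf] := choice J.
have : injective f.
  move=> i j fij; have : bp (t i) = bp (t j) by rewrite !Hf fij.
  have [iN jN] := (ltn_ord i, ltn_ord j).
  have [mi _] := Ht i iN; have [mj _] := Ht j jN.
  move=> /bpt_inj tt; have {}tt : t i = t j.
    apply: tt.
    have := mono 0%N i (leq0n _) (ltnW iN); have := mono 0%N j (leq0n _) (ltnW jN).
    have := mono i.+1 m.+1 iN (leqnn _); have := mono j.+1 m.+1 jN (leqnn _).
    by rewrite EN ltr_norml; slra.
  apply: val_inj; apply/eqP; rewrite eqn_leq; apply/andP; split; rewrite leqNgt; apply/negP => lt'.
    by have := mono _ _ lt' (ltnW iN); slra.
  by have := mono _ _ lt' (ltnW jN); slra.
by move=> /leq_card; rewrite !card_ord ltnn.
Qed.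

End StableAngles.

Section HullExtrema.
Local Open Scope card_scope.
Variable R : realType.

Lemma locmax_not_strict_min (f : R -> R) t : (\forall u \near t, f u <= f t) ->
  (\forall u \near t, u != t -> f t < f u) -> False.
Proof.
move=> /nbhs_ball_real[d d0 dP] /nbhs_ball_real[e e0 eP].
have [k [k0 ke kd]] : exists k, [/\ 0 < k, k < e & k < d].
  by exists (Num.min e d / 2); split; rewrite ?ltr_pdivrMr ?divr_gt0 // ?lt_min ?e0 //;
     have [] := leP e d; slra.
have kt : `|t + k - t| = k by rewrite addrAC subrr add0r gtr0_norm.
have := dP (t + k); rewrite kt => /(_ kd); rewrite leNgt => /negP; apply.
by apply: eP; rewrite ?kt // gt_eqF // ltrDl.
Qed.

(** A local maximum is an equilibrium. If it were not a vertex it would be stable, hence a strict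
    local minimum. *)
Lemma hull_locmax_vertex n (v : 'I_n -> R * R) p t : (convex_hull v)° p ->
  (\forall u \near t, rad (convex_hull v) p u <= rad (convex_hull v) p t) ->
  exists2 i, equilibrium (convex_hull v) p (v i) & bpt (convex_hull v) p t = v i.
Proof.
move=> iH tmax; have Hb := hull_body iH.
have eqt : equilibrium (convex_hull v) p (bpt (convex_hull v) p t).
  split; first exact: boundary_pol.
  split; first exact: bpt_in.
  left => z Hz; have [->|zt] := eqVneq z (bpt (convex_hull v) p t).
    by rewrite subrr /dot /= !mul0r addr0.
  by apply/ltW; apply: (locmax_below Hb iH).
have [[i iE]|nv] := pselect (exists i, v i = bpt (convex_hull v) p t).
  by exists i => //; rewrite iE.
have st : stable (convex_hull v) p (bpt (convex_hull v) p t).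
  by apply: nonvertex_stable => // i; apply/eqP => iE; apply: nv; exists i.
by case: (locmax_not_strict_min tmax (stable_strict_min Hb iH st)).
Qed.

End HullExtrema.

(** * Areas of sectors *)

Section PlaneMeasure.
Variable R : realType.

Local Notation T1 := (measurableTypeR R).
Local Notation T2 := (measurableTypeR R * measurableTypeR R)%type.
Local Notation mu := (@plane_measure R).
Local Notation lam := (@lebesgue_measure R).

(** Measurability in the product of the two measurable lines, for sets of the bare type [R * R] on
    which the topology lives. *)
Definition mes (A : set (R * R)) : Prop := measurable (A : set T2).

(** An open set is the countable union of the boxes with rational centre and radius [k.+1%:R^-1]
    that it contains. *)
Lemma open_mes (A : set (R * R)) : open A -> mes A.
Proof.
move=> oA.
pose box (q1 q2 : rat) (k : nat) : set (R * R) :=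
  [set z | ratr q1 - k.+1%:R^-1 < z.1 < ratr q1 + k.+1%:R^-1] `&`
  [set z | ratr q2 - k.+1%:R^-1 < z.2 < ratr q2 + k.+1%:R^-1].
have -> : A = \bigcup_(q1 : rat) \bigcup_(q2 : rat) \bigcup_(k : nat)
    (if `[< box q1 q2 k `<=` A >] then box q1 q2 k else set0).
  apply/seteqP; split => z; last first.
    by move=> [q1 _ [q2 _ [k _]]]; case: ifP => // /asboolP h; exact: h.
  move=> Az; have : nbhs z A by apply: open_nbhs_nbhs.
  move=> /nbhs_boxP[e e0 He].
  have [k ke] : exists k : nat, k.+1%:R^-1 < e / 2.
    exists (Num.truncn (e / 2)^-1); rewrite invf_plt ?posrE ?divr_gt0 //.
    exact: truncnS_gt.
  have k0 : 0 < k.+1%:R^-1 :> R by rewrite invr_gt0 ltr0n.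
  have lt1 (x : R) : x - k.+1%:R^-1 < x + k.+1%:R^-1.
    by rewrite ltrD2l; apply: lt_trans k0; rewrite oppr_lt0.
  have [q1 h1] := rat_in_itvoo (lt1 z.1).
  have [q2 h2] := rat_in_itvoo (lt1 z.2).
  move: h1 h2; rewrite !in_itv /= => h1 h2.
  have [d dE] : exists d : R, d = k.+1%:R^-1 by exists k.+1%:R^-1.
  rewrite -dE in ke k0 h1 h2.
  exists q1 => //; exists q2 => //; exists k => //.
  case: ifPn => [_|/asboolPn]; first by split; rewrite /= -dE; slra.
  case=> w [/=]; rewrite -dE => w1 w2; apply: He; rewrite ltr_norml; slra.
apply: bigcupT_measurable_rat => q1; apply: bigcupT_measurable_rat => q2.
apply: bigcupT_measurable => k; case: ifP => // _.
have -> : box q1 q2 k = `]ratr q1 - k.+1%:R^-1, ratr q1 + k.+1%:R^-1[%classic `*`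
   `]ratr q2 - k.+1%:R^-1, ratr q2 + k.+1%:R^-1[%classic.
  by apply/seteqP; split => z /=; rewrite !in_itv.
exact: (measurableX (measurable_itv _) (measurable_itv _)).
Qed.

Lemma closed_mes (A : set (R * R)) : closed A -> mes A.
Proof.
by move=> cA; rewrite /mes -[A]setCK; apply: measurableC; apply: open_mes; exact: closed_openC.
Qed.

Lemma compact_mes (A : set (R * R)) : compact A -> mes A.
Proof. by move=> cA; apply: closed_mes; exact: compact_closed (@norm_hausdorff _ _) cA. Qed.

Lemma continuous_mes (f : R * R -> R * R) : continuous f ->
  measurable_fun setT (f : T2 -> T2).
Proof.
move=> cf; have m1 (g : R * R -> R) : continuous g -> measurable_fun setT (g : T2 -> T1).
  move=> cg; apply: (measurability _ (RGenOInfty.measurableE R)).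
  move=> _ [_ [a ->] <-]; rewrite setTI; apply: open_mes.
  by apply: open_comp => [z _|]; [exact: cg|exact: interval_open].
have -> : f = (fun z => ((f z).1, (f z).2)) by apply/funext => z; rewrite -surjective_pairing.
apply: measurable_fun_pair; apply: m1 => z.
  exact: (cvg_comp _ _ (cf z) (@cvg_fst _ _ _ _ _)).
exact: (cvg_comp _ _ (cf z) (@cvg_snd _ _ _ _ _)).
Qed.

(** Uniqueness of the measure with the right values on half-open intervals, applied to the image of
    Lebesgue measure under the affine map, rescaled by the absolute value of [a]. *)
Lemma lebesgue_affine (a b : R) (A : set T1) : a != 0 -> measurable A ->
  lam [set y | A (a * y + b)] = ((`|a|^-1)%:E * lam A)%E.
Proof.
move=> a0 mA; pose phi : T1 -> T1 := fun y => a * y + b.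
have mphi : measurable_fun setT phi.
  apply: continuous_measurable_fun => y.
  by apply: cvgD; [apply: cvgM; [exact: cvg_cst|exact: cvg_id]|exact: cvg_cst].
pose nu := mscale (NngNum (normr_ge0 a))
   (measure_function_pushforward__canonical__measure_function_Measure lam mphi).
have an0 : 0 < `|a| by rewrite normr_gt0.
have ub : forall A, measurable A -> lam A = nu A.
  apply: lebesgue_measure_unique => _ [[u v] _ <-] /=.
  rewrite /nu /mscale /= /pushforward.
  have [vu|uv] := leP v u.
    have -> : phi @^-1` `]u, v]%classic = set0.
      by apply/seteqP; split => y //=; rewrite in_itv /=; slra.
    by rewrite set_itv_ge ?bnd_simp -?leNgt // measure0 mule0.
  have [ap|an] := ltP 0 a.
    have -> : phi @^-1` `]u, v]%classic = `](u - b) / a, (v - b) / a]%classic.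
      apply/seteqP; split => y /=; rewrite !in_itv /= /phi.
        by rewrite ltr_pdivrMr // ler_pdivlMr // mulrC; slra.
      by rewrite ltr_pdivrMr // ler_pdivlMr // mulrC; slra.
    rewrite !lebesgue_measure_itv /= !lte_fin uv ltr_pM2r ?invr_gt0 // ltrD2r uv.
    rewrite -!EFinB -EFinM; congr EFin; rewrite (gtr0_norm ap); field.
    by rewrite gt_eqF.
  have {}an : a < 0 by rewrite lt_neqAle a0.
  have -> : phi @^-1` `]u, v]%classic = `[(v - b) / a, (u - b) / a[%classic.
    apply/seteqP; split => y /=; rewrite !in_itv /= /phi.
      by rewrite ltr_ndivlMr // ler_ndivrMr // mulrC; slra.
    by rewrite ltr_ndivlMr // ler_ndivrMr // mulrC; slra.
  rewrite !lebesgue_measure_itv /= !lte_fin uv ltr_nM2r ?invr_lt0 // ltrD2r uv.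
  rewrite -!EFinB -EFinM; congr EFin; rewrite (ltr0_norm an); field.
  by rewrite lt_eqF.
rewrite (ub A mA) /nu /mscale /= muleA -EFinM mulVf ?gt_eqF // mul1e.
by [].
Qed.

(** The factor refers to preimages: a homothety of ratio [k] has factor [(k ^+ 2)^-1]. *)
Definition scales (f : R * R -> R * R) (k : R) :=
  measurable_fun setT (f : T2 -> T2) /\
  forall A, mes A -> mu (f @^-1` A) = (k%:E * mu A)%E.

Lemma mes_preimage (f : R * R -> R * R) A : measurable_fun setT (f : T2 -> T2) ->
  mes A -> mes (f @^-1` A).
Proof. by move=> mf mA; rewrite /mes -[_ @^-1` _]setTI; exact: mf. Qed.

Lemma scales_comp f g k l : scales f k -> scales g l -> scales (g \o f) (k * l).
Proof.
move=> [mf hf] [mg hg]; split; first exact: measurableT_comp.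
by move=> A mA; rewrite comp_preimage hf ?hg ?EFinM ?muleA //; exact: mes_preimage.
Qed.

Lemma scales_ext f g k l : f =1 g -> k = l -> scales f k -> scales g l.
Proof. by move=> /funext -> ->. Qed.

(** Fubini: each vertical section is transformed by an affine map of slope [a]. *)
Lemma scales_shear (a b c : R) : a != 0 ->
  scales (fun z => (z.1, a * z.2 + b * z.1 + c)) `|a|^-1.
Proof.
move=> a0; have mf : measurable_fun setT
    ((fun z : R * R => (z.1, a * z.2 + b * z.1 + c)) : T2 -> T2).
  apply: continuous_mes; apply: continuous_pair => z; first exact: cvg_fst.
  apply: cvgD; last exact: cvg_cst.
  apply: cvgD; (apply: cvgM; first exact: cvg_cst); [exact: cvg_snd|exact: cvg_fst].
split => // A mA; rewrite /plane_measure /product_measure1.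
transitivity (\int[lam]_x ((`|a|^-1)%:E * lam (xsection A x)))%E.
  apply: eq_integral => x _ /=.
  have -> : xsection [set z | A (z.1, a * z.2 + b * z.1 + c)] x =
     [set y | xsection A x (a * y + (b * x + c))].
    by apply/seteqP; split => y; rewrite /xsection /= !inE /= !addrA.
  by apply: lebesgue_affine => //; exact: measurable_xsection.
by rewrite ge0_integralZl //; exact: measurable_fun_xsection.
Qed.

Lemma scales_swap : scales (fun z => (z.2, z.1)) 1.
Proof.
have mf : measurable_fun setT ((fun z : R * R => (z.2, z.1)) : T2 -> T2).
  by apply: continuous_mes; apply: continuous_pair => z; [exact: cvg_snd|exact: cvg_fst].
split => // A mA; rewrite mul1e.
pose nu := measure_function_pushforward__canonical__measure_function_Measure mu mf.
apply/esym; apply: (@product_measure_unique _ _ _ _ R lam lam nu _ A mA).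
move=> X Y mX mY; rewrite /nu /= /pushforward.
have -> : (fun z : R * R => (z.2, z.1)) @^-1` (X `*` Y) = Y `*` X.
  by apply/seteqP; split => z /= [].
by rewrite /plane_measure product_measure1E // muleC.
Qed.

Lemma scales_shear' (a b c : R) : a != 0 ->
  scales (fun z => (a * z.1 + b * z.2 + c, z.2)) `|a|^-1.
Proof.
move=> a0; have h := scales_comp (scales_comp scales_swap (scales_shear b c a0)) scales_swap.
by apply: scales_ext h => //; rewrite mul1r mulr1.
Qed.

Lemma scales_translate (u v : R) : scales (fun z => (z.1 + u, z.2 + v)) 1.
Proof.
have h := scales_comp (scales_shear 0 v (oner_neq0 R)) (scales_shear' 0 u (oner_neq0 R)).
apply: scales_ext h => [z|]; last by rewrite normr1 invr1 mulr1.
by rewrite /= !mul1r !mul0r !addr0.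
Qed.

Lemma scales_homothety (k : R) : k != 0 -> scales (fun z => (k * z.1, k * z.2)) (k ^+ 2)^-1.
Proof.
move=> k0; have h := scales_comp (scales_shear 0 0 k0) (scales_shear' 0 0 k0).
apply: scales_ext h => [z|]; first by rewrite /= !mul0r !addr0.
by rewrite -invfM -expr2 real_normK // num_real.
Qed.

(** A rotation is a product of three shears, where [t] is minus the tangent of half the angle. This
    breaks down for the half turn, which is obtained as two quarter turns. *)
Lemma scales_rotation (c s : R) : c ^+ 2 + s ^+ 2 = 1 ->
  scales (fun z => (c * z.1 - s * z.2, s * z.1 + c * z.2)) 1.
Proof.
have key (x y : R) : x ^+ 2 + y ^+ 2 = 1 -> 1 + x != 0 ->
    scales (fun z => (x * z.1 - y * z.2, y * z.1 + x * z.2)) 1.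
  move=> xy x1; pose t := - (y / (1 + x)).
  have h := scales_comp (scales_comp (scales_shear' t 0 (oner_neq0 R))
    (scales_shear y 0 (oner_neq0 R))) (scales_shear' t 0 (oner_neq0 R)).
  apply: scales_ext h => [z|]; last by rewrite normr1 invr1 !mulr1.
  have e1 : t * y = x - 1.
    apply: (mulIf x1); transitivity (x ^+ 2 - (x ^+ 2 + y ^+ 2)).
      by rewrite /t; field.
    by rewrite xy; ring.
  have e2 : t * (1 + x) = - y by rewrite /t mulNr divfK.
  rewrite /= !mul1r !addr0; congr pair.
    transitivity (z.1 + t * z.2 + (t * y) * (z.1 + t * z.2) + t * z.2); first by ring.
    by rewrite e1; transitivity (x * z.1 + t * (1 + x) * z.2); [ring|rewrite e2; ring].
  transitivity (z.2 + y * z.1 + t * y * z.2); first by ring.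
  by rewrite e1; ring.
move=> cs; have [c1|c1] := eqVneq (1 + c) 0; last exact: key.
have c2 : c = -1 by slra.
have s0 : s = 0 by apply/eqP; rewrite -sqrf_eq0; apply/eqP; move: cs; rewrite c2; slra.
have h1 := @key 0 1 ltac:(by rewrite expr1n expr0n add0r) ltac:(by rewrite addr0 oner_eq0).
have h := scales_comp h1 h1.
apply: scales_ext h => [z|]; last by rewrite mulr1.
by rewrite /= c2 s0; congr pair; ring.
Qed.

(** For positive [k], the direct similarity of ratio [k] and angle [u] that takes [p] to [q]; in
    polar coordinates it multiplies the radius and shifts the angle. *)
Definition polar_map (p q : R * R) (k u : R) (z : R * R) : R * R :=
  (q.1 + k * (cos u * (z.1 - p.1) - sin u * (z.2 - p.2)),
   q.2 + k * (sin u * (z.1 - p.1) + cos u * (z.2 - p.2))).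

Lemma polar_map_pol p q k u s t : polar_map p q k u (pol p s t) = pol q (k * s) (t + u).
Proof. by rewrite /polar_map /pol /= cosD sinD; congr pair; ring. Qed.

Lemma scales_polar_map p q k u : k != 0 -> scales (polar_map p q k u) (k ^+ 2)^-1.
Proof.
move=> k0; have h := scales_comp (scales_comp (scales_comp (scales_translate (- p.1) (- p.2))
  (scales_rotation (cos2Dsin2 u))) (scales_homothety k0)) (scales_translate q.1 q.2).
apply: scales_ext h => [z|]; last by rewrite !mul1r mulr1.
by rewrite /polar_map /=; congr pair; ring.
Qed.

End PlaneMeasure.

Section Area.
Variable R : realType.

Local Notation T1 := (measurableTypeR R).
Local Notation T2 := (measurableTypeR R * measurableTypeR R)%type.
Local Notation lam := (@lebesgue_measure R).
Local Notation mu := (lam \x lam)%E.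
Implicit Types (A B : set (R * R)) (p q : R * R) (a b c t s : R) (f g : R -> R).

(** [area] sends an infinite measure to 0, so that its additivity and monotonicity are stated for
    sets of finite measure. *)
Definition fmes A := mes A /\ (mu A < +oo)%E.

Lemma fmesW A : fmes A -> mes A. Proof. by case. Qed.

Lemma fmes_sub A B : mes A -> fmes B -> A `<=` B -> fmes A.
Proof.
move=> mA [mB fB] AB; split => //; apply: le_lt_trans fB.
by apply: le_measure; rewrite ?inE.
Qed.

Lemma fmesE A : fmes A -> mu A = (area A)%:E.
Proof. by move=> [mA fA]; rewrite /area fineK // ge0_fin_numE. Qed.

Lemma area_ge0 A : 0 <= area A.
Proof. by rewrite /area fine_ge0 // /plane_measure; exact: measure_ge0. Qed.

Lemma area_le A B : mes A -> fmes B -> A `<=` B -> area A <= area B.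
Proof.
move=> mA fB AB; have fA := fmes_sub mA fB AB.
rewrite -lee_fin -!fmesE //; apply: le_measure => //; rewrite inE //; exact: fmesW.
Qed.

Lemma fmesU A B : fmes A -> fmes B -> fmes (A `|` B).
Proof.
move=> fA fB; have mU : mes (A `|` B) by apply: measurableU; exact: fmesW.
split => //; have := @measureU2 _ _ _ mu A B (fmesW fA) (fmesW fB).
by move=> /le_lt_trans; apply; rewrite lte_add_pinfty //; [case: fA|case: fB].
Qed.

Lemma areaU A B : fmes A -> fmes B -> A `&` B = set0 -> area (A `|` B) = area A + area B.
Proof.
move=> fA fB AB; apply: EFin_inj.
rewrite EFinD -(fmesE fA) -(fmesE fB) -(fmesE (fmesU fA fB)).
by apply: measureU => //; exact: fmesW.
Qed.

Lemma areaD A B : fmes A -> mes B -> B `<=` A -> area (A `\` B) = area A - area B.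
Proof.
move=> fA mB BA; have fB := fmes_sub mB fA BA.
have mD : mes (A `\` B) by apply: measurableD => //; exact: fmesW.
have fD : fmes (A `\` B) by apply: fmes_sub mD fA _ => z [].
apply/eqP; rewrite eq_sym subr_eq; apply/eqP.
rewrite -(areaU fD fB); first by rewrite setUC setDUK.
by rewrite setIC setDIK.
Qed.

Lemma compact_fmes A : compact A -> fmes A.
Proof.
move=> cA; have mA := compact_mes cA.
have [M [_ HM]] := compact_bounded cA.
have {}HM := HM (M + 1) ltac:(slra).
pose I : set T1 := `[- (M + 1), M + 1]%classic.
have fI : fmes (I `*` I).
  split; first exact: (measurableX (measurable_itv _) (measurable_itv _)).
  rewrite product_measure1E //; [|exact: measurable_itv..].
  rewrite [X in (X * _)%E](_ : _ = lebesgue_measure (`[- (M + 1), M + 1]%classic : set R)) //.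
  rewrite [X in (_ * X)%E](_ : _ = lebesgue_measure (`[- (M + 1), M + 1]%classic : set R)) //.
  by rewrite lebesgue_measure_itv /=; case: ifP => _; rewrite ?mul0e ?ltry //= -EFinN -EFinD -EFinM ltry.
apply: (fmes_sub mA fI) => z /HM; rewrite /= prod_normE /= ge_max => /andP[z1 z2].
by split; rewrite /I /= in_itv /= -ler_norml.
Qed.

Lemma area_point p : area [set p] = 0.
Proof.
rewrite /area /plane_measure.
have -> : [set p] = [set p.1] `*` [set p.2].
  apply/seteqP; split => z /=; first by move=> ->.
  by move=> [h1 h2]; rewrite [z]surjective_pairing h1 h2 -surjective_pairing.
by rewrite product_measure1E //= lebesgue_measure_set1 mul0e.
Qed.

(** Half-open in the angle and without [p], so that adjacent sectors are disjoint; [csec] is the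
    compact set that contains it. *)
Definition psec p a b f : set (R * R) :=
  [set z | exists t s, [/\ a <= t < b, 0 < s <= f t & z = pol p s t]].

Definition csec p a b f : set (R * R) :=
  [set z | exists t s, [/\ a <= t <= b, 0 <= s <= f t & z = pol p s t]].

Lemma continuous_fst f : continuous f -> continuous (fun x : R * R => f x.1).
Proof.
move=> cf x; apply: (@continuous_comp _ _ _ (fst : R * R -> R) f); last exact: cf.
exact: cvg_fst.
Qed.

Lemma csec_compact p a b f : continuous f -> (forall t, 0 < f t) -> compact (csec p a b f).
Proof.
move=> cf f0; pose h (x : R * R) : R * R := pol p (x.2 * f x.1) x.1.
have -> : csec p a b f = h @` (`[a, b]%classic `*` `[0, 1]%classic).
  apply/seteqP; split => z.
    move=> [t [s [t1 /andP[s0 s1] ->]]]; exists (t, s / f t); last first.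
      by rewrite /h /= divfK // gt_eqF.
    split; rewrite /= in_itv //=; apply/andP; split.
      by rewrite divr_ge0 // ltW.
    by rewrite ler_pdivrMr // mul1r.
  move=> [[t l] [/=]]; rewrite !in_itv /= => t1 /andP[l0 l1] <-.
  exists t, (l * f t); split => //.
  by rewrite mulr_ge0 ?(ltW (f0 t)) //= ler_piMl // ltW.
apply: continuous_compact; last by apply: compact_setX; exact: segment_compact.
apply: continuous_subspaceT; apply: continuous_pol => x; last exact: cvg_fst.
apply: cvgM; first exact: cvg_snd.
exact: (continuous_fst cf).
Qed.

(** The sector is a countable union of compact images of rectangles that exhaust its half-open
    domain. *)
Lemma psec_mes p a b f : continuous f -> (forall t, 0 < f t) -> mes (psec p a b f).
Proof.
move=> cf f0; pose h (x : R * R) : R * R := pol p (x.2 * f x.1) x.1.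
have -> : psec p a b f = \bigcup_k
    (h @` (`[a, b - k.+1%:R^-1]%classic `*` `[k.+1%:R^-1, 1]%classic)).
  have kex (d : R) : 0 < d -> exists k : nat, k.+1%:R^-1 < d.
    move=> d0; exists (Num.truncn d^-1); rewrite invf_plt ?posrE //; exact: truncnS_gt.
  apply/seteqP; split => z.
    move=> [t [s [/andP[t0 t1] /andP[s0 s1] ->]]].
    have l0 : 0 < s / f t by rewrite divr_gt0.
    have [k kd] := kex (Num.min (b - t) (s / f t)) ltac:(by rewrite lt_min subr_gt0 t1).
    move: kd; rewrite lt_min => /andP[k1 k2].
    exists k => //; exists (t, s / f t); last by rewrite /h /= divfK // gt_eqF.
    split; rewrite /= in_itv /=; apply/andP; split => //.
    - by move: k1; set d := _^-1; slra.
    - exact: ltW.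
    - by rewrite ler_pdivrMr // mul1r.
  move=> [k _ [[t l] [/=]]]; rewrite !in_itv /= => /andP[t0 t1] /andP[l0 l1] <-.
  have k0 : 0 < k.+1%:R^-1 :> R by rewrite invr_gt0 ltr0n.
  have lp : 0 < l by apply: lt_le_trans l0.
  exists t, (l * f t); split => //.
    by rewrite t0 /= (le_lt_trans t1) // ltrBlDr ltrDl.
  by rewrite mulr_gt0 //= ler_piMl // ltW.
apply: bigcupT_measurable => k; apply: compact_mes.
apply: continuous_compact; last by apply: compact_setX; exact: segment_compact.
apply: continuous_subspaceT; apply: continuous_pol => x; last exact: cvg_fst.
apply: cvgM; first exact: cvg_snd.
exact: (continuous_fst cf).
Qed.

Lemma psec_fmes p a b f : continuous f -> (forall t, 0 < f t) -> fmes (psec p a b f).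
Proof.
move=> cf f0; apply: (fmes_sub (@psec_mes p a b f cf f0) (compact_fmes (@csec_compact p a b f cf f0))).
move=> z [t [s [/andP[t0 t1] /andP[s0 s1] ->]]]; exists t, s; split => //.
  by rewrite t0 ltW.
by rewrite s1 ltW.
Qed.

Lemma psec_eq p a b f g : (forall t, a <= t < b -> f t = g t) -> psec p a b f = psec p a b g.
Proof.
move=> fg; apply/seteqP; split => z [t [s [t1 s1 ->]]]; exists t, s; split => //.
  by rewrite -fg.
by rewrite fg.
Qed.

Lemma psec_sub p a b f g : (forall t, a <= t < b -> f t <= g t) -> psec p a b f `<=` psec p a b g.
Proof.
move=> fg z [t [s [t1 /andP[s0 s1] ->]]]; exists t, s; split => //.
by rewrite s0 (le_trans s1) // fg.
Qed.

Lemma psec_cat p a b c f : a <= b <= c -> psec p a c f = psec p a b f `|` psec p b c f.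
Proof.
move=> /andP[ab bc]; apply/seteqP; split => z.
  move=> [t [s [/andP[t0 t1] s1 ->]]]; have [tb|tb] := ltP t b.
    by left; exists t, s; rewrite t0.
  by right; exists t, s; rewrite tb.
by move=> [|] [t [s [/andP[t0 t1] s1 ->]]]; exists t, s; split => //; apply/andP; split; slra.
Qed.

Lemma area_psec_cat p a b c f : continuous f -> (forall t, 0 < f t) ->
  a <= b <= c -> c <= a + 2 * pi ->
  area (psec p a c f) = area (psec p a b f) + area (psec p b c f).
Proof.
move=> cf f0 abc ca; rewrite (psec_cat p f abc) areaU //; try exact: psec_fmes.
apply/seteqP; split => // z [[t [s [t1 /andP[s0 _] ->]]] [u [r [u1 /andP[r0 _]]]]].
by move=> /(pol_inj s0 r0)[]; [rewrite ltr_norml; slra|slra].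
Qed.

Lemma area_psec_le p a b f g : continuous f -> (forall t, 0 < f t) ->
  continuous g -> (forall t, 0 < g t) ->
  (forall t, a <= t < b -> f t <= g t) -> area (psec p a b f) <= area (psec p a b g).
Proof.
move=> cf f0 cg g0 fg; apply: area_le; [exact: psec_mes|exact: psec_fmes|exact: psec_sub].
Qed.

Lemma polar_mapK p q k u : k != 0 ->
  cancel (polar_map p q k u) (polar_map q p k^-1 (- u)).
Proof.
move=> k0 z; have cs := cos2Dsin2 u.
rewrite /polar_map /= cosN sinN [RHS]surjective_pairing; congr pair.
  transitivity (p.1 + (z.1 - p.1) * (cos u ^+ 2 + sin u ^+ 2)); first by field.
  by rewrite cs; ring.
transitivity (p.2 + (z.2 - p.2) * (cos u ^+ 2 + sin u ^+ 2)); first by field.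
by rewrite cs; ring.
Qed.

Lemma area_polar_map p q k u A B : 0 < k -> fmes B ->
  (forall z, A z <-> B (polar_map p q k u z)) -> area B = k ^+ 2 * area A.
Proof.
move=> k0 fB AB; have kn : k != 0 by rewrite gt_eqF.
have [_ /(_ B (fmesW fB))] := scales_polar_map p q u kn.
have -> : polar_map p q k u @^-1` B = A by apply/seteqP; split => z /AB.
rewrite [X in (_ * X)%E](fmesE fB) /= => eA; rewrite [area A]/area /plane_measure [X in _ * fine X]eA.
by rewrite fineM //= mulrA divff ?mul1r // expf_neq0.
Qed.

Lemma area_psec_map p q k u a b f : 0 < k -> continuous f -> (forall t, 0 < f t) ->
  area (psec q (a + u) (b + u) (fun t => k * f (t - u))) = k ^+ 2 * area (psec p a b f).
Proof.
move=> k0 cf f0; apply: (area_polar_map (p := p) (q := q) (u := u)) => //.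
  apply: psec_fmes; last by move=> t; rewrite mulr_gt0.
  move=> t; apply: cvgM; first exact: cvg_cst.
  apply: (@continuous_comp _ _ _ (fun t => t - u) f); last exact: cf.
  by apply: cvgB; [exact: cvg_id|exact: cvg_cst].
have kn : k != 0 by rewrite gt_eqF.
move=> z; split.
  move=> [t [s [/andP[t0 t1] /andP[s0 s1] ->]]]; exists (t + u), (k * s).
  rewrite polar_map_pol addrK; split => //; first by slra.
  by rewrite mulr_gt0 //= ler_pM2l.
move=> [t [s [/andP[t0 t1] /andP[s0 s1] e]]]; exists (t - u), (k^-1 * s); split.
- by slra.
- by rewrite mulr_gt0 ?invr_gt0 //= ler_pdivrMl.
- by rewrite -(polar_map_pol q) -e polar_mapK.
Qed.

End Area.

(** * The area of a triangle with one vertex at the centre *)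

Section Triangle.
Variable R : realType.

Local Notation T1 := (measurableTypeR R).
Local Notation T2 := (measurableTypeR R * measurableTypeR R)%type.
Local Notation lam := (@lebesgue_measure R).
Local Notation mu := (lam \x lam)%E.
Implicit Types (A B : set (R * R)) (p q : R * R) (a b c t s u v : R) (f g : R -> R).

Lemma cos_gt0 t : - (pi / 2) < t < pi / 2 -> 0 < cos t.
Proof. by move=> h; rewrite cos_gt0_pihalf. Qed.

Lemma continuous_max_cos c : continuous (fun t => Num.max c (cos t)).
Proof. by move=> t; apply: continuous_max; [exact: cvg_cst|exact: continuous_cos]. Qed.

Lemma max_cos_gt0 c t : 0 < c -> 0 < Num.max c (cos t).
Proof. by move=> c0; rewrite lt_max c0. Qed.

Lemma continuous_sec c : 0 < c -> continuous (fun t => (Num.max c (cos t))^-1).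
Proof.
move=> c0 t; apply: cvgV; last exact: continuous_max_cos.
by rewrite gt_eqF // max_cos_gt0.
Qed.

(** In polar coordinates [s = 1 / cos t] is the line [z.1 = 1], so the sector is a triangle with
    apex at the origin and sides of slopes [tan u] and [tan v]. On [u, v] the maximum with [c] is
    just the cosine. *)
Lemma triangleE c u v : 0 < c -> - (pi / 2) < u -> u <= v -> v < pi / 2 ->
  (forall t, u <= t <= v -> c <= cos t) ->
  psec 0 u v (fun t => (Num.max c (cos t))^-1) =
  [set z | 0 < z.1 <= 1 /\ z.1 * tan u <= z.2 < z.1 * tan v].
Proof.
move=> c0 u0 uv v0 cle; apply/seteqP; split => z.
  move=> [t [s [t1 /andP[s0 s1] ->]]]; have /andP[tu tv] := t1.
  have cc : c <= cos t by apply: cle; rewrite tu ltW.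
  have ct : 0 < cos t by apply: lt_le_trans cc.
  rewrite (max_idPr cc) in s1.
  have yE : s * sin t = s * cos t * tan t by rewrite /tan; field; rewrite gt_eqF.
  have x0 : 0 < s * cos t by rewrite mulr_gt0.
  rewrite /pol /= !add0r yE; split.
    by rewrite x0 /= -ler_pdivlMr // div1r.
  rewrite ler_pM2l // ltr_pM2l //.
  have pin x : u <= x <= v -> x \in `]- (pi / 2), (pi / 2)[%R.
    by move=> h; rewrite in_itv /=; slra.
  rewrite (ltr_tan (pin t ltac:(slra)) (pin v ltac:(slra))) tv andbT leNgt.
  by rewrite (ltr_tan (pin t ltac:(slra)) (pin u ltac:(slra))) -leNgt.
move=> /= [/andP[x0 x1] /andP[y0 y1]].
set t := atan (z.2 / z.1); have tt : tan t = z.2 / z.1 by rewrite atanK.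
have tp : - (pi / 2) < t < pi / 2 by rewrite atan_gtNpi2 atan_ltpi2.
have ct := cos_gt0 tp.
have uI : u \in `]- (pi / 2), (pi / 2)[%R by rewrite in_itv /=; slra.
have vI : v \in `]- (pi / 2), (pi / 2)[%R by rewrite in_itv /=; slra.
have tI : t \in `]- (pi / 2), (pi / 2)[%R by rewrite in_itv /=; slra.
have tv : t < v by rewrite -(ltr_tan tI vI) tt ltr_pdivrMr // mulrC.
have ut : u <= t by rewrite leNgt -(ltr_tan tI uI) tt ltr_pdivrMr // mulrC -leNgt.
exists t, (z.1 / cos t); split.
- by rewrite ut.
- rewrite divr_gt0 //= (max_idPr _); last by apply: cle; rewrite ut ltW.
  by rewrite ler_pdivrMr // mulVf ?gt_eqF.
- rewrite /pol /= !add0r [LHS]surjective_pairing; congr pair.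
    by rewrite divfK // gt_eqF.
  have -> : z.1 / cos t * sin t = z.1 * tan t by rewrite /tan; field; rewrite gt_eqF.
  by rewrite tt mulrC divfK // gt_eqF.
Qed.

Lemma integral_linear c : (\int[lam]_(x in (`]0%R, 1%R]%classic : set T1)) (c * x)%:E)%E = (c / 2)%:E.
Proof.
rewrite integral_itv_obnd_cbnd; last first.
  apply: measurable_funTS; apply/measurable_EFinP; apply: continuous_measurable_fun.
  by move=> x; apply: cvgM; [exact: cvg_cst|exact: cvg_id].
have dF (x : R) : is_derive x (1 : R) (fun x : R => c / 2 * x ^+ 2) (c * x).
  have h := is_deriveZ (c / 2) (is_deriveX 2 (@is_derive_id R R x 1)).
  by apply: (@is_derive_eq _ _ _ _ _ _ _ _ h); rewrite /GRing.scale /=; field.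
rewrite (@continuous_FTC2 _ _ (fun x : R => c / 2 * x ^+ 2)) //.
- by rewrite -EFinB; congr EFin; field.
- by apply: continuous_subspaceT => x; apply: cvgM; [exact: cvg_cst|exact: cvg_id].
- have cF : continuous (fun x : R => c / 2 * x ^+ 2).
    by move=> x; apply: cvgM; [exact: cvg_cst|exact: exprn_continuous].
  split.
  + by move=> x _; exact: @ex_derive _ _ _ _ _ _ _ (dF x).
  + by apply: cvg_at_right_filter; exact: cF.
  + by apply: cvg_at_left_filter; exact: cF.
- by move=> x _; rewrite derive1E; exact: @derive_val _ _ _ _ _ _ _ (dF x).
Qed.

(** Fubini: the section over the abscissa [x] is an interval of length [(n - m) * x]. *)
Lemma area_cone (m n : R) : m <= n ->
  mes [set z : R * R | 0 < z.1 <= 1 /\ z.1 * m <= z.2 < z.1 * n] ->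
  area [set z : R * R | 0 < z.1 <= 1 /\ z.1 * m <= z.2 < z.1 * n] = (n - m) / 2.
Proof.
move=> mn mT; rewrite /area /plane_measure /product_measure1.
set A := [set z | _]; have -> : lam \o xsection A =
   (fun x : T1 => ((n - m) * x)%:E) \_ (`]0%R, 1%R]%classic : set T1).
  apply/funext => x /=; rewrite patchE.
  have [x01|x01] := boolP (x \in _).
    move: x01; rewrite inE /= in_itv /= => /andP[x0 x1].
    have -> : xsection A x = `[x * m, x * n[%classic.
      by apply/seteqP; split => y; rewrite /xsection /= inE /A /= in_itv /= ?x0 ?x1 => // -[].
    rewrite [LHS]lebesgue_measure_itv /= lte_fin.
    case: (ltP (x * m) (x * n)) => [_|h]; first by rewrite -EFinD -mulrBr mulrC.
    by move: h; rewrite ler_pM2l // => h; rewrite (le_anti (introT andP (conj mn h))) subrr mul0r.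
  have -> : xsection A x = set0.
    apply/seteqP; split => y //; rewrite /xsection /= inE /A /= => -[x2 _].
    by move/negP: x01; apply; rewrite inE /= in_itv.
  exact: measure0.
by rewrite -integral_mkcond integral_linear.
Qed.

Lemma area_triangle0 c u v : 0 < c -> - (pi / 2) < u -> u <= v -> v < pi / 2 ->
  (forall t, u <= t <= v -> c <= cos t) ->
  area (psec 0 u v (fun t => (Num.max c (cos t))^-1)) = (tan v - tan u) / 2.
Proof.
move=> c0 u0 uv v0 cle.
have mT : mes (psec 0 u v (fun t => (Num.max c (cos t))^-1)).
  by apply: psec_mes; [exact: continuous_sec|move=> t; rewrite invr_gt0 max_cos_gt0].
rewrite triangleE // in mT *; apply: area_cone => //.
move: uv; rewrite le_eqVlt => /predU1P[->//|uv]; apply/ltW.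
by rewrite ltr_tan // in_itv /=; slra.
Qed.

Lemma cos_min c d t : - pi <= c -> d <= pi -> c <= t <= d -> Num.min (cos c) (cos d) <= cos t.
Proof.
move=> cp dp /andP[ct td].
have key x y : 0 <= x -> x <= y -> y <= pi -> cos y <= cos x.
  move=> x0 xy yp; move: xy; rewrite le_eqVlt => /predU1P[->//|xy].
  by apply/ltW; rewrite ltr_cos // in_itv /=; slra.
have [t0|t0] := leP 0 t; rewrite ge_min; apply/orP; [right|left].
  exact: key.
by rewrite -(cosN c) -(cosN t); apply: key; slra.
Qed.

(* The radius r / cos (t - t0) is replaced outside [a, b] by a function [f] that is
   positive and continuous everywhere. *)
Lemma area_triangle p r a b t0 : 0 < r -> t0 - pi / 2 < a -> a <= b -> b < t0 + pi / 2 ->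
  exists f, [/\ continuous f, forall t, 0 < f t,
    forall t, a <= t <= b -> f t = r / cos (t - t0) &
    area (psec p a b f) = r ^+ 2 * (tan (b - t0) - tan (a - t0)) / 2].
Proof.
move=> r0 a0 ab b0; have pi0 := @pi_gt0 R.
set c := Num.min (cos (a - t0)) (cos (b - t0)).
have c0 : 0 < c by rewrite lt_min !cos_gt0 //; slra.
have cle t : a - t0 <= t <= b - t0 -> c <= cos t.
  by move=> h; apply: cos_min => //; slra.
pose g t := (Num.max c (cos t))^-1.
have cg : continuous g := continuous_sec c0.
have g0 t : 0 < g t by rewrite invr_gt0 max_cos_gt0.
have h := @area_psec_map R 0 p r t0 (a - t0) (b - t0) g r0 cg g0.
exists (fun t => r * g (t - t0)); split.
- move=> t; apply: cvgM; first exact: cvg_cst.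
  apply: (@continuous_comp _ _ _ (fun t => t - t0) g); last exact: cg.
  by apply: cvgB; [exact: cvg_id|exact: cvg_cst].
- by move=> t; rewrite mulr_gt0.
- by move=> t tab; rewrite /g (max_idPr _) // cle //; slra.
- have a1 : - (pi / 2) < a - t0 by slra.
  have b1 : b - t0 < pi / 2 by slra.
  have ab1 : a - t0 <= b - t0 by rewrite lerD2r.
  rewrite !subrK in h; rewrite h (area_triangle0 c0 a1 ab1 b1 cle); exact: mulrA.
Qed.

Lemma derive_lt f df a b : (forall x, a <= x <= b -> is_derive x (1 : R) f (df x)) ->
  (forall x, a < x < b -> 0 < df x) -> a < b -> f a < f b.
Proof.
move=> fd df0 ab.
have h1 (x : R) : x \in `]a, b[%R -> is_derive x 1 f (df x).
  by rewrite in_itv /= => /andP[ax xb]; apply: fd; rewrite !ltW.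
have h2 : {within `[a, b], continuous f}.
  apply: continuous_in_subspaceT => x; rewrite inE /= in_itv /= => /fd h.
  by apply/differentiable_continuous/derivable1_diffP; exact: @ex_derive _ _ _ _ _ _ _ h.
have [x /itvP xab e] := MVT ab h1 h2.
by rewrite -subr_gt0 e mulr_gt0 ?subr_gt0 // df0 // !xab.
Qed.

Lemma sin_lt_id (x : R) : 0 < x -> sin x < x.
Proof.
move=> x0; have pi0 := @pi_gt0 R; have [x1|x1] := ltP 1 x.
  by apply: le_lt_trans x1; exact: sin_le1.
have pi2 := @pi_ge2 R.
have h (y : R) : 0 <= y <= x -> is_derive y (1 : R) (fun x => x - sin x) (1 - cos y).
  by move=> _; apply: is_deriveB.
have := derive_lt h _ x0; rewrite sin0 subr0 subr_gt0; apply => y /andP[y0 y1].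
by rewrite subr_gt0 cos_lt1 //; slra.
Qed.

Lemma tan_gt_id (x : R) : 0 < x < pi / 2 -> x < tan x.
Proof.
move=> /andP[x0 xp]; have pi0 := @pi_gt0 R.
have cp (y : R) : 0 <= y <= x -> 0 < cos y by move=> h; apply: cos_gt0; slra.
have h (y : R) : 0 <= y <= x -> is_derive y (1 : R) (fun x => tan x - x) (cos y ^- 2 - 1).
  move=> yx; apply: is_deriveB; apply: is_derive_tan; by rewrite gt_eqF // cp.
have := derive_lt h _ x0; rewrite tan0 subr0 subr_gt0; apply => y /andP[y0 y1].
have c0 : 0 < cos y by apply: cp; slra.
have c1 : cos y < 1 by apply: cos_lt1; slra.
by rewrite subr_gt0 invf_gt1 ?exprn_gt0 // expr_lt1 // ltW.
Qed.

End Triangle.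

(** * The area of a circular sector *)

Section Sector.
Variable R : realType.

Local Notation T1 := (measurableTypeR R).
Local Notation T2 := (measurableTypeR R * measurableTypeR R)%type.
Local Notation lam := (@lebesgue_measure R).
Local Notation mu := (lam \x lam)%E.
Implicit Types (A B : set (R * R)) (p q : R * R) (a b c t s u v : R) (f g : R -> R).

Lemma cst_cont r : continuous (cst r : R -> R).
Proof. by move=> x; exact: cvg_cst. Qed.

Lemma area_sector_rotate p r a d : 0 < r -> area (psec p a (a + d) (cst r)) = area (psec (0 : R * R) 0 d (cst r)).
Proof.
move=> r0; have := @area_psec_map R 0 p 1 a 0 d (cst r) ltr01 (@cst_cont r) (fun=> r0).
rewrite add0r (addrC d) expr1n mul1r => <-; congr area; apply: psec_eq => t _.
by rewrite mul1r.
Qed.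

Lemma area_sectorD r d e : 0 < r -> 0 <= d -> 0 <= e -> d + e <= 2 * pi ->
  area (psec (0 : R * R) 0 (d + e) (cst r)) = area (psec (0 : R * R) 0 d (cst r)) + area (psec (0 : R * R) 0 e (cst r)).
Proof.
move=> r0 d0 e0 de; have c := @cst_cont r.
rewrite (@area_psec_cat R 0 0 d (d + e) (cst r) c (fun=> r0)); last 2 first.
- by rewrite d0 lerDl.
- by rewrite add0r.
by rewrite area_sector_rotate.
Qed.

Lemma area_sectorMn r d n : 0 < r -> 0 <= d -> d *+ n <= 2 * pi ->
  area (psec (0 : R * R) 0 (d *+ n) (cst r)) = area (psec (0 : R * R) 0 d (cst r)) *+ n.
Proof.
move=> r0 d0; elim: n => [_|n IH dn].
  rewrite !mulr0n (_ : psec _ _ _ _ = set0) ?/area ?/plane_measure ?measure0 //.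
  by apply/seteqP; split => // z [t [s [/andP[t0 t1] _ _]]]; move: (le_lt_trans t0 t1); rewrite ltxx.
move: dn; rewrite (mulrSr d) [RHS]mulrSr => dn.
rewrite area_sectorD //; last exact: mulrn_wge0.
by rewrite IH //; apply: le_trans dn; rewrite lerDl.
Qed.

(** Both bounds are areas of triangles: one is tangent to the arc at angle 0, the other has apothem
    [r * cos d] and meets the arc at angle [d]. *)
Lemma area_sector_bounds r d : 0 < r -> 0 < d < pi / 2 ->
  r ^+ 2 * (cos d ^+ 2 * tan d) / 2 <= area (psec (0 : R * R) 0 d (cst r)) <= r ^+ 2 * tan d / 2.
Proof.
move=> r0 /andP[d0 dp]; have c := @cst_cont r.
have pi0 := @pi_gt0 R; have cd : 0 < cos d by apply: cos_gt0; slra.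
have cdt (t : R) : 0 <= t <= d -> cos d <= cos t <= 1.
  move=> td; rewrite cos_le1 andbT.
  have := @cos_min R 0 d t; rewrite cos0 (min_idPr (cos_le1 d)); apply => //; slra.
have [f [cf f0 fE fA]] := @area_triangle R 0 r 0 d 0 r0 ltac:(slra) (ltW d0) ltac:(slra).
have rc0 : 0 < r * cos d by rewrite mulr_gt0.
have [g [cg g0 gE gA]] := @area_triangle R 0 (r * cos d) 0 d 0 rc0 ltac:(slra) (ltW d0) ltac:(slra).
rewrite !subr0 tan0 subr0 in fA gA.
rewrite -fA (_ : _ / 2 = area (psec (0 : R * R) 0 d g)); last by rewrite gA; ring.
apply/andP; split; apply: area_psec_le => // t /andP[t0 t1].
  have tI : 0 <= t <= d by rewrite t0 ltW.
  have /andP[h1 h2] := cdt _ tI.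
  rewrite gE // subr0 /= ler_pdivrMr ?(lt_le_trans cd) //.
  by rewrite ler_pM2l.
have tI : 0 <= t <= d by rewrite t0 ltW.
have /andP[h1 h2] := cdt _ tI.
by rewrite fE // subr0 /= ler_pdivlMr ?(lt_le_trans cd) // ler_piMr // ltW.
Qed.

(** The sector is cut into [n.+1] equal slices, each squeezed between two triangles with an error
    cubic in its angle; the total error is of order [n.+1%:R ^- 2] and vanishes in the limit. *)
Lemma area_sector p r a b : 0 < r -> a <= b <= a + 2 * pi ->
  area (psec p a b (cst r)) = r ^+ 2 * (b - a) / 2.
Proof.
move=> r0 /andP[]; rewrite le_eqVlt => /predU1P[<- _|ab ba].
  have := @area_sectorMn r 0 0 r0 (lexx _) ltac:(by rewrite mulr0n mulr_ge0 // pi_ge0).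
  by rewrite !mulr0n -(area_sector_rotate p a 0 r0) addr0 => ->; rewrite subrr mulr0 mul0r.
pose d := b - a; have -> : b = a + d by rewrite /d addrC subrK.
rewrite area_sector_rotate // [a + d]addrC addrK.
have d0 : 0 < d by rewrite subr_gt0.
have dp : d <= 2 * pi by rewrite /d; slra.
have pi0 := @pi_gt0 R; have pi2 := @pi_ge2 R.
set X := area _; apply/eqP; rewrite -subr_eq0 -normr_le0.
(* The second alternative discards the [n] for which the slice angle is at least 1 / 2, where the
   lower bound on its cosine would fail to be available. *)
have key n : `|X - r ^+ 2 * d / 2| <= r ^+ 2 * d ^+ 3 / n.+1%:R ^+ 2 \/ n.+1%:R <= d * 2.
  have [h|h] := leP n.+1%:R (d * 2); first by right.
  left; have n0 : 0 < n.+1%:R :> R by rewrite ltr0n.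
  set e := d / n.+1%:R; have e0 : 0 < e by rewrite divr_gt0.
  have ne : e *+ n.+1 = d by rewrite -mulr_natr /e divfK // gt_eqF.
  have e1 : e < 2^-1 by rewrite /e ltr_pdivrMr // mulrC ltr_pdivlMr.
  have ep : 0 < e < pi / 2 by slra.
  have := area_sector_bounds r0 ep; have := @area_sectorMn r e n.+1 r0 (ltW e0).
  rewrite ne => /(_ dp); rewrite -/X => -> /andP[h1 h2].
  have te := tan_gt_id ep; have se := sin_lt_id e0.
  have ce : 0 < cos e by apply: cos_gt0; slra.
  have cs := cos2Dsin2 e.
  have tE : tan e = sin e / cos e by [].
  have s0 : 0 < sin e.
    have : 0 < tan e by slra.
    by rewrite tE pmulr_lgt0 ?invr_gt0.
  have s2 : sin e ^+ 2 <= e ^+ 2 by rewrite ler_sqr ?nnegrE; slra.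
  have e2 : e ^+ 2 <= 2^-1 ^+ 2 by rewrite ler_sqr ?nnegrE; slra.
  have c1 := cos_le1 e.
  have c3 : 2^-1 <= cos e.
    have : cos e ^+ 2 <= cos e by rewrite expr2 ler_piMr // ltW.
    by move: s2 e2 cs; set a1 := _ ^+ 2; set a2 := _ ^+ 2; slra.
  have te2 : tan e <= 2 * e.
    rewrite tE ler_pdivrMr //; apply: (le_trans (ltW se)).
    by rewrite mulrAC ler_peMl //; slra.
  have sc : cos e ^+ 2 * tan e <= e.
    have -> : cos e ^+ 2 * tan e = sin e * cos e by rewrite tE; field; rewrite gt_eqF.
    by apply: le_trans (ltW se); rewrite ler_piMr // ltW.
  have gap : tan e - cos e ^+ 2 * tan e <= 2 * e ^+ 3.
    have -> : tan e - cos e ^+ 2 * tan e = (1 - cos e ^+ 2) * tan e by ring.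
    have -> : 1 - cos e ^+ 2 = sin e ^+ 2 by rewrite -cs; ring.
    rewrite (_ : 2 * e ^+ 3 = e ^+ 2 * (2 * e)); last by ring.
    by apply: ler_pM => //; [rewrite sqr_ge0|slra].
  set Y := area _ in h1 h2 *.
  have r2 : 0 < r ^+ 2 by rewrite exprn_gt0.
  have YE : `|Y - r ^+ 2 * e / 2| <= r ^+ 2 * e ^+ 3.
    have g1 : r ^+ 2 * (tan e - cos e ^+ 2 * tan e) <= r ^+ 2 * (2 * e ^+ 3).
      by rewrite ler_pM2l.
    have g2 : r ^+ 2 * e <= r ^+ 2 * tan e by rewrite ler_pM2l // ltW.
    have g3 : r ^+ 2 * (cos e ^+ 2 * tan e) <= r ^+ 2 * e by rewrite ler_pM2l.
    rewrite ler_norml mulrBr in g1 *.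
    rewrite (_ : r ^+ 2 * (2 * e ^+ 3) = 2 * (r ^+ 2 * e ^+ 3)) in g1; last by ring.
    move: h1 h2 g1 g2 g3; set a1 := r ^+ 2 * tan e; set a2 := r ^+ 2 * e; set a3 := r ^+ 2 * _; set a4 := r ^+ 2 * _.
    by slra.
  have -> : Y *+ n.+1 - r ^+ 2 * d / 2 = (Y - r ^+ 2 * e / 2) * n.+1%:R.
    rewrite (_ : d = e * n.+1%:R); last by rewrite -ne mulr_natr.
    by rewrite -[_ *+ n.+1]mulr_natr; ring.
  rewrite normrM (gtr0_norm n0) -ler_pdivlMr //; apply: le_trans YE _.
  rewrite le_eqVlt (_ : _ == _) // /e; apply/eqP; field.
  by rewrite ?gt_eqF // ltr_wpDl // ler0n.
rewrite leNgt; apply/negP => Z0.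
set Z := `|_| in key Z0.
pose M := r ^+ 2 * d ^+ 3 / Z + d * 2.
have M0 : 0 < r ^+ 2 * d ^+ 3 / Z by rewrite divr_gt0 // mulr_gt0 // exprn_gt0.
pose n := Num.truncn (M + 1); have nM : M + 1 < n.+1%:R by exact: truncnS_gt.
have n1 : 1 <= n.+1%:R :> R by rewrite ler1n.
have [h|] := key n; last by rewrite leNgt => /negP; apply; rewrite /M in nM; slra.
have : n.+1%:R ^+ 2 <= r ^+ 2 * d ^+ 3 / Z.
  by rewrite ler_pdivlMr // mulrC -ler_pdivlMr // exprn_gt0 // (lt_le_trans ltr01).
have : n.+1%:R <= n.+1%:R ^+ 2 :> R by rewrite expr2 ler_peMl //; slra.
by rewrite /M in nM; slra.
Qed.

End Sector.

(** * Polygons inscribed in a profile *)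

Section Uniform.
Variable R : realType.
Implicit Types (f : R -> R) (a b x y d e A s m q T k : R).

(** Only [x] is confined to [a, b]: the comparison point [y] may lie slightly outside. *)
Lemma uniform_continuity f a b e : continuous f -> 0 < e ->
  exists2 d, 0 < d & forall x y, a <= x <= b -> `|y - x| <= d -> `|f y - f x| < e.
Proof.
move=> cf e0.
have cI := @segment_compact R a b.
have := (compact_near_coveringP `[a, b]%classic).1 cI R (0^'+) (fun d x => forall y, `|y - x| <= d -> `|f y - f x| < e).
case=> [x _|].
  have [d d0 dP] : exists2 d, 0 < d & forall u, `|u - x| < d -> `|f u - f x| < e / 2.
    apply/nbhs_ball_real; have /cvgrPdist_lt/(_ (e / 2) ltac:(slra)) := cf x.
    by apply: filterS => u; rewrite distrC.
  exists ([set y | `|y - x| < d / 2], [set h | h < d / 2]); first split.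
  - by apply/nbhs_ball_real; exists (d / 2) => //; slra.
  - by apply: nbhs_right_lt; slra.
  move=> [x' h] /= [xx' hd] y yx.
  have h1 : `|f x' - f x| < e / 2 by apply: dP; slra.
  have h2 : `|f y - f x| < e / 2.
    by apply: dP; have := ler_distD x' y x; slra.
  by have := ler_distD (f x) (f y) (f x'); rewrite (distrC (f x)); slra.
move=> d /= d0 dP; exists (d / 2) => [|x y xab yx]; first by slra.
apply: (dP (d / 2)) yx; rewrite /= ?in_itv //=; last by slra.
by rewrite sub0r normrN gtr0_norm; slra.
Qed.

Lemma cos_ge_quad x : 1 - x ^+ 2 / 2 <= cos x.
Proof.
have -> : x = (x / 2) *+ 2 by rewrite mulr2n; field.
rewrite cos_mulr2n; set y := x / 2; have cs := cos2Dsin2 y.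
have -> : y *+ 2 = 2 * y by rewrite mulr_natl.
suff h : sin y ^+ 2 <= y ^+ 2 by rewrite -[cos y ^+ 2 *+ 2]mulr_natl; slra.
wlog y0 : y {cs} / 0 <= y => [H|].
  have [/H//|y0] := leP 0 y.
  by have := H (- y) ltac:(slra); rewrite sinN !sqrrN.
move: y0; rewrite le_eqVlt => /predU1P[<-|y0]; first by rewrite sin0.
have h1 := sin_lt_id y0.
rewrite -(real_normK (num_real (sin y))) ler_sqr ?nnegrE //; last exact: ltW.
rewrite ler_norml (ltW h1) andbT; have [y1|y1] := ltP 1 y.
  by apply: le_trans (sin_geN1 y); slra.
have pi2 := @pi_ge2 R; apply: (@le_trans _ _ 0); first by slra.
by apply: sin_ge0_pi; slra.
Qed.

Lemma bernoulli_ineq x n : 0 <= x <= 1 -> 1 - n%:R * x <= (1 - x) ^+ n.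
Proof.
move=> /andP[x0 x1]; elim: n => [|n IH]; first by rewrite mul0r subr0 expr0.
rewrite exprS; have n0 : 0 <= n%:R :> R by [].
have : 0 <= n%:R * x * x by rewrite !mulr_ge0.
have h : (1 - x) * (1 - n%:R * x) <= (1 - x) * (1 - x) ^+ n.
  by apply: ler_wpM2l => //; rewrite subr_ge0.
by move: h; set A := (1 - x) ^+ n; rewrite -natr1; slra.
Qed.

Lemma crossing_radius_ge A s m x y : 0 < m -> m <= A -> m <= s ->
  0 <= x -> 0 <= y -> 0 < x + y < pi / 2 ->
  m * cos (x + y) <= A * s * sin (x + y) / (A * sin x + s * sin y).
Proof.
move=> m0 mA ms x0 y0 /andP[d0 dp]; have pi0 := @pi_gt0 R.
have A0 : 0 < A by slra.
have s0 : 0 < s by slra.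
have D0 : 0 < A * sin x + s * sin y.
  have := @ray_cross_gt0 R A s 0 x (x + y) A0 s0 ltac:(slra) ltac:(slra).
  by rewrite subr0 addrAC subrr add0r.
rewrite ler_pdivlMr // sinD mulrDr mulrDr.
have cle z : 0 <= z <= x + y -> cos (x + y) <= cos z.
  move=> /andP[z0]; rewrite le_eqVlt => /predU1P[->//|zx].
  by apply/ltW; rewrite ltr_cos // in_itv /=; slra.
have sx : 0 <= sin x by apply: sin_ge0_pi; slra.
have sy : 0 <= sin y by apply: sin_ge0_pi; slra.
have cxy : 0 <= cos (x + y) by apply/ltW/cos_gt0; slra.
have c1 : cos (x + y) <= cos y by apply: cle; slra.
have c2 : cos (x + y) <= cos x by apply: cle; slra.
apply: lerD.
  have -> : A * s * (sin x * cos y) = (s * cos y) * (A * sin x) by ring.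
  apply: ler_wpM2r; first by rewrite mulr_ge0 // ltW.
  by apply: ler_pM => //; exact: ltW.
have -> : A * s * (cos x * sin y) = (A * cos x) * (s * sin y) by ring.
apply: ler_wpM2r; first by rewrite mulr_ge0 // ltW.
by apply: ler_pM => //; exact: ltW.
Qed.

(** The cube of [1 - e / 3] exceeds [1 - e] by [e ^+ 2 * (1 / 3 - e / 27)]. The three factors will
    be the damping of the samples, the oscillation of the profile and the sag of the chords. *)
Lemma three_factors e q T T' k : 0 < e < 1 -> 1 - e / 3 <= q -> 1 - e / 3 <= k ->
  0 <= T -> (1 - e / 3) * T <= T' -> (1 - e) * T <= q * T' * k.
Proof.
move=> /andP[e0 e1] hq hk T0 hT; set w := 1 - e / 3 in hq hk hT.
have w0 : 0 <= w by rewrite /w; slra.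
have wT : 0 <= w * T by rewrite mulr_ge0.
have h := ler_pM (mulr_ge0 w0 wT) w0 (ler_pM w0 wT hq hT) hk.
apply: le_trans h; rewrite (_ : w * (w * T) * w = (1 - e + e ^+ 2 * (1 / 3 - e / 27)) * T); last first.
  by rewrite /w; field.
rewrite ler_wpM2r //; have : 0 <= e ^+ 2 * (1 / 3 - e / 27) by rewrite mulr_ge0 ?sqr_ge0 //; slra.
by slra.
Qed.

End Uniform.

Section Sampling.
Variable R : realType.
Variables (K : set (R * R)) (p : R * R).
Hypotheses (Kb : convex_body K) (pK : K° p).
Local Notation rho := (rad K p).
Local Notation bp := (bpt K p).

(** [tau] is the profile to be approximated from inside, with one peak [c k] between [b k] and
    [b k.+1]. That it touches [rho] there, at a local maximum of [rho], puts the rest of [K]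
    strictly below the perpendicular at the peak, by [locmax_below]. *)
Variables (n : nat) (b c : nat -> R) (tau : R -> R).
Hypotheses (n0 : (0 < n)%N)
  (bc : forall k, (k < n)%N -> b k < c k < b k.+1) (bn : b n = b 0%N + 2 * pi)
  (tau_cont : continuous tau)
  (tau_gt0 : forall t, b 0%N <= t <= b n -> 0 < tau t)
  (tau_le : forall t, b 0%N <= t <= b n -> tau t <= rho t)
  (tau_incr : forall k x y, (k < n)%N -> b k <= x -> x <= y -> y <= c k -> tau x <= tau y)
  (tau_decr : forall k x y, (k < n)%N -> c k <= x -> x <= y -> y <= b k.+1 -> tau y <= tau x)
  (tau_peak : forall k, (k < n)%N -> tau (c k) = rho (c k))
  (rho_peak : forall k, (k < n)%N -> \forall u \near c k, rho u <= rho (c k)).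

Variable N : nat.
Hypothesis N6 : (6 <= N)%N.

Let N_gt0 : 0 < N%:R :> R. Proof. by rewrite ltr0n (leq_trans _ N6). Qed.
Let N_ge6 : 6 <= N%:R :> R. Proof. by rewrite ler_nat. Qed.

(* Since 2 pi^2 < 33, the cosine of an angle at most 2 pi / N exceeds [ratio]. *)
Definition ratio : R := 1 - 33 / N%:R ^+ 2.

Lemma ratio_itv : 0 < ratio < 1.
Proof.
have N6' := N_ge6; have h : 36 <= N%:R ^+ 2 :> R.
  by apply: (@le_trans _ _ (6 * 6)); [lra|rewrite expr2; apply: ler_pM].
rewrite /ratio; apply/andP; split; last by rewrite ltrBlDr ltrDl divr_gt0 // exprn_gt0.
by rewrite subr_gt0 ltr_pdivrMr ?mul1r ?exprn_gt0 //; lra.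
Qed.

Lemma ratio_cos d : `|d| <= 2 * pi / N%:R -> ratio < cos d.
Proof.
move=> dN; apply: lt_le_trans (cos_ge_quad d).
have p4 : pi < 4 :> R by have := @pihalf_lt2 R; lra.
have pi0 := @pi_gt0 R.
rewrite /ratio ltrD2l ltrN2; have -> : d ^+ 2 = `|d| ^+ 2 by rewrite real_normK // num_real.
have h : `|d| ^+ 2 <= (2 * pi / N%:R) ^+ 2.
  by rewrite ler_sqr ?nnegrE // divr_ge0 // ?(ltW N_gt0) // mulr_ge0 // ltW.
apply: (@le_lt_trans _ _ ((2 * pi / N%:R) ^+ 2 / 2)); first by lra.
rewrite expr_div_n mulrAC ltr_pM2r ?invr_gt0 ?exprn_gt0 //.
have : pi ^+ 2 < 4 ^+ 2 :> R by rewrite ltr_sqr ?nnegrE //; exact: ltW.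
by rewrite exprMn; lra.
Qed.

Lemma b_mono k : (k < n)%N -> b 0%N <= b k /\ b k.+1 <= b n.
Proof.
move=> kn; have bb i : (i < n)%N -> b i < b i.+1 by move=> /bc /andP[]; exact: lt_trans.
by split; apply: (seq_mono_le bb) => //; exact: ltnW.
Qed.

(* The j-th sample from a peak has its radius multiplied by [ratio ^+ j]: it is then
   strictly dominated by the previous one, so that only peaks are equilibria of the hull. *)
Definition half_end (k : nat) (s : bool) : R := if s then b k.+1 else b k.
Definition sample_angle k s j : R := c k + (half_end k s - c k) * (j%:R / N%:R).
Definition sample_radius k s j : R := tau (sample_angle k s j) * ratio ^+ j.
Definition sample_point k s j : R * R := pol p (sample_radius k s j) (sample_angle k s j).

Lemma half_end_dist k s : (k < n)%N -> `|half_end k s - c k| <= 2 * pi.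
Proof.
move=> kn; have [h1 h2] := b_mono kn; have /andP[h3 h4] := bc kn; have bn' := bn.
by rewrite ler_norml; case: s; rewrite /half_end; lra.
Qed.

Lemma sample_angle_itv k s j : (k < n)%N -> (j <= N)%N ->
  if s then c k <= sample_angle k s j <= b k.+1 else b k <= sample_angle k s j <= c k.
Proof.
move=> kn jN; have /andP[h3 h4] := bc kn; rewrite /sample_angle.
set x : R := j%:R / N%:R; have /andP[x0 x1] : 0 <= x <= 1.
  by rewrite divr_ge0 // ?(ltW N_gt0) //= ler_pdivrMr // mul1r ler_nat.
 case: s => /=.
  have h5 : 0 <= (b k.+1 - c k) * x by rewrite mulr_ge0 // subr_ge0 ltW.
  have : (b k.+1 - c k) * x <= b k.+1 - c k by rewrite ler_piMr // subr_ge0 ltW.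
  by lra.
have h5 : 0 <= (c k - b k) * x by rewrite mulr_ge0 // subr_ge0 ltW.
have : (c k - b k) * x <= c k - b k by rewrite ler_piMr // subr_ge0 ltW.
by lra.
Qed.

Lemma sample_angle_in k s j : (k < n)%N -> (j <= N)%N -> b 0%N <= sample_angle k s j <= b n.
Proof.
move=> kn jN; have [h1 h2] := b_mono kn; have /andP[h3 h4] := bc kn.
by have := sample_angle_itv s kn jN; case: s => /andP[]; lra.
Qed.

Lemma sample_angleS k s j : sample_angle k s j.+1 - sample_angle k s j = (half_end k s - c k) / N%:R.
Proof. by rewrite /sample_angle -natr1; field; rewrite gt_eqF. Qed.

Lemma sample_step k s j : (k < n)%N ->
  `|sample_angle k s j.+1 - sample_angle k s j| <= 2 * pi / N%:R.
Proof.
move=> kn; rewrite sample_angleS normrM normfV (gtr0_norm N_gt0).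
by rewrite ler_pM2r ?invr_gt0 // half_end_dist.
Qed.

Lemma sample_tau_decr k s j : (k < n)%N -> (j < N)%N ->
  tau (sample_angle k s j.+1) <= tau (sample_angle k s j).
Proof.
move=> kn jN; have := sample_angle_itv s kn jN; have := sample_angle_itv s kn (ltnW jN).
have := sample_angleS k s j; have /andP[h3 h4] := bc kn; case: s => /= e /andP[h5 h6] /andP[h7 h8].
  have : 0 < (b k.+1 - c k) / N%:R by rewrite divr_gt0 // subr_gt0.
  by move=> h; apply: (tau_decr kn) => //; lra.
have : 0 < (c k - b k) / N%:R by rewrite divr_gt0 // subr_gt0.
have -> : (c k - b k) / N%:R = - ((b k - c k) / N%:R) by rewrite -mulNr opprB.
by move=> h; apply: (tau_incr kn) => //; lra.
Qed.

Lemma sample_radius_gt0 k s j : (k < n)%N -> (j <= N)%N -> 0 < sample_radius k s j.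
Proof.
move=> kn jN; have /andP[q0 _] := ratio_itv.
by rewrite mulr_gt0 ?exprn_gt0 // tau_gt0 // sample_angle_in.
Qed.

Lemma sample_in k s j : (k < n)%N -> (j <= N)%N -> K (sample_point k s j).
Proof.
move=> kn jN; apply/(in_radP Kb pK); first exact/ltW/sample_radius_gt0.
have /andP[q0 q1] := ratio_itv; have h := sample_angle_in s kn jN.
apply: le_trans (tau_le h); rewrite /sample_radius ler_piMr ?(ltW (tau_gt0 h)) //.
by rewrite exprn_ile1 // ltW.
Qed.

Lemma sample0 k s : (k < n)%N -> sample_point k s 0 = bp (c k).
Proof.
by move=> kn; rewrite /sample_point /sample_radius /sample_angle mul0r mulr0 addr0 mulr1 tau_peak.
Qed.

Lemma dot_pol_pol r s t u : dot (pol p r t - pol p s u) (pol p s u - p) = s * (r * cos (t - u) - s).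
Proof.
rewrite /dot /pol /= cosB; have cs := cos2Dsin2 u.
transitivity (s * (r * (cos t * cos u + sin t * sin u) - s * (cos u ^+ 2 + sin u ^+ 2))); first by ring.
by rewrite cs mulr1.
Qed.

(** Positivity says that the perpendicular at sample [j.+1] does not support the hull. It holds
    because the radius loses a factor [ratio] at each step, and [ratio] is smaller than the cosine
    of the angular step. *)
Lemma sample_dominated k s j : (k < n)%N -> (j < N)%N ->
  0 < dot (sample_point k s j - sample_point k s j.+1) (sample_point k s j.+1 - p).
Proof.
move=> kn jN; rewrite dot_pol_pol; have r1 := sample_radius_gt0 s kn jN.
apply: mulr_gt0 => //; rewrite subr_gt0.
have /andP[q0 q1] := ratio_itv; have r0 := sample_radius_gt0 s kn (ltnW jN).
have qc : ratio < cos (sample_angle k s j - sample_angle k s j.+1).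
  by apply: ratio_cos; rewrite distrC sample_step.
apply: (@le_lt_trans _ _ (sample_radius k s j * ratio)); last by rewrite ltr_pM2l.
rewrite /sample_radius exprSr mulrA ler_pM2r // ler_pM2r ?exprn_gt0 //.
exact: sample_tau_decr.
Qed.

Definition sample_vertex (i : 'I_#|{: 'I_n * bool * 'I_N.+1}|) : R * R :=
  let x := enum_val i in sample_point x.1.1 x.1.2 x.2.

Local Notation H := (convex_hull sample_vertex).

Lemma sample_hull k s j : (k < n)%N -> (j <= N)%N -> H (sample_point k s j).
Proof.
move=> kn jN; pose x : 'I_n * bool * 'I_N.+1 := (Ordinal kn, s, Ordinal (jN : (j < N.+1)%N)).
have <- : sample_vertex (enum_rank x) = sample_point k s j by rewrite /sample_vertex enum_rankK.
exact: hull_vertex.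
Qed.

Lemma sample_hull_sub : H `<=` K.
Proof.
have [_ Kc _] := Kb; apply: hull_min => // i; rewrite /sample_vertex.
by apply: sample_in => //; rewrite -ltnS.
Qed.

Lemma between t : b 0%N <= t <= b n -> exists k s j, [/\ (k < n)%N, (j < N)%N &
  (sample_angle k s j <= t <= sample_angle k s j.+1) \/
  (sample_angle k s j.+1 <= t <= sample_angle k s j)].
Proof.
have unit_cell (x : R) : 0 <= x <= 1 -> exists2 j, (j < N)%N & j%:R / N%:R <= x <= j.+1%:R / N%:R.
  move=> /andP[x0]; rewrite le_eqVlt => /predU1P[->|x1].
    exists N.-1; first by rewrite prednK // (leq_trans _ N6).
    rewrite prednK ?(leq_trans _ N6) // divff ?gt_eqF //; apply/andP; split => //.
    by rewrite ler_pdivrMr // mul1r ler_nat leq_pred.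
  have xN : 0 <= x * N%:R by rewrite mulr_ge0 // ltW.
  have /andP[xl xg] := truncn_itv xN.
  exists (Num.truncn (x * N%:R)).
    by rewrite -(ltr_nat R) (le_lt_trans xl) // gtr_pMl.
  by rewrite ler_pdivrMr // xl /= ler_pdivlMr // ltW.
move=> /andP[t0]; have bb i : (i < n)%N -> b i < b i.+1 by move=> /bc /andP[]; exact: lt_trans.
move=> tn; have [k kn /andP[kt tk]] : exists2 k, (k < n)%N & b k <= t <= b k.+1.
  move: tn; rewrite le_eqVlt => /predU1P[->|tn].
    by exists n.-1; rewrite prednK // lexx andbT ltW // -[in X in _ < X](prednK n0) bb // prednK.
  have [k kn /andP[h1 h2]] := param_arc bb (introT andP (conj t0 tn)).
  by exists k => //; rewrite h1 ltW.
have /andP[h3 h4] := bc kn.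
have [tc|tc] := leP t (c k).
  have d0 : 0 < c k - b k by rewrite subr_gt0.
  have [|j jN /andP[j1 j2]] := @unit_cell ((c k - t) / (c k - b k)).
    rewrite divr_ge0 ?subr_ge0 //= ?ler_pdivrMr ?mul1r ?lerD2l ?lerN2 //; exact: ltW.
  exists k, false, j; split => //; right; rewrite /sample_angle /=.
  move: j1 j2; rewrite ler_pdivlMr // ler_pdivrMr //.
  by set x := _ / _; set y := _ / _; lra.
have d0 : 0 < b k.+1 - c k by rewrite subr_gt0.
have [|j jN /andP[j1 j2]] := @unit_cell ((t - c k) / (b k.+1 - c k)).
  apply/andP; split; first by rewrite divr_ge0 // ?subr_ge0 ltW.
  by rewrite ler_pdivrMr // mul1r lerD2r.
exists k, true, j; split => //; left; rewrite /sample_angle /=.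
move: j1 j2; rewrite ler_pdivlMr // ler_pdivrMr //.
by set x := _ / _; set y := _ / _; lra.
Qed.

(** The ray crosses the chord between two neighbouring samples, whose radii are both at least [m];
    the total damping is at most [ratio ^+ N], and the chord sags by a cosine of the step. *)
Lemma sample_hull_ray t e : b 0%N <= t <= b n -> 0 < e < tau t ->
  (forall u, `|u - t| <= 2 * pi / N%:R -> tau t - e <= tau u) ->
  exists2 X, ratio ^+ N * (tau t - e) * cos (2 * pi / N%:R) <= X & 0 < X /\ H (pol p X t).
Proof.
move=> tb /andP[e0 et] te; have [k [s [j [kn jN tj]]]] := between tb.
have Hj := sample_hull s kn (ltnW jN); have Hj1 := sample_hull s kn jN.
have st := sample_step s j kn.
set m := ratio ^+ N * (tau t - e).
have /andP[q0 q1] := ratio_itv.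
have m0 : 0 < m by rewrite mulr_gt0 ?exprn_gt0 // subr_gt0.
have rad_ge i : (i <= N)%N -> `|sample_angle k s i - t| <= 2 * pi / N%:R -> m <= sample_radius k s i.
  move=> iN it; rewrite /m /sample_radius mulrC; apply: ler_pM.
  - by rewrite subr_ge0 ltW.
  - by rewrite exprn_ge0 // ltW.
  - exact: te.
  - by rewrite ler_wiXn2l ?ltW.
have pi0 := @pi_gt0 R; have N6' := N_ge6.
(* Six steps or more keep the angular step at most [pi / 3], below the [pi / 2] demanded by
   [crossing_radius_ge]. *)
have dd : 2 * pi / N%:R <= 2 * pi / 6 :> R.
  by rewrite ler_pM2l ?mulr_gt0 // lef_pV2 ?posrE.
have dne : sample_angle k s j.+1 != sample_angle k s j.
  rewrite -subr_eq0 sample_angleS; apply: mulf_neq0; last by rewrite invr_eq0 gt_eqF.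
  rewrite subr_eq0.
  by rewrite /half_end; have /andP[h3 h4] := bc kn; case: (s); [rewrite gt_eqF|rewrite lt_eqF].
move: st; rewrite ler_norml => /andP[st1 st2].
have rj : m <= sample_radius k s j.
  by apply: rad_ge; [exact: ltnW|rewrite ler_norml; case: tj => /andP[]; lra].
have rj1 : m <= sample_radius k s j.+1.
  by apply: rad_ge => //; rewrite ler_norml; case: tj => /andP[]; lra.
move: Hj Hj1 rj rj1; rewrite /sample_point.
set a := sample_angle k s j in dne st1 st2 tj *; set a' := sample_angle k s j.+1 in dne st1 st2 tj *.
move: (sample_radius k s j) (sample_radius k s j.+1) => A B Hj Hj1 rj rj1.
have go (x y A' B' : R) : x <= t <= y -> x != y -> y - x <= 2 * pi / N%:R ->
    H (pol p A' x) -> H (pol p B' y) -> m <= A' -> m <= B' ->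
    exists2 X, m * cos (2 * pi / N%:R) <= X & 0 < X /\ H (pol p X t).
  move=> /andP[xt ty] xy yx HA HB mA mB.
  have xy' : x < y by rewrite lt_neqAle xy (le_trans xt).
  have A0 : 0 < A' by lra.
  have B0 : 0 < B' by lra.
  have h := @crossing_radius_ge R A' B' m (t - x) (y - t) m0 mA mB ltac:(lra) ltac:(lra) ltac:(lra).
  have E : t - x + (y - t) = y - x by ring.
  rewrite E in h.
  have c0 : 0 < cos (y - x) by apply: cos_gt0; lra.
  have HX := ray_cross (@hull_convex _ _ _) HA HB A0 B0 (introT andP (conj xt ty)) ltac:(lra).
  move: HX h; set X := _ / _ => HX h; exists X.
    2: by split=> //; exact: lt_le_trans (mulr_gt0 m0 c0) h.
  apply: le_trans h; rewrite ler_pM2l //.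
  move: yx; rewrite le_eqVlt => /predU1P[->//|yx].
  by apply/ltW; rewrite ltr_cos // in_itv /=; lra.
case: tj => tj.
  by apply: (go _ _ _ _ tj _ _ Hj Hj1 rj rj1); [rewrite eq_sym|].
by apply: (go _ _ _ _ tj dne _ Hj1 Hj rj1 rj); lra.
Qed.

Definition filled e := forall t s, b 0%N <= t <= b n -> 0 <= s <= (1 - e) * tau t -> H (pol p s t).

Lemma sample_hull_filled e : (forall t, b 0%N <= t <= b n ->
    exists2 X, (1 - e) * tau t <= X & 0 < X /\ H (pol p X t)) -> filled e.
Proof.
move=> hX; have bn' := bn; have pi0 := @pi_gt0 R.
(* [p] lies between the points of the hull found on two opposite rays. *)
have Hp : H p.
  have [X _ [X0 HX]] := hX (b 0%N) ltac:(lra).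
  have [Y _ [Y0 HY]] := hX (b 0%N + pi) ltac:(lra).
  have XY : X + Y != 0 by rewrite gt_eqF // addr_gt0.
  have -> : p = seg (pol p X (b 0%N)) (pol p Y (b 0%N + pi)) (X / (X + Y)).
    rewrite /seg /pol /= cosDpi sinDpi [LHS]surjective_pairing; congr pair; field => //.
  apply: convex_set_seg => //; first exact: hull_convex.
  apply/andP; split; first by apply: divr_ge0; lra.
  by rewrite ler_pdivrMr ?mul1r; lra.
move=> t s tb /andP[s0 st]; have [X XX [X0 HX]] := hX t tb.
have -> : pol p s t = seg p (pol p X t) (s / X).
  by rewrite /seg /pol /=; congr pair; field; rewrite gt_eqF.
apply: convex_set_seg => //; first exact: hull_convex.
by rewrite divr_ge0 ?(ltW X0) //= ler_pdivrMr // mul1r (le_trans st).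
Qed.

Lemma filled_interior e m : 0 < m -> (forall t, b 0%N <= t <= b n -> m <= (1 - e) * tau t) ->
  filled e -> H° p.
Proof.
move=> m0 mle fH; apply/nbhs_boxP; exists (m / 2) => [|z z1 z2]; first by lra.
have [t [s [/andP[t0 t1] s0 zE]]] := polar_exists p z (b 0%N).
have tb : b 0%N <= t <= b n by rewrite bn t0 ltW.
rewrite zE; apply: fH => //; rewrite s0 /=; apply: le_trans (mle t tb).
have : s ^+ 2 <= m ^+ 2.
  rewrite -(dot_pol_self p s t) -zE /dot /= -!expr2.
  have sq x : `|x| < m / 2 -> x ^+ 2 <= (m / 2) ^+ 2.
    move=> xm; rewrite -(real_normK (num_real x)) ler_sqr ?nnegrE //; lra.
  have := sq _ z1; have := sq _ z2; set X := (z.1 - p.1) ^+ 2; set Y := (z.2 - p.2) ^+ 2.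
  by have := exprn_gt0 2 m0; lra.
by rewrite ler_sqr ?nnegrE // ltW.
Qed.

Hypothesis iH : H° p.

Lemma sample_peak i : equilibrium H p (sample_vertex i) ->
  exists j : 'I_n, sample_vertex i = bp (c j).
Proof.
rewrite /sample_vertex; case: (enum_val i) => [[k s] j] /= eqi; exists k.
case: j eqi => [[|j] jN] /= eqi; first exact: sample0.
have /= := equilibrium_supports (hull_body iH) iH eqi (sample_hull s (ltn_ord k) (ltnW jN)).
by rewrite leNgt sample_dominated.
Qed.

Lemma sample_hull_nondegenerate : only_nondegenerate H p.
Proof.
apply: hull_only_nondegenerate => // k eqk i; have [j ->] := sample_peak eqk => ij.
apply: (locmax_below Kb pK) => //; first exact: rho_peak.
by apply: sample_hull_sub; exact: hull_vertex.
Qed.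

(** A local maximum of the radius of the hull is a vertex equilibrium, hence one of the [n]
    peaks. *)
Lemma sample_hull_count : exists2 S, (S <= n)%N & has_stable_points H p S.
Proof.
apply: (stable_count_le (hull_body iH) iH (P := fun j : 'I_n => bp (c j))) => t tmax.
by have [i eqi ->] := hull_locmax_vertex iH tmax; exact: sample_peak.
Qed.

End Sampling.

Section Construction.
Variable R : realType.
Implicit Types (K : set (R * R)) (p : R * R).

(** Damping, oscillation of [tau] over one step and sag of the chords each cost a factor at least
    [1 - e / 3] once the samples are dense enough; [three_factors] combines them. *)
Lemma inner_body K p (n : nat) (b c : nat -> R) (tau : R -> R) (e : R) :
  convex_body K -> K° p -> (0 < n)%N ->
  (forall k, (k < n)%N -> b k < c k < b k.+1) -> b n = b 0%N + 2 * pi ->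
  continuous tau ->
  (forall t, b 0%N <= t <= b n -> 0 < tau t <= rad K p t) ->
  (forall k x y, (k < n)%N -> b k <= x -> x <= y -> y <= c k -> tau x <= tau y) ->
  (forall k x y, (k < n)%N -> c k <= x -> x <= y -> y <= b k.+1 -> tau y <= tau x) ->
  (forall k, (k < n)%N -> tau (c k) = rad K p (c k)) ->
  (forall k, (k < n)%N -> \forall u \near c k, rad K p u <= rad K p (c k)) ->
  0 < e < 1 ->
  exists K', [/\ ps_convex_body K', K' `<=` K, K'° p, only_nondegenerate K' p &
    (exists2 S, (S <= n)%N & has_stable_points K' p S) /\
    forall t s, b 0%N <= t <= b n -> 0 <= s <= (1 - e) * tau t -> K' (pol p s t)].
Proof.
move=> Kb pK n0 bc bn tc tau_itv ti td tp rp /andP[e0 e1].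
have pi0 := @pi_gt0 R.
have tau_gt0 t : b 0%N <= t <= b n -> 0 < tau t by move=> /tau_itv/andP[].
have tau_le t : b 0%N <= t <= b n -> tau t <= rad K p t by move=> /tau_itv/andP[].
have [||t0 t0b tmin] := @EVT_min R tau (b 0%N) (b n); first by slra.
  exact: continuous_subspaceT.
rewrite in_itv /= in t0b; set m := tau t0 in tmin.
have m0 : 0 < m := tau_gt0 _ t0b.
have {}tmin t : b 0%N <= t <= b n -> m <= tau t by move=> h; apply: tmin; rewrite in_itv.
have em0 : 0 < m * e / 3 by rewrite divr_gt0 // mulr_gt0.
have [d d0 dP] := uniform_continuity (b 0%N) (b n) tc em0.
(* The term [99 / e] gives [33 / N <= e / 3], where by the Bernoulli inequality [ratio ^+ N] is at
   least [1 - 33 / N]; the term [2 * pi / d] makes the angular step at most [d], the modulus of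
   continuity. *)
pose N := (6 + ((Num.truncn (99 / e)).+1 + (Num.truncn (2 * pi / d)).+1))%N.
have N6 : (6 <= N)%N by exact: leq_addr.
have N0 : 0 < N%:R :> R by rewrite ltr0n (leq_trans _ N6).
have N1 : 1 <= N%:R :> R by rewrite ler1n (leq_trans _ N6).
have N99 : 99 / e <= N%:R.
  apply/ltW/(lt_le_trans (truncnS_gt (99 / e))); rewrite ler_nat.
  exact: leq_trans (leq_addr _ _) (leq_addl _ _).
have Nd : 2 * pi / d <= N%:R.
  apply/ltW/(lt_le_trans (truncnS_gt (2 * pi / d))); rewrite ler_nat.
  exact: leq_trans (leq_addl _ _) (leq_addl _ _).
clearbody N.
have dN : 2 * pi / N%:R <= d by rewrite ler_pdivrMr // (mulrC d) -ler_pdivrMr.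
have Ne : 33 / N%:R <= e / 3.
  by rewrite ler_pdivrMr // mulrAC ler_pdivlMr // mulrC; move: N99; rewrite ler_pdivrMr //; slra.
have q1 : 1 - e / 3 <= ratio R N ^+ N.
  apply: (@le_trans _ _ (1 - 33 / N%:R)); first by slra.
  have E : N%:R * (33 / N%:R ^+ 2) = 33 / N%:R :> R by field; rewrite gt_eqF.
  rewrite -E; apply: bernoulli_ineq.
  have /andP[h1 h2] := ratio_itv R N6; move: h1 h2; rewrite /ratio; slra.
have q2 : 1 - e / 3 <= cos (2 * pi / N%:R).
  apply: le_trans (cos_ge_quad _).
  have p4 : pi < 4 :> R by have := @pihalf_lt2 R; slra.
  have h1 : (2 * pi / N%:R) ^+ 2 <= 64 / N%:R :> R.
    have h2 : 2 * pi / N%:R <= 8 / N%:R :> R by rewrite ler_pM2r ?invr_gt0 //; slra.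
    have h3 : 2 * pi / N%:R <= 8 :> R by apply: le_trans h2 _; rewrite ler_pdivrMr // ler_peMr.
    have h4 : 0 <= 2 * pi / N%:R :> R by rewrite divr_ge0 ?mulr_ge0 ?ltW.
    have h5 := ler_pM h4 h4 h2 h3.
    by rewrite expr2; apply: (le_trans h5); rewrite mulrAC -natrM.
  by have : 64 / N%:R = 2 * (32 / 33) * (33 / N%:R) :> R; [field; rewrite gt_eqF|slra].
have fl : filled p n b c tau N e.
  apply: sample_hull_filled => // t tb.
  have tm := tmin t tb.
  have me : m * e / 3 < m by rewrite -mulrA gtr_pMr //; slra.
  have [X X1 [X0 HX]] : exists2 X, ratio R N ^+ N * (tau t - m * e / 3) * cos (2 * pi / N%:R) <= X &
      0 < X /\ convex_hull (sample_vertex p b c tau (N := N) (n := n)) (pol p X t).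
    apply: sample_hull_ray => //; first by rewrite em0; slra.
    by move=> u ut; have := dP t u tb (le_trans ut dN); rewrite ltr_norml => /andP[]; slra.
  exists X => //; apply: le_trans X1.
  have me' : m * e / 3 <= tau t * (e / 3) by rewrite -mulrA ler_wpM2r //; slra.
  by apply: three_factors; rewrite ?e0 //; slra.
have iH : (convex_hull (sample_vertex p b c tau (N := N) (n := n)))° p.
  apply: (filled_interior bn (m := (1 - e) * m) _ _ fl).
    by rewrite mulr_gt0 //; slra.
  by move=> t tb; rewrite ler_wpM2l ?tmin //; slra.
exists (convex_hull (sample_vertex p b c tau (N := N) (n := n))); split => //.
- by split; [exact: hull_body iH|exact: hull_piecewise_smooth iH].
- by apply: (sample_hull_sub Kb pK).
- by apply: (sample_hull_nondegenerate Kb pK).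
- by split => //; apply: (sample_hull_count (K := K)).
Qed.

End Construction.

(** * Cutting off a sector *)

Section Cut.
Variable R : realType.
Variables (K : set (R * R)) (p : R * R).
Hypotheses (Kb : convex_body K) (pK : K° p).
Local Notation rho := (rad K p).
Local Notation bp := (bpt K p).
Local Notation st := (stang K p).

Lemma body_psec a : K = psec p a (a + 2 * pi) rho `|` [set p].
Proof.
apply/seteqP; split => z.
  move=> Kz; have [t [s [ta s0 zE]]] := polar_exists p z a.
  move: s0; rewrite le_eqVlt => /predU1P[s0|s0].
    by right; rewrite zE -s0 /pol /= !mul0r !addr0 -surjective_pairing.
  by left; exists t, s; split => //; rewrite s0 /=; apply/(in_radP Kb pK); [exact: ltW|rewrite -zE].
case=> [[t [s [ta /andP[s0 sr] ->]]]|->]; last exact: Kp.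
by apply/(in_radP Kb pK) => //; exact: ltW.
Qed.

Lemma area_body a : area K = area (psec p a (a + 2 * pi) rho).
Proof.
have cr := rad_continuous Kb pK; have r0 := rad_gt0 Kb pK.
rewrite [in LHS](body_psec a) areaU; first by rewrite area_point addr0.
- exact: psec_fmes.
- apply: compact_fmes; exact: compact_set1.
- apply/seteqP; split => // z [[t [s [ta /andP[s0 sr] zE]]]] zp.
  have := dot_pol_self p s t; rewrite -zE zp subrr /dot /= !mul0r addr0 => /esym/eqP.
  by rewrite sqrf_eq0 gt_eqF.
Qed.

(* An arbitrary lower bound instead of the infimum: the same estimates then also
   show that [fewer_stable] is nonempty. *)
Variable M : R.
Hypothesis M_le : forall K', fewer_stable K p K' -> M <= area (K `\` K').

(** [inner_body] yields competitors that contain the profile shrunk by the factor [1 - e], whose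
    area is [(1 - e) ^+ 2] times that of the profile; the bound follows as [e] tends to 0. *)
Lemma lower_bound_profile S (n : nat) (b c : nat -> R) (tau : R -> R) :
  has_stable_points K p S -> (n < S)%N -> (0 < n)%N ->
  (forall k, (k < n)%N -> b k < c k < b k.+1) -> b n = b 0%N + 2 * pi ->
  continuous tau -> (forall t, 0 < tau t <= rho t) ->
  (forall k x y, (k < n)%N -> b k <= x -> x <= y -> y <= c k -> tau x <= tau y) ->
  (forall k x y, (k < n)%N -> c k <= x -> x <= y -> y <= b k.+1 -> tau y <= tau x) ->
  (forall k, (k < n)%N -> tau (c k) = rho (c k)) ->
  (forall k, (k < n)%N -> \forall u \near c k, rho u <= rho (c k)) ->
  M <= area K - area (psec p (b 0%N) (b 0%N + 2 * pi) tau).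
Proof.
move=> hS nS n0 bc bn tc tau_itv ti td tp rp.
have tau0 t : 0 < tau t by have /andP[] := tau_itv t.
set A := area (psec _ _ _ _).
have A0 : 0 <= A := area_ge0 _.
have key e : 0 < e < 1 -> M <= area K - (1 - e) ^+ 2 * A.
  move=> e01; have [K' [K'b K'K K'p K'n [[S' S'n hS'] K'f]]] :=
    @inner_body R K p n b c tau e Kb pK n0 bc bn tc (fun t _ => tau_itv t) ti td tp rp e01.
  have e1 : 0 < 1 - e by case/andP: e01 => ? ?; rewrite subr_gt0.
  have fK' : fewer_stable K p K'.
    by split => //; exists S, S'; split => //; exact: leq_ltn_trans nS.
  apply: le_trans (M_le fK') _.
  have := @area_psec_map R p p (1 - e) 0 (b 0%N) (b 0%N + 2 * pi) tau e1 tc tau0.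
  rewrite !addr0 => <-.
  have ct : continuous (fun t => (1 - e) * tau (t - 0)).
    by move=> t; apply: cvgM; [exact: cvg_cst|rewrite subr0; apply: cvg_trans (tc t); apply: near_eq_cvg; near=> u; rewrite subr0].
  have t0 t : 0 < (1 - e) * tau (t - 0) by rewrite mulr_gt0.
  have fP := @psec_fmes R p (b 0%N) (b 0%N + 2 * pi) _ ct t0.
  set B := psec _ _ _ _ in fP *.
  have BK' : B `<=` K'.
    move=> z [t [s [/andP[tb1 tb2] /andP[s0]]]]; rewrite subr0 => sr ->.
    by apply: K'f; [rewrite tb1 bn ltW|rewrite sr ltW].
  have [cK _ _] := Kb; have [[cK' _ _] _] := K'b.
  rewrite -areaD; [|exact: compact_fmes|exact: fmesW|exact: subset_trans K'K].
  apply: area_le.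
  - by apply: measurableD; apply: fmesW; exact: compact_fmes.
  - have fK := compact_fmes cK; apply: (fmes_sub _ fK) => [|z []//].
    by apply: measurableD; exact: fmesW.
  - by move=> z [Kz nK']; split => // /BK'.
rewrite leNgt; apply/negP => h; set d := M - (area K - A).
have d0 : 0 < d by rewrite subr_gt0.
(* Chosen so that [2 * e * A] is smaller than the supposed excess [d]. *)
pose e := Num.min (1 / 2) (d / (4 * (A + 1))).
have A1 : 0 < 4 * (A + 1) by slra.
have e0 : 0 < e by rewrite lt_min divr_gt0 // divr_gt0.
have e1 : e <= 1 / 2 by rewrite ge_min lexx.
have e2 : e * (4 * (A + 1)) <= d by rewrite -ler_pdivlMr // ge_min lexx orbT.
have := key e ltac:(slra).
have -> : (1 - e) ^+ 2 * A = A - 2 * (e * A) + e ^+ 2 * A by ring.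
have h1 : 0 <= e * A by rewrite mulr_ge0 // ltW.
have h2 : 0 <= e ^+ 2 * A by rewrite mulr_ge0 // sqr_ge0.
by rewrite /d in e2 d0; slra.
Unshelve. all: by end_near.
Qed.

Hypotheses (Ks : piecewise_smooth_boundary K) (Kn : only_nondegenerate K p).

Definition peak a b m := [/\ a < m < b, forall u, a <= u <= b -> rho u <= rho m,
    forall x y, a <= x <= y -> y <= m -> rho x <= rho y &
    forall x y, m <= x <= y -> y <= b -> rho y <= rho x].

Lemma peak_exists a b : st a -> st b -> a < b -> (forall t, a < t < b -> ~ st t) ->
  exists m, peak a b m.
Proof.
move=> sa sb ab nst; apply: unimodal => //.
- exact: rad_continuous.
- exact: stable_strict_min.
- exact: stable_strict_min.
- move=> m mab hm; apply: (nst m mab); apply: locmin_stable => //.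
  exact/Kn/locmin_equilibrium.
Qed.

Lemma peak_near a b m : peak a b m -> \forall u \near m, rho u <= rho m.
Proof. by case=> mab hm _ _; exact: (near_of_itv mab). Qed.

Lemma peak_mono a b m x y : peak a b m -> a <= x -> x <= y -> y <= m -> rho x <= rho y.
Proof. by case=> _ _ h _ ax xy ym; apply: h => //; rewrite ax. Qed.

Lemma peak_anti a b m x y : peak a b m -> m <= x -> x <= y -> y <= b -> rho y <= rho x.
Proof. by case=> _ _ _ h ax xy ym; apply: h => //; rewrite ax. Qed.

Lemma peak_ge a b m x : peak a b m -> m <= x <= b -> rho b <= rho x.
Proof. by move=> pk /andP[mx xb]; exact: (peak_anti pk mx xb). Qed.

Lemma peak_ge' a b m x : peak a b m -> a <= x <= m -> rho a <= rho x.
Proof. by move=> pk /andP[ax xm]; exact: (peak_mono pk _ ax xm). Qed.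

Lemma peaks_exist S (th : nat -> R) :
  (forall i, (i < S)%N -> th i < th i.+1) -> (forall i, (i <= S)%N -> st (th i)) ->
  (forall i t, (i < S)%N -> th i < t < th i.+1 -> ~ st t) ->
  exists m : nat -> R, forall i, (i < S)%N -> peak (th i) (th i.+1) (m i).
Proof.
move=> thS sth nst; pose P i x := (i < S)%N -> peak (th i) (th i.+1) x.
have /choice[m mP] : forall i, exists x, P i x.
  move=> i; have [iS|iS] := boolP (i < S)%N; last by exists 0 => h; rewrite h in iS.
  have [m pm] := peak_exists (sth i (ltnW iS)) (sth i.+1 iS) (thS i iS) (fun t => nst i t iS).
  by exists m.
by exists m.
Qed.

Lemma continuous_rad_clamp (g h : R -> R) : continuous g -> (forall t, 0 < g t) -> continuous h ->
  continuous (fun t => Num.min (rho t) (g (h t))).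
Proof.
move=> cg g0 ch t; apply: continuous_min; first exact: rad_continuous.
by apply: (@continuous_comp _ _ _ h g); [exact: ch|exact: cg].
Qed.

Lemma rad_clamp_itv (h : R -> R) t : 0 < Num.min (rho t) (rho (h t)) <= rho t.
Proof. by rewrite lt_min !rad_gt0 //= ge_min lexx. Qed.

Lemma cut_area a b c d (f g : R -> R) : continuous f -> (forall t, 0 < f t) ->
  continuous g -> (forall t, 0 < g t) -> a <= b -> b <= c -> c <= d -> d <= a + 2 * pi ->
  (forall t, a <= t < b -> f t = g t) -> (forall t, c <= t < d -> f t = g t) ->
  area (psec p a d f) - area (psec p a d g) = area (psec p b c f) - area (psec p b c g).
Proof.
move=> cf f0 cg g0 ab bc cd da fg fg'.
have ac : a <= c := le_trans ab bc.
have cp := le_trans cd da.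
rewrite !(@area_psec_cat R p a c d) ?ac //= !(@area_psec_cat R p a b c) ?ab //=.
rewrite (psec_eq p fg) (psec_eq p fg').
move: (area (psec p a b g)) (area (psec p c d g)) (area (psec p b c f)) (area (psec p b c g)).
by move=> A B C D; ring.
Qed.

(** Truncating [rho] at the level of the higher endpoint [th 1] erases that minimum: before [th 1]
    the profile rises to this level and stays there, after it [rho] rises to the next peak. Two
    windows merge into one. *)
Lemma cut_first S (th : nat -> R) : has_stable_points K p S -> (2 <= S)%N ->
  th S = th 0%N + 2 * pi ->
  (forall i, (i < S)%N -> th i < th i.+1) -> (forall i, (i <= S)%N -> st (th i)) ->
  (forall i t, (i < S)%N -> th i < t < th i.+1 -> ~ st t) ->
  rho (th 0%N) <= rho (th 1%N) ->
  M <= area (psec p (th 0%N) (th 1%N) rho) -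
    area (psec p (th 0%N) (th 1%N) (fun t => Num.min (rho t) (rho (th 1%N)))).
Proof.
move=> hS S2 thS thi sth nst r01.
have [m mP] := peaks_exist thi sth nst.
(* A single continuous formula: before [th 1] the second term is the constant truncation level,
   after it [rho] itself. *)
pose tau t := Num.min (rho t) (rho (Num.max t (th 1%N))).
(* [th 1] is dropped, so the first window runs from [th 0] to [th 2] and has its peak at [m 1]. *)
pose b k := if k is k'.+1 then th k'.+2 else th 0%N.
case: S S2 hS thS thi sth nst mP => [|[|n]] // _ hS thS thi sth nst mP.
have rc := rad_continuous Kb pK; have r0 := rad_gt0 Kb pK.
have ct : continuous tau.
  apply: continuous_rad_clamp => // t; apply: continuous_max; [exact: cvg_id|exact: cvg_cst].
have tau_ge t : th 1%N <= t -> tau t = rho t by move=> h; rewrite /tau (max_idPl h) minxx.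
have tau_lt t : t <= th 1%N -> tau t = Num.min (rho t) (rho (th 1%N)) by move=> h; rewrite /tau (max_idPr h).
have tau0 t : 0 < tau t by have /andP[] := rad_clamp_itv (fun t => Num.max t (th 1%N)) t.
have tau_le t : tau t <= rho t by have /andP[] := rad_clamp_itv (fun t => Num.max t (th 1%N)) t.
have pk1 := mP 1%N isT; have pk0 := mP 0%N isT.
have [/andP[m1 m1'] _ _ _] := pk1; have [/andP[m0 m0'] _ _ _] := pk0.
have th1 k : (0 < k)%N -> (k <= n.+2)%N -> th 1%N <= th k.
  move=> k0 kn; exact: (seq_mono_le thi).
have := @lower_bound_profile n.+2 n.+1 b (fun k => m k.+1) tau hS (ltnSn _) isT.
have bc k : (k < n.+1)%N -> b k < m k.+1 < b k.+1.
  by move=> kn; have [/andP[h1 h2] _ _ _] := mP k.+1 kn; case: k kn h1 h2 => [|k] kn h1 h2 /=; slra.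
move=> /(_ bc thS ct (rad_clamp_itv (fun t => Num.max t (th 1%N)))).
move=> h; have {}h : M <= area K - area (psec p (th 0%N) (th 0%N + 2 * pi) tau).
  apply: h.
  - move=> [|k] x y kn /= bx xy yc.
      have [y1|y1] := leP y (th 1%N).
        rewrite !tau_lt //; last exact: le_trans y1.
        have [ym|ym] := leP y (m 0%N).
          by rewrite le_min2 // (peak_mono pk0).
        rewrite [X in _ <= X](min_idPr _); first by rewrite ge_min lexx orbT.
        by apply: (peak_ge pk0); rewrite ltW.
      rewrite (tau_ge y); last exact: ltW.
      have [x1|x1] := leP x (th 1%N).
        rewrite tau_lt //; apply: (@le_trans _ _ (rho (th 1%N))); first by rewrite ge_min lexx orbT.
        by apply: (peak_ge' pk1); rewrite ltW.
      by rewrite tau_ge ?(ltW x1) // (peak_mono pk1) // ltW.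
    have h1 := th1 k.+2 isT (ltnW kn).
    by rewrite !tau_ge ?(peak_mono (mP k.+2 kn)) //; slra.
  - move=> k x y kn mx xy yb; have [/andP[h1 h2] _ _ _] := mP k.+1 kn.
    have h3 := th1 k.+1 isT (ltnW kn).
    by rewrite !tau_ge ?(peak_anti (mP k.+1 kn)) //; slra.
  - move=> k kn; have [/andP[h1 h2] _ _ _] := mP k.+1 kn.
    have h3 := th1 k.+1 isT (ltnW kn).
    by rewrite tau_ge //; slra.
  - by move=> k kn; exact: (peak_near (mP k.+1 kn)).
apply: le_trans h _; rewrite (area_body (th 0%N)).
have h1 : th 1%N <= th n.+2 by exact: th1.
have h2 : th 0%N <= th 1%N by exact/ltW/thi.
have h3 : th 1%N <= th 0%N + 2 * pi by rewrite -thS.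
have h4 t : th 0%N <= t < th 0%N -> rho t = tau t.
  by move=> /andP[h h']; move: (le_lt_trans h h'); rewrite ltxx.
have h5 t : th 1%N <= t < th 0%N + 2 * pi -> rho t = tau t.
  by move=> /andP[h _]; rewrite tau_ge.
have -> := cut_area rc r0 ct tau0 (lexx _) h2 h3 (lexx _) h4 h5.
have -> // : psec p (th 0%N) (th 1%N) tau = psec p (th 0%N) (th 1%N) (fun t => Num.min (rho t) (rho (th 1%N))).
by apply: psec_eq => t /andP[_ h]; rewrite tau_lt // ltW.
Qed.

(** The mirror image of [cut_first]: the higher minimum [th S.-1] is erased, and the last window
    joins the one before it, whose peak is kept. *)
Lemma cut_last S (th : nat -> R) : has_stable_points K p S -> (2 <= S)%N ->
  th S = th 0%N + 2 * pi ->
  (forall i, (i < S)%N -> th i < th i.+1) -> (forall i, (i <= S)%N -> st (th i)) ->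
  (forall i t, (i < S)%N -> th i < t < th i.+1 -> ~ st t) ->
  rho (th S) <= rho (th S.-1) ->
  M <= area (psec p (th S.-1) (th S) rho) -
    area (psec p (th S.-1) (th S) (fun t => Num.min (rho t) (rho (th S.-1)))).
Proof.
move=> hS S2 thS thi sth nst r01.
have [m mP] := peaks_exist thi sth nst.
case: S S2 hS thS thi sth nst mP r01 => [|[|n]] // _ hS thS thi sth nst mP /= r01.
set q := th n.+1 in r01 *.
pose tau t := Num.min (rho t) (rho (Num.min t q)).
pose b k := if k == n.+1 then th n.+2 else th k.
have rc := rad_continuous Kb pK; have r0 := rad_gt0 Kb pK.
have ct : continuous tau.
  apply: continuous_rad_clamp => // t; apply: continuous_min; [exact: cvg_id|exact: cvg_cst].
have tau_ge t : t <= q -> tau t = rho t by move=> h; rewrite /tau (min_idPl h) minxx.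
have tau_lt t : q <= t -> tau t = Num.min (rho t) (rho q) by move=> h; rewrite /tau (min_idPr h).
have tau0 t : 0 < tau t by have /andP[] := rad_clamp_itv (fun t => Num.min t q) t.
have pk1 := mP n.+1 (ltnSn _); have pk0 := mP n (ltnW (ltnSn _)).
rewrite -/q in pk1 pk0.
have [/andP[m1 m1'] _ _ _] := pk1; have [/andP[m0 m0'] _ _ _] := pk0.
have th1 k : (k <= n.+1)%N -> th k <= q.
  by move=> kn; apply: (seq_mono_le thi).
have bE k : (k <= n)%N -> b k = th k by move=> kn; rewrite /b; case: eqP => // kE; rewrite kE ltnn in kn.
have bS k : (k < n)%N -> b k.+1 = th k.+1 by move=> kn; rewrite bE.
have bl : b n.+1 = th n.+2 by rewrite /b eqxx.
have := @lower_bound_profile n.+2 n.+1 b m tau hS (ltnSn _) isT.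
have bc k : (k < n.+1)%N -> b k < m k < b k.+1.
  move=> kn; have [/andP[h1 h2] _ _ _] := mP k (ltnW kn).
  rewrite bE // h1 /=; move: kn; rewrite ltnS leq_eqVlt => /predU1P[->|kn]; last by rewrite bS.
  by rewrite bl; apply: (lt_trans m0'); exact: thi.
have b00 : b 0%N = th 0%N by rewrite bE.
move=> /(_ bc); rewrite b00 bl => /(_ thS ct (rad_clamp_itv (fun t => Num.min t q))).
move=> h; have {}h : M <= area K - area (psec p (th 0%N) (th 0%N + 2 * pi) tau).
  apply: h.
  - move=> k x y kn; rewrite bE // => bx xy ym; have [/andP[h1 h2] _ _ _] := mP k (ltnW kn).
    have h3 := th1 k.+1 kn.
    by rewrite !tau_ge ?(peak_mono (mP k (ltnW kn))) //; slra.
  - move=> k x y; rewrite ltnS leq_eqVlt => /predU1P[->|kn]; last first.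
      move=> mx xy; rewrite bS // => yb; have [/andP[h1 h2] _ _ _] := mP k (ltn_trans kn (ltnW (ltnSn _))).
      have h3 := th1 k.+1 (ltnW kn).
      by rewrite !tau_ge ?(peak_anti (mP k (ltn_trans kn (ltnW (ltnSn _))))) //; slra.
    rewrite bl => mx xy yb.
    have [x1|x1] := leP q x.
      rewrite !tau_lt //; last exact: le_trans xy.
      have [ym|ym] := leP (m n.+1) x.
        by rewrite le_min2 // (peak_anti pk1).
      rewrite [X in _ <= X](min_idPr _); first by rewrite ge_min lexx orbT.
      by apply: (peak_ge' pk1); rewrite x1 ltW.
    rewrite (tau_ge x); last exact: ltW.
    have [y1|y1] := leP q y.
      rewrite tau_lt //; apply: (@le_trans _ _ (rho q)); first by rewrite ge_min lexx orbT.
      by apply: (peak_ge pk0); rewrite mx ltW.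
    by rewrite tau_ge ?(ltW y1) // (peak_anti pk0) // ltW.
  - move=> k kn; have [/andP[h1 h2] _ _ _] := mP k (ltnW kn).
    have h3 := th1 k.+1 kn.
    by rewrite tau_ge //; slra.
  - by move=> k kn; exact: (peak_near (mP k (ltnW kn))).
apply: le_trans h _; rewrite (area_body (th 0%N)) -thS.
have h2 : th 0%N <= q by exact: th1.
have h3 : q <= th n.+2 by exact/ltW/thi.
have h6 : th n.+2 <= th 0%N + 2 * pi by rewrite thS.
have h4 t : th 0%N <= t < q -> rho t = tau t.
  by move=> /andP[_ h]; rewrite tau_ge // ltW.
have h5 t : th n.+2 <= t < th n.+2 -> rho t = tau t.
  by move=> /andP[h h']; move: (le_lt_trans h h'); rewrite ltxx.
have -> := cut_area rc r0 ct tau0 h2 h3 (lexx _) h6 h4 h5.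
have -> // : psec p q (th n.+2) tau = psec p q (th n.+2) (fun t => Num.min (rho t) (rho q)).
by apply: psec_eq => t /andP[h _]; rewrite tau_lt.
Qed.

Lemma stang_2pi t : st (t + 2 * pi) <-> st t.
Proof. by rewrite /stang bpt_2pi. Qed.

(** The lower of the two stable angles has to be an end of the enumeration, so that the higher one
    is inside and can be erased: the enumeration starts at [a] if [rho a] is the smaller value, at
    [b - 2 * pi] otherwise. *)
Lemma cut_bound S a b : has_stable_points K p S -> (2 <= S)%N ->
  st a -> st b -> a < b -> (forall t, a < t < b -> ~ st t) ->
  M <= area (psec p a b rho) -
    area (psec p a b (fun t => Num.min (rho t) (Num.max (rho a) (rho b)))).
Proof.
move=> hS S2 sa sb ab nst; have [rab|rab] := leP (rho a) (rho b).
  have [th [th0 thS thi sth nth]] := stable_window Kb pK hS (ltnW S2) sa.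
  have t1 : th 1%N = b.
    apply/le_anti/andP; split; rewrite leNgt; apply/negP => h.
      by apply: (nth 0%N b); rewrite ?(ltnW S2) // th0 ab.
    apply: (nst (th 1%N)); last by apply: sth; exact: ltnW.
    by rewrite h -th0 thi // ltnW.
  have thS' : th S = th 0%N + 2 * pi by rewrite thS th0.
  by have := cut_first hS S2 thS' thi sth nth; rewrite th0 t1; apply.
have sb' : st (b - 2 * pi).
  by apply: (stang_2pi (b - 2 * pi)).1; rewrite (subrK (2 * pi) b).
have [th [th0 thS thi sth nth]] := stable_window Kb pK hS (ltnW S2) sb'.
rewrite subrK in thS; have S1 : (S.-1 < S)%N by rewrite prednK // ltnW.
have SE : S.-1.+1 = S by rewrite prednK // ltnW.
have t1 : th S.-1 = a.
  apply/le_anti/andP; split; rewrite leNgt; apply/negP => h.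
    apply: (nst (th S.-1)); last by apply: sth; exact: ltnW.
    by rewrite h -thS -[in X in _ < X]SE thi.
  by apply: (nth S.-1 a S1) => //; rewrite h SE thS.
have thS' : th S = th 0%N + 2 * pi by rewrite thS th0 subrK.
by have := cut_last hS S2 thS' thi sth nth; rewrite thS t1; apply; exact: ltW.
Qed.

End Cut.

(** * The sector inequality *)

Section GainFunction.
Variable R : realType.
Implicit Types (x y t : R).

Lemma is_derive_sub_mulcos x : is_derive x (1 : R) (fun x => sin x - x * cos x) (x * sin x).
Proof.
have h := is_deriveB (is_derive_sin x) (is_deriveM (@is_derive_id R R x 1) (is_derive_cos x)).
by apply: (@is_derive_eq _ _ _ _ _ _ _ _ h); rewrite /GRing.scale /=; ring.
Qed.

Lemma sub_mulcos_gt0 x : 0 < x < pi -> 0 < sin x - x * cos x.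
Proof.
move=> /andP[x0 xp].
have := @derive_lt R (fun x => sin x - x * cos x) (fun x => x * sin x) 0 x.
rewrite /= sin0 mul0r subr0; apply => // [y _|y /andP[y0 yx]]; first exact: is_derive_sub_mulcos.
by rewrite mulr_gt0 // sin_gt0_pi //; slra.
Qed.

(** For [x < pi / 2] this is [tan x / (tan x - x)]: the area of a kite circumscribed to a circle,
    with half angle [x] at the centre, over the area of its part beyond the circle. The present form
    remains smooth on (0, pi). *)
Definition gain x := sin x / (sin x - x * cos x).
Definition gain1 x := (cos x * sin x - x) / (sin x - x * cos x) ^+ 2.

Lemma is_derive_gain x : 0 < x < pi -> is_derive x (1 : R) gain (gain1 x).
Proof.
move=> x0; have D0 := sub_mulcos_gt0 x0; have Dn : sin x - x * cos x != 0 by rewrite gt_eqF.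
have h := is_deriveM (is_derive_sin x) (@is_deriveV R (fun x => sin x - x * cos x) x _ 1 Dn (is_derive_sub_mulcos x)).
apply: (@is_derive_eq _ _ _ _ _ _ _ _ h); rewrite /GRing.scale /= /gain1.
have cs := cos2Dsin2 x.
transitivity ((cos x * sin x - x * (cos x ^+ 2 + sin x ^+ 2)) / (sin x - x * cos x) ^+ 2); first by field.
by rewrite cs mulr1.
Qed.

Lemma is_derive_gain1 x : 0 < x < pi ->
  is_derive x (1 : R) gain1 (2 * sin x * (x ^+ 2 - sin x ^+ 2) / (sin x - x * cos x) ^+ 3).
Proof.
move=> x0; have D0 := sub_mulcos_gt0 x0; have Dn : sin x - x * cos x != 0 by rewrite gt_eqF.
have D2 : (sin x - x * cos x) ^+ 2 != 0 by rewrite expf_neq0.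
have hn := is_deriveB (is_deriveM (is_derive_cos x) (is_derive_sin x)) (@is_derive_id R R x 1).
have hd := is_deriveX 2 (is_derive_sub_mulcos x).
have h := is_deriveM hn (@is_deriveV R ((fun x => sin x - x * cos x) ^+ 2) x _ 1 D2 hd).
apply: (@is_derive_eq _ _ _ _ _ _ _ _ h); rewrite /GRing.scale /=.
have cs : sin x ^+ 2 = 1 - cos x ^+ 2 by rewrite -(cos2Dsin2 x); ring.
rewrite !fctE /=.
transitivity ((((cos x ^+ 2 - sin x ^+ 2 - 1) * (sin x - x * cos x)) - 2 * (cos x * sin x - x) * (x * sin x)) / (sin x - x * cos x) ^+ 3).
  by field.
congr (_ / _).
transitivity ((cos x ^+ 2 - 1 - sin x ^+ 2) * (sin x - x * cos x) - 2 * x * cos x * sin x ^+ 2 + 2 * x ^+ 2 * sin x); first by ring.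
rewrite [X in (_ - 1 - X)]cs (_ : cos x ^+ 2 - 1 - (1 - cos x ^+ 2) = - 2 * (1 - cos x ^+ 2)); last by ring.
by rewrite -cs; ring.
Qed.

Lemma gain1_lt x y : 0 < x -> x < y -> y < pi -> gain1 x < gain1 y.
Proof.
move=> x0 xy yp.
apply: (derive_lt (df := fun x => 2 * sin x * (x ^+ 2 - sin x ^+ 2) / (sin x - x * cos x) ^+ 3)) => //.
  by move=> t txy; apply: is_derive_gain1; slra.
move=> t /andP[tx ty]; have t0 : 0 < t by slra.
have D0 : 0 < sin t - t * cos t by apply: sub_mulcos_gt0; slra.
have s0 : 0 < sin t by apply: sin_gt0_pi; slra.
have st := sin_lt_id t0.
rewrite divr_gt0 ?exprn_gt0 // mulr_gt0 ?mulr_gt0 // subr_gt0 ltr_sqr ?nnegrE //; exact: ltW.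
Qed.

Lemma gain_tangent x y : 0 < x < pi -> 0 < y < pi -> x != y ->
  gain y + gain1 y * (x - y) < gain x.
Proof.
move=> /andP[x0 xp] /andP[y0 yp] xy.
pose f t := gain t - gain1 y * t.
have df t : 0 < t < pi -> is_derive t (1 : R) f (gain1 t - gain1 y).
  move=> t0; have h := is_deriveB (is_derive_gain t0) (is_deriveZ (gain1 y) (@is_derive_id R R t 1)).
  by apply: (@is_derive_eq _ _ _ _ _ _ _ _ h); rewrite /GRing.scale /= mulr1.
suff : f y < f x by rewrite /f; slra.
have [yx|xy'] := ltP y x.
  apply: (derive_lt (df := fun t => gain1 t - gain1 y)) => // t tt; first by apply: df; slra.
  by rewrite subr_gt0 gain1_lt //; slra.
have {xy'} xy : x < y by rewrite lt_neqAle xy.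
rewrite -ltrN2; apply: (derive_lt (f := fun t => - f t) (df := fun t => gain1 y - gain1 t)) => // t tt.
  rewrite -opprB; apply: is_deriveN; apply: df; slra.
by rewrite subr_gt0 gain1_lt //; slra.
Qed.

(** The sum of the tangent-line inequalities at the mean [pi / n], whose linear parts cancel;
    equality in the sum forces equality in each term. *)
Lemma gain_jensen n (x : 'I_n -> R) : (2 <= n)%N -> (forall i, 0 < x i < pi) ->
  \sum_i x i = pi ->
  n%:R * gain (pi / n%:R) <= \sum_i gain (x i) /\
  (\sum_i gain (x i) = n%:R * gain (pi / n%:R) -> forall i, x i = pi / n%:R).
Proof.
move=> n2 xi sx; have pi0 := @pi_gt0 R.
have n0 : 0 < n%:R :> R by rewrite ltr0n ltnW.
set y := pi / n%:R.
have yI : 0 < y < pi by rewrite divr_gt0 //= ltr_pdivrMr // ltr_pMr // ltr1n.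
have tan_le i : gain y + gain1 y * (x i - y) <= gain (x i).
  have [->|/gain_tangent h] := eqVneq (x i) y; last exact/ltW/h.
  by rewrite subrr mulr0 addr0.
have E : \sum_i (gain y + gain1 y * (x i - y)) = n%:R * gain y.
  have -> : \sum_i (gain y + gain1 y * (x i - y)) =
      \sum_(i < n) gain y + gain1 y * (\sum_i x i - \sum_(i < n) y).
    by rewrite -sumrB mulr_sumr -big_split.
  rewrite sx !sumr_const card_ord -(mulr_natl (gain y)) -(mulr_natl y) /y.
  by rewrite [n%:R * (pi / _)]mulrC divfK ?gt_eqF // subrr mulr0 addr0.
split; first by rewrite -E; apply: ler_sum.
move=> e i; apply/eqP; apply: contraT => xy.
have := gain_tangent (xi i) yI xy.
have : \sum_j (gain (x j) - (gain y + gain1 y * (x j - y))) = 0 by rewrite sumrB E e subrr.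
move=> /eqP; rewrite psumr_eq0; last by move=> j _; rewrite subr_ge0.
by move=> /allP /(_ i (mem_index_enum _)) /= /eqP; slra.
Qed.

(** [tan t / t] increases on (0, pi / 2), because [sin t * cos t < t]. *)
Lemma tan_ratio_le b x : 0 < b -> b <= x -> x < pi / 2 -> tan b <= b * (tan x / x).
Proof.
move=> b0; rewrite le_eqVlt => /predU1P[<- _|bx xp].
  by rewrite mulrC divfK // gt_eqF.
have x0 : 0 < x by slra.
rewrite -ler_pdivrMl // mulrC; apply: ltW.
have ct (t : R) : 0 < t < pi / 2 -> 0 < cos t by move=> h; apply: cos_gt0; slra.
apply: (derive_lt (f := fun t => tan t / t) (df := fun t => (t - sin t * cos t) / (cos t * t) ^+ 2)) => // t tt.
  have t0 : t != 0 by rewrite gt_eqF //; slra.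
  have c0 : cos t != 0 by rewrite gt_eqF // ct //; slra.
  have h := is_deriveM (is_derive_tan c0) (is_deriveV t0 (@is_derive_id R R t 1)).
  apply: (@is_derive_eq _ _ _ _ _ _ _ _ h); rewrite /GRing.scale /= /tan.
  by field; rewrite c0 t0.
have t0 : 0 < t by slra.
have c0 : 0 < cos t by apply: ct; slra.
rewrite divr_gt0 ?exprn_gt0 ?mulr_gt0 // subr_gt0; apply: le_lt_trans (sin_lt_id t0).
have pi0 := @pi_gt0 R; by rewrite ler_piMr ?cos_le1 // sin_ge0_pi //; slra.
Qed.

End GainFunction.

Section StrictArea.
Variable R : realType.
Implicit Types (f g : R -> R) (a b t : R).

(** By continuity the strict inequality persists near [t0], where two constants [s < s'] separate
    [f] from [g]; the circular sectors with these radii have different areas. *)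
Lemma area_psec_lt p a b t0 f g : continuous f -> (forall t, 0 < f t) ->
  continuous g -> (forall t, 0 < g t) -> a < b -> b <= a + 2 * pi ->
  (forall t, a <= t < b -> f t <= g t) -> a <= t0 <= b -> f t0 < g t0 ->
  area (psec p a b f) < area (psec p a b g).
Proof.
move=> cf f0 cg g0 ab ba fg t0ab fg0.
set s := (2 * f t0 + g t0) / 3; set s' := (f t0 + 2 * g t0) / 3.
have fs : f t0 < s by rewrite /s; slra.
have ss : s < s' by rewrite /s /s'; slra.
have sg : s' < g t0 by rewrite /s'; slra.
have [e1 e10 e1P] : exists2 e, 0 < e & forall u, `|u - t0| < e -> f u < s.
  by apply/nbhs_ball_real; move/cvgr_lt: (cf t0) => /(_ _ fs).
have [e2 e20 e2P] : exists2 e, 0 < e & forall u, `|u - t0| < e -> s' < g u.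
  by apply/nbhs_ball_real; move/cvgr_gt: (cg t0) => /(_ _ sg).
pose e := Num.min e1 e2.
have e0 : 0 < e by rewrite lt_min e10.
have eP u : `|u - t0| < e -> f u < s /\ s' < g u.
  by rewrite lt_min => /andP[h1 h2]; split; [exact: e1P|exact: e2P].
have [c [d [ac cd db cdP]]] : exists c d, [/\ a <= c, c < d, d <= b & forall u, c <= u < d -> `|u - t0| < e].
  exists (Num.max a (t0 - e / 2)), (Num.min b (t0 + e / 2)); split.
  - by rewrite le_max lexx.
  - by rewrite lt_min !gt_max; apply/andP; split; apply/andP; split; slra.
  - by rewrite ge_min lexx.
  - move=> u; rewrite ge_max lt_min => /andP[/andP[h1 h2] /andP[h3 h4]]; rewrite ltr_norml; slra.
have s0 : 0 < s by apply: lt_trans fs.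
have s'0 : 0 < s' by slra.
have cdp : c <= d <= c + 2 * pi by slra.
clearbody s s'; move: cdP {e1P e2P} eP => cdP eP.
have k1 : area (psec p c d f) <= area (psec p c d (cst s)).
  by apply: area_psec_le => // [|t /cdP/eP[/ltW]//]; exact: cst_cont.
have k2 : area (psec p c d (cst s')) <= area (psec p c d g).
  by apply: area_psec_le => // [|t /cdP/eP[_ /ltW]//]; exact: cst_cont.
clear eP cdP e e0 e1 e2 e10 e20 fs sg fg0.
rewrite (area_sector p s0 cdp) in k1; rewrite (area_sector p s'0 cdp) in k2.
have k3 : s ^+ 2 * (d - c) / 2 < s' ^+ 2 * (d - c) / 2.
  by rewrite ltr_pM2r ?invr_gt0 // ltr_pM2r ?subr_gt0 // ltr_sqr ?nnegrE // ltW.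
have h1 : a <= c <= b by rewrite ac (le_trans (ltW cd)).
have h2 : c <= d <= b by rewrite db ltW.
have h3 : b <= c + 2 * pi by apply: (le_trans ba); rewrite lerD2r.
rewrite (area_psec_cat p cf f0 h1 ba) (area_psec_cat p cf f0 h2 h3).
rewrite (area_psec_cat p cg g0 h1 ba) (area_psec_cat p cg g0 h2 h3).
have k4 : area (psec p a c f) <= area (psec p a c g).
  apply: area_psec_le => // t /andP[ta tc]; apply: fg; rewrite ta (lt_le_trans tc) //.
  by case/andP: h1.
have k5 : area (psec p d b f) <= area (psec p d b g).
  apply: area_psec_le => // t /andP[td tb]; apply: fg; rewrite tb andbT.
  by rewrite (le_trans ac) // (le_trans (ltW cd)).
move: k1 k2 k3 k4 k5; move: (area _) (area _) (area _) (area _) (area _) (area _).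
move: (_ / 2) (_ / 2) => A B C D E F G H; slra.
Qed.

End StrictArea.

Section SectorNumbers.
Variable R : realType.
Implicit Types (x psi k r X Y : R).

Lemma sum4_eq0 (a b c d : R) : 0 <= a -> 0 <= b -> 0 <= c -> 0 <= d ->
  0 = a + b + c + d -> [/\ b = 0, c = 0 & d = 0].
Proof. by move=> *; split; slra. Qed.

(* With mu = tan x / x and in units of r^2 / 2, the first case amounts to
   mu * inner - (X + Y) >= (1 - k^2) tan x (1 - psi / x) + k^2 (tan psi - psi). *)
Lemma sector_numbers x psi k r X Y : 0 < x < pi / 2 -> 0 <= psi < 2 * x -> 0 < k <= 1 -> 0 < r ->
  (k * r) ^+ 2 * psi / 2 <= X ->
  (psi <= x -> Y <= (k * r) ^+ 2 * (tan x - tan psi) / 2 + r ^+ 2 * tan x / 2) ->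
  (x <= psi -> Y <= r ^+ 2 * tan (2 * x - psi) / 2) ->
  X + Y <= tan x / x * (X + r ^+ 2 * (2 * x - psi) / 2) /\
  (X + Y = tan x / x * (X + r ^+ 2 * (2 * x - psi) / 2) ->
    [/\ psi = 0, k = 1 & Y = r ^+ 2 * tan x]).
Proof.
move=> /andP[x0 xp] /andP[p0 px].
have b0 : 0 < 2 * x - psi by slra.
have bx : x < psi -> 2 * x - psi <= x by move=> h; slra.
move=> /andP[k0 k1] r0 hX hY1 hY2.
have tx : x < tan x by apply: tan_gt_id; rewrite x0.
set mu := tan x / x; have mux : mu * x = tan x by rewrite /mu divfK // gt_eqF.
have mu1 : 1 < mu by rewrite /mu ltr_pdivlMr // mul1r.
have r2 : 0 < r ^+ 2 by rewrite exprn_gt0.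
have k2 : 0 < k ^+ 2 by rewrite exprn_gt0.
have k21 : k ^+ 2 <= 1 by rewrite expr_le1 // ltW.
rewrite exprMn in hX hY1.
have hX' : (mu - 1) * (k ^+ 2 * r ^+ 2 * psi / 2) <= (mu - 1) * X.
  by rewrite ler_wpM2l // subr_ge0 ltW.
(* If [psi] exceeds [x], the remaining angle [2 * x - psi] is at most [x], and [tan_ratio_le] bounds
   [Y] by [mu] times the circular sector over it; the positive term [(mu - 1) * X] makes the
   inequality strict. *)
have [psx|psx] := leP psi x; last first.
  have hY := hY2 (ltW psx).
  have hb := tan_ratio_le b0 (bx psx) xp; rewrite -/mu in hb.
  have hb' : r ^+ 2 * tan (2 * x - psi) <= r ^+ 2 * ((2 * x - psi) * mu) by rewrite ler_pM2l.
  have s0 : 0 < (mu - 1) * (k ^+ 2 * r ^+ 2 * psi / 2).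
    by rewrite mulr_gt0 ?subr_gt0 // divr_gt0 // !mulr_gt0 // (lt_trans x0).
  have E : mu * (X + r ^+ 2 * (2 * x - psi) / 2) - (X + Y) =
     (mu - 1) * X + r ^+ 2 * ((2 * x - psi) * mu) / 2 - Y by ring.
  have st : 0 < mu * (X + r ^+ 2 * (2 * x - psi) / 2) - (X + Y).
    rewrite E; move: hb' hX' s0 hY.
    move: (r ^+ 2 * ((2 * x - psi) * mu)) (r ^+ 2 * tan (2 * x - psi)) ((mu - 1) * X) => A B C.
    by move: ((mu - 1) * _) => D *; slra.
  by split; [slra|move=> e; move: st; rewrite e subrr ltxx].
have hY := hY1 psx.
have tp : psi <= tan psi.
  move: p0; rewrite le_eqVlt => /predU1P[<-|p0]; first by rewrite tan0.
  by apply/ltW/tan_gt_id; slra.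
set s1 := r ^+ 2 / 2 * ((1 - k ^+ 2) * (mu * (x - psi))).
set s2 := r ^+ 2 / 2 * (k ^+ 2 * (tan psi - psi)).
have r22 : 0 <= r ^+ 2 / 2 by rewrite divr_ge0 // ltW.
have mu0 : 0 <= mu by apply: ltW; exact: lt_trans mu1.
have s10 : 0 <= s1 by apply: mulr_ge0 => //; apply: mulr_ge0; rewrite ?subr_ge0 // mulr_ge0 ?subr_ge0.
have s20 : 0 <= s2 by apply: mulr_ge0 => //; apply: mulr_ge0; rewrite ?subr_ge0 // ltW.
set d1 := (mu - 1) * X - (mu - 1) * (k ^+ 2 * r ^+ 2 * psi / 2).
set d2 := k ^+ 2 * r ^+ 2 * (tan x - tan psi) / 2 + r ^+ 2 * tan x / 2 - Y.
have d10 : 0 <= d1 by rewrite subr_ge0.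
have d20 : 0 <= d2 by rewrite subr_ge0.
have E : mu * (X + r ^+ 2 * (2 * x - psi) / 2) - (X + Y) = d1 + d2 + s1 + s2.
  by rewrite /d1 /d2 /s1 /s2 -mux; field.
split; first by rewrite -subr_ge0 E (addr_ge0 (addr_ge0 (addr_ge0 d10 d20) s10) s20).
move=> e; rewrite e subrr in E.
have [d2z s1z s2z] := sum4_eq0 d10 d20 s10 s20 E.
have pz : psi = 0.
  apply: contraTeq isT => pn; have : psi < tan psi.
    by apply: tan_gt_id; rewrite lt_neqAle eq_sym pn p0 /= (le_lt_trans psx).
  move=> h; have : 0 < s2 by rewrite /s2 !mulr_gt0 ?invr_gt0 // subr_gt0.
  by rewrite s2z ltxx.
have kz : k = 1.
  apply: contraTeq isT => kn; have k1' : k < 1 by rewrite lt_neqAle kn.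
  have : 0 < s1; last by rewrite s1z ltxx.
  rewrite /s1 pz subr0 mux; apply: mulr_gt0; first by rewrite divr_gt0.
  apply: mulr_gt0; last exact: lt_trans tx.
  by rewrite subr_gt0 expr_lt1 // ltW.
split => //; move: d2z; rewrite /d2 pz kz tan0 => d2z.
by move/eqP: d2z; rewrite subr_eq0 => /eqP <-; rewrite expr1n; field.
Qed.

Lemma sum_tight (A B C : R) : B <= C / 2 -> A <= C / 2 -> C = B + A -> B = C / 2.
Proof. slra. Qed.

End SectorNumbers.

Section Sector.
Variable R : realType.
Variables (K : set (R * R)) (p : R * R).
Hypotheses (Kb : convex_body K) (pK : K° p).
Local Notation rho := (rad K p).
Local Notation bp := (bpt K p).
Local Notation st := (stang K p).

Lemma sector_triangle t0 r a b : 0 < r -> t0 - pi / 2 < a -> a < b -> b < t0 + pi / 2 ->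
  b <= a + 2 * pi ->
  (forall t, a <= t <= b -> rho t * cos (t - t0) <= r) ->
  area (psec p a b rho) <= r ^+ 2 * (tan (b - t0) - tan (a - t0)) / 2 /\
  (forall t, a <= t <= b -> area (psec p a b rho) = r ^+ 2 * (tan (b - t0) - tan (a - t0)) / 2 ->
    rho t * cos (t - t0) = r).
Proof.
move=> r0 ta ab bt ba h; have [f [cf f0 fE fA]] := area_triangle p r0 ta (ltW ab) bt.
have rc := rad_continuous Kb pK; have rg := rad_gt0 Kb pK.
have c0 t : a <= t <= b -> 0 < cos (t - t0) by move=> tt; apply: cos_gt0; slra.
have fr t : a <= t < b -> rho t <= f t.
  move=> /andP[at_ tb]; have tt : a <= t <= b by rewrite at_ ltW.
  by rewrite fE // ler_pdivlMr ?h ?c0.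
rewrite -fA; split; first exact: area_psec_le.
move=> t tt e; apply/eqP; rewrite eq_le h //= leNgt; apply/negP => lt.
have := @area_psec_lt R p a b t rho f rc rg cf f0 ab ba fr tt.
rewrite fE // ltr_pdivlMr ?c0 // lt => /(_ isT).
by rewrite e ltxx.
Qed.

Lemma equilibrium_cos t u : equilibrium K p (bp t) -> - (pi / 2) < u - t < pi / 2 ->
  rho u * cos (u - t) <= rho t.
Proof. by move=> eq h; apply: equilibrium_rad_le => //; exact: cos_gt0. Qed.

Lemma equilibrium_triangle t0 a b : equilibrium K p (bp t0) ->
  t0 - pi / 2 < a -> a < b -> b < t0 + pi / 2 ->
  area (psec p a b rho) <= rho t0 ^+ 2 * (tan (b - t0) - tan (a - t0)) / 2 /\
  (forall t, a <= t <= b -> area (psec p a b rho) = rho t0 ^+ 2 * (tan (b - t0) - tan (a - t0)) / 2 ->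
    rho t * cos (t - t0) = rho t0).
Proof.
move=> eq ta ab bt; have pi0 := @pi_gt0 R.
apply: sector_triangle => //; [exact: rad_gt0|slra|move=> t tt].
by apply: equilibrium_cos => //; slra.
Qed.

Lemma area_psec_empty a f : area (psec p a a f) = 0.
Proof.
rewrite (_ : psec p a a f = set0) ?/area ?/plane_measure ?measure0 //.
by apply/seteqP; split => // z [t [s [/andP[t0 t1] _ _]]]; move: (le_lt_trans t0 t1); rewrite ltxx.
Qed.

(* [a] is the first angle at which the radius reaches its larger endpoint value. *)
Lemma sector_up_core u v a r : equilibrium K p (bp u) -> equilibrium K p (bp v) ->
  v - u < pi -> rho v = r -> u <= a -> a < v ->
  (forall t, u <= t -> t <= a -> rho u <= rho t <= r) ->
  (forall t, a <= t -> t <= v -> r <= rho t) -> let x := (v - u) / 2 in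
  area (psec p u v rho) <= tan x / x * area (psec p u v (fun t => Num.min (rho t) r)) /\
  (area (psec p u v rho) = tan x / x * area (psec p u v (fun t => Num.min (rho t) r)) ->
   rho u = r /\ rho (u + x) * cos x = rho u).
Proof.
move=> equ eqv vup rv ua av low high x.
have rc := rad_continuous Kb pK; have rg := rad_gt0 Kb pK; have pi0 := @pi_gt0 R.
have r0 : 0 < r by rewrite -rv.
have x0 : 0 < x < pi / 2 by rewrite /x; slra.
have psi0 : 0 <= a - u < 2 * x by rewrite /x; slra.
have au : u <= a <= u + 2 * pi by slra.
have uav : u <= a <= v by rewrite ua ltW.
have vu : v <= u + 2 * pi by slra.
have va : a <= v <= a + 2 * pi by slra.
have va2 : v <= a + 2 * pi by slra.
have uxa : v - (u + x) = x by rewrite /x; field.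
have xv : u + x < v by rewrite /x; slra.
have ux : u < u + x by rewrite ltrDl; case/andP: x0.
have uE : u + x - u = x by ring.
have vaE : 2 * x - (a - u) = v - a by rewrite /x; field.
have u1 : u - pi / 2 < u by slra.
have u2 : u + x < u + pi / 2 by rewrite /x; slra.
have v1 : v - pi / 2 < u + x by rewrite /x; slra.
have v2 : v < v + pi / 2 by slra.
have ruv : rho u <= r by have /andP[] := low u (lexx _) ua.
clearbody x.
have low' t : u <= t < a -> rho u <= rho t.
  by move=> /andP[ut ta]; have /andP[] := low t ut (ltW ta).
have low2 t : u <= t < a -> Num.min (rho t) r = rho t.
  by move=> /andP[ut ta]; apply/min_idPl; have /andP[] := low t ut (ltW ta).
have high' t : a <= t < v -> Num.min (rho t) r = r.
  by move=> /andP[ut ta]; apply/min_idPr; apply: high => //; exact: ltW.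
have cg : continuous (fun t => Num.min (rho t) r).
  by move=> t; apply: continuous_min; [exact: rc|exact: cvg_cst].
have g0 t : 0 < Num.min (rho t) r by rewrite lt_min rg.
have gA : area (psec p u v (fun t => Num.min (rho t) r)) = area (psec p u a rho) + r ^+ 2 * (v - a) / 2.
  have -> := area_psec_cat p cg g0 uav vu.
  by rewrite (psec_eq p low2) (psec_eq p high') -(area_sector p r0 va).
have rA := area_psec_cat p rc rg uav vu.
have krE : rho u / r * r = rho u by rewrite divfK // gt_eqF.
have k01 : 0 < rho u / r <= 1 by rewrite divr_gt0 //= ler_pdivrMr // mul1r.
have hX : (rho u / r * r) ^+ 2 * (a - u) / 2 <= area (psec p u a rho).
  rewrite krE -(area_sector p (rg u) au).
  by apply: area_psec_le => //; [exact: cst_cont|by move=> t; exact: rg].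
have tv c : u + x <= c -> c < v -> area (psec p c v rho) <= r ^+ 2 * tan (v - c) / 2.
  move=> uc cv; have [+ _] := equilibrium_triangle eqv (lt_le_trans v1 uc) cv v2.
  by rewrite subrr tan0 sub0r -tanN opprB rv.
(* If [a] comes before the bisector [u + x], the line at [u] bounds the piece up to the bisector and
   the line at [v] the rest; otherwise the line at [v] bounds the whole piece. *)
have hY1 : a - u <= x -> area (psec p a v rho) <=
    (rho u / r * r) ^+ 2 * (tan x - tan (a - u)) / 2 + r ^+ 2 * tan x / 2.
  rewrite lerBlDl krE => axv'.
  have axv : a <= u + x <= v by rewrite axv' ltW.
  have -> := area_psec_cat p rc rg axv va2.
  have := tv (u + x) (lexx _) xv; rewrite uxa => h2.
  apply: lerD => //; move: axv'; rewrite le_eqVlt => /predU1P[->|ax].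
    by rewrite area_psec_empty uE subrr mulr0 mul0r.
  by have [+ _] := equilibrium_triangle equ (lt_le_trans u1 ua) ax u2; rewrite uE.
have hY2 : x <= a - u -> area (psec p a v rho) <= r ^+ 2 * tan (2 * x - (a - u)) / 2.
  by rewrite lerBrDl => px; have := tv a px av; rewrite vaE.
(* Here [psi] is the angle [a - u] over which [rho] is at most [r], [k] is the ratio of the two
   stable radii, and [X] and [Y] are the areas over [[u, a]] and [[a, v]]. *)
have [h1 h2] := sector_numbers x0 psi0 k01 r0 hX hY1 hY2.
rewrite vaE -gA -rA in h1 h2; split => // e; have [pz kz Yz] := h2 e.
have ruE : rho u = r by rewrite -krE kz mul1r.
(* Now [a = u], and the two triangles cut out by the bisector have their total area attained; so
   each of them is attained, and the boundary point on the bisector lies on the line at [u]. *)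
split => //; have aE : a = u by apply/eqP; rewrite -subr_eq0 pz.
have [T1 T2] := equilibrium_triangle equ u1 ux u2.
have T3 := tv (u + x) (lexx _) xv; rewrite uxa in T3.
rewrite uE subrr tan0 subr0 ruE in T1 T2.
have := T2 (u + x); rewrite uE ruE; apply; first by rewrite lexx ltW.
have axv : u <= u + x <= v by rewrite !ltW.
have := area_psec_cat p rc rg axv vu; rewrite aE in Yz; rewrite Yz.
exact: sum_tight T1 T3.
Qed.

(** The mirror image of [sector_up_core], with the larger stable radius at [u] and the roles of
    [[u, a]] and [[a, v]] exchanged. *)
Lemma sector_down_core u v a r : equilibrium K p (bp u) -> equilibrium K p (bp v) ->
  v - u < pi -> rho u = r -> u < a -> a <= v ->
  (forall t, a <= t -> t <= v -> rho v <= rho t <= r) ->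
  (forall t, u <= t -> t <= a -> r <= rho t) -> let x := (v - u) / 2 in
  area (psec p u v rho) <= tan x / x * area (psec p u v (fun t => Num.min (rho t) r)) /\
  (area (psec p u v rho) = tan x / x * area (psec p u v (fun t => Num.min (rho t) r)) ->
   rho v = r /\ rho (u + x) * cos x = rho u).
Proof.
move=> equ eqv vup ru ua av low high x.
have rc := rad_continuous Kb pK; have rg := rad_gt0 Kb pK; have pi0 := @pi_gt0 R.
have r0 : 0 < r by rewrite -ru.
have x0 : 0 < x < pi / 2 by rewrite /x; slra.
have psi0 : 0 <= v - a < 2 * x by rewrite /x; slra.
have au : u <= a <= u + 2 * pi by slra.
have uav : u <= a <= v by rewrite av ltW.
have vu : v <= u + 2 * pi by slra.
have va : a <= v <= a + 2 * pi by slra.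
have au2 : a <= u + 2 * pi by slra.
have uxa : u + x - v = - x by rewrite /x; field.
have xv : u + x < v by rewrite /x; slra.
have ux : u < u + x by rewrite ltrDl; case/andP: x0.
have uE : u + x - u = x by ring.
have vaE : 2 * x - (v - a) = a - u by rewrite /x; field.
have u1 : u - pi / 2 < u by slra.
have u2 : u + x < u + pi / 2 by rewrite /x; slra.
have v1 : v - pi / 2 < u + x by rewrite /x; slra.
have v2 : v < v + pi / 2 by slra.
have px1 : v - a <= x -> u + x <= a by rewrite /x; slra.
have px2 : x <= v - a -> a <= u + x by rewrite /x; slra.
have ruv : rho v <= r by have /andP[] := low v av (lexx _).
clearbody x.
have low' t : a <= t < v -> rho v <= rho t.
  by move=> /andP[ut ta]; have /andP[] := low t ut (ltW ta).
have low2 t : a <= t < v -> Num.min (rho t) r = rho t.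
  by move=> /andP[ut ta]; apply/min_idPl; have /andP[] := low t ut (ltW ta).
have high' t : u <= t < a -> Num.min (rho t) r = r.
  by move=> /andP[ut ta]; apply/min_idPr; apply: high => //; exact: ltW.
have cg : continuous (fun t => Num.min (rho t) r).
  by move=> t; apply: continuous_min; [exact: rc|exact: cvg_cst].
have g0 t : 0 < Num.min (rho t) r by rewrite lt_min rg.
have gA : area (psec p u v (fun t => Num.min (rho t) r)) = area (psec p a v rho) + r ^+ 2 * (a - u) / 2.
  have -> := area_psec_cat p cg g0 uav vu.
  by rewrite (psec_eq p low2) (psec_eq p high') -(area_sector p r0 au) addrC.
have rA := area_psec_cat p rc rg uav vu; rewrite addrC in rA.
have krE : rho v / r * r = rho v by rewrite divfK // gt_eqF.
have k01 : 0 < rho v / r <= 1 by rewrite divr_gt0 //= ler_pdivrMr // mul1r.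
have hX : (rho v / r * r) ^+ 2 * (v - a) / 2 <= area (psec p a v rho).
  rewrite krE -(area_sector p (rg v) va).
  by apply: area_psec_le => //; [exact: cst_cont|by move=> t; exact: rg].
have tu c : c <= u + x -> u < c -> area (psec p u c rho) <= r ^+ 2 * tan (c - u) / 2.
  move=> uc cv; have [+ _] := equilibrium_triangle equ u1 cv (le_lt_trans uc u2).
  by rewrite subrr tan0 subr0 ru.
have hY1 : v - a <= x -> area (psec p u a rho) <=
    (rho v / r * r) ^+ 2 * (tan x - tan (v - a)) / 2 + r ^+ 2 * tan x / 2.
  rewrite krE => /px1 axv'.
  have axv : u <= u + x <= a by rewrite axv' andbT ltW.
  have -> := area_psec_cat p rc rg axv au2.
  have := tu (u + x) (lexx _) ux; rewrite uE => h2.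
  rewrite addrC; apply: lerD => //; move: axv'; rewrite le_eqVlt => /predU1P[<-|ax].
    by rewrite area_psec_empty -(opprB (u + x) v) uxa opprK subrr mulr0 mul0r.
  have [+ _] := equilibrium_triangle eqv v1 ax (le_lt_trans av v2).
  by rewrite uxa tanN -(opprB v a) tanN opprK (addrC (- tan _)).
have hY2 : x <= v - a -> area (psec p u a rho) <= r ^+ 2 * tan (2 * x - (v - a)) / 2.
  by move=> /px2 px; have := tu a px ua; rewrite vaE.
have [h1 h2] := sector_numbers x0 psi0 k01 r0 hX hY1 hY2.
rewrite vaE -gA -rA in h1 h2; split => // e; have [pz kz Yz] := h2 e.
have ruE : rho v = r by rewrite -krE kz mul1r.
split => //; have aE : a = v by apply/eqP; rewrite eq_sym -subr_eq0 pz.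
have [T1 T2] := equilibrium_triangle equ u1 ux u2.
have [T3 _] := equilibrium_triangle eqv v1 xv v2; rewrite uxa subrr tan0 sub0r tanN opprK ruE in T3.
rewrite uE subrr tan0 subr0 ru in T1 T2.
have := T2 (u + x); rewrite uE ru; apply; first by rewrite lexx ltW.
have axv : u <= u + x <= v by rewrite !ltW.
have := area_psec_cat p rc rg axv vu; rewrite aE in Yz; rewrite Yz.
exact: sum_tight T1 T3.
Qed.

(** On the side of the lower endpoint, the intermediate value theorem supplies the angle [a] at
    which [rho] reaches the higher stable radius; the shape of the peak gives the bounds before and
    after [a]. *)
Lemma sector_bound u v m : peak K p u v m -> equilibrium K p (bp u) -> equilibrium K p (bp v) ->
  v - u < pi -> rho u < rho m -> rho v < rho m -> let x := (v - u) / 2 in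
  let inner := area (psec p u v (fun t => Num.min (rho t) (Num.max (rho u) (rho v)))) in
  area (psec p u v rho) <= tan x / x * inner /\
  (area (psec p u v rho) = tan x / x * inner -> rho u = rho v /\ rho (u + x) * cos x = rho u).
Proof.
move=> pk equ eqv vup rum rvm; have [/andP[um mv] _ _ _] := pk.
have rc := rad_continuous Kb pK.
have [ruv|ruv] := leP (rho u) (rho v).
  have [a ami ra] : exists2 a, a \in `[u, m]%R & rho a = rho v.
    apply: IVT; [exact: ltW|exact: continuous_subspaceT|].
    by rewrite ge_min ruv /= le_max (ltW rvm) orbT.
  move: ami; rewrite in_itv /= => /andP[ua am].
  apply: (@sector_up_core u v a (rho v)) => //; first exact: le_lt_trans mv.
    move=> t ut ta; rewrite (peak_ge' pk) ?(le_trans ta) ?ut //= -ra.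
    exact: (peak_mono pk).
  move=> t at_ tv; have [tm|tm] := leP t m; first by rewrite -ra; exact: (peak_mono pk).
  by apply: (peak_ge pk); rewrite (ltW tm).
have [a ami ra] : exists2 a, a \in `[m, v]%R & rho a = rho u.
  apply: IVT; [exact: ltW|exact: continuous_subspaceT|].
  by rewrite ge_min (ltW ruv) orbT /= le_max (ltW rum).
move: ami; rewrite in_itv /= => /andP[ma av].
have lo t : a <= t -> t <= v -> rho v <= rho t <= rho u.
  move=> at_ tv; rewrite (peak_ge pk) ?(le_trans ma) ?tv //= -ra.
  exact: (peak_anti pk).
have hi t : u <= t -> t <= a -> rho u <= rho t.
  move=> ut ta; have [tm|tm] := leP m t; first by rewrite -ra; exact: (peak_anti pk).
  by apply: (peak_ge' pk); rewrite ut ltW.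
have [h1 h2] := sector_down_core equ eqv vup erefl (lt_le_trans um ma) av lo hi.
by split => // /h2[-> ->].
Qed.

(** Below [pi / 2] this is [sector_bound] solved for the cut. From [pi / 2] on the cosine is
    nonpositive, so [gain x] is at most 1, and the inequality is strict because the inner area is
    positive. *)
Lemma sector_gain u v m : peak K p u v m -> equilibrium K p (bp u) -> equilibrium K p (bp v) ->
  v - u < 2 * pi -> rho u < rho m -> rho v < rho m -> let x := (v - u) / 2 in
  let cut := area (psec p u v rho) -
    area (psec p u v (fun t => Num.min (rho t) (Num.max (rho u) (rho v)))) in
  cut * gain x <= area (psec p u v rho) /\
  (area (psec p u v rho) = cut * gain x ->
    [/\ x < pi / 2, rho u = rho v & rho (u + x) * cos x = rho u]).
Proof.
move=> pk equ eqv vu rum rvm x; have [/andP[um mv] _ _ _] := pk.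
have rc := rad_continuous Kb pK; have rg := rad_gt0 Kb pK; have pi0 := @pi_gt0 R.
have sb := sector_bound pk equ eqv; rewrite -/x in sb.
have i0 : 0 < area (psec p u v (fun t => Num.min (rho t) (Num.max (rho u) (rho v)))).
  set q := Num.min (rho u) (rho v); have q0 : 0 < q by rewrite lt_min !rg.
  have uv : u <= v <= u + 2 * pi by slra.
  have : 0 < area (psec p u v (cst q)).
    by rewrite area_sector // divr_gt0 // mulr_gt0 ?exprn_gt0 // subr_gt0; slra.
  move=> /lt_le_trans; apply; apply: area_psec_le.
  - exact: cst_cont.
  - by [].
  - by move=> t; apply: continuous_min; [exact: rc|exact: cvg_cst].
  - by move=> t; rewrite lt_min rg lt_max rg.
  move=> t /andP[ut tv] /=; rewrite le_min; apply/andP; split.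
    have [tm|tm] := leP t m.
      by rewrite ge_min (peak_ge' pk) ?ut.
    by rewrite ge_min (peak_ge pk) ?orbT // (ltW tm) ltW.
  by rewrite ge_min le_max lexx.
have x0 : 0 < x < pi by rewrite /x; slra.
have xp : x < pi / 2 -> v - u < pi by rewrite /x; slra.
have A0 := area_ge0 (psec p u v rho).
move: sb i0 A0; set A := area (psec p u v rho); set I := area _ => sb i0 A0 /=.
clearbody x A I.
have D0 := sub_mulcos_gt0 x0; have s0 : 0 < sin x by apply: sin_gt0_pi.
have [xh|xh] := ltP x (pi / 2).
  have [h1 h2] := sb (xp xh) rum rvm.
  have c0 : 0 < cos x by apply: cos_gt0; slra.
  have x00 : x != 0 by rewrite gt_eqF //; slra.
  have E : A - (A - I) * gain x = (tan x / x * I - A) * (x * cos x / (sin x - x * cos x)).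
    by rewrite /gain /tan; field; rewrite x00 !gt_eqF.
  have w0 : 0 < x * cos x / (sin x - x * cos x) by rewrite divr_gt0 // mulr_gt0 //; slra.
  split; first by rewrite -subr_ge0 E mulr_ge0 ?subr_ge0 // ltW.
  move=> e; have [|ru rux] := h2; last by split.
  apply/eqP; rewrite eq_sym -subr_eq0; move/eqP: e; rewrite -subr_eq0 E mulf_eq0.
  by rewrite (gt_eqF w0) orbF.
have g1 : 0 < gain x <= 1.
  rewrite /gain divr_gt0 //= ler_pdivrMr // mul1r lerBrDr gerDl.
  by rewrite pmulr_rle0 ?cos_le0_itv //; slra.
have {g1} st : (A - I) * gain x < A.
  have [AI|AI] := leP 0 (A - I).
    case/andP: g1 => g0 g1; apply: (@le_lt_trans _ _ (A - I)); first by rewrite ler_piMr.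
    by rewrite ltrBlDr ltrDl.
  case/andP: g1 => g0 _; apply: (@lt_le_trans _ _ 0); last exact: A0.
  by rewrite pmulr_llt0.
by split; [exact: ltW|move=> e; rewrite -e ltxx in st].
Qed.

End Sector.

(** * Regular polygons and robustness *)

Section HullAux.
Variable R : realType.

Lemma halfplane_convex (c w : R * R) (r : R) : convex_set [set z | dot (z - c) w <= r].
Proof.
apply: seg_convex_set => a b t /= ha hb /andP[t0 t1].
rewrite (_ : dot (seg a b t - c) w = (1 - t) * dot (a - c) w + t * dot (b - c) w); last first.
  by rewrite /dot /seg /=; ring.
have h1 : (1 - t) * dot (a - c) w <= (1 - t) * r by rewrite ler_wpM2l // subr_ge0.
have h2 : t * dot (b - c) w <= t * r by rewrite ler_wpM2l.
by lra.
Qed.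

Lemma cos_2pi_sub (a : R) : cos (2 * pi - a) = cos a.
Proof. by rewrite mulr_natl mulr2n -addrA addrC cosDpi addrC cosDpi opprK cosN. Qed.

Lemma dot_polB (p : R * R) s t u : dot (pol p s t - p) (cos u, sin u) = s * cos (t - u).
Proof. by rewrite /dot /pol /= cosB; ring. Qed.

Lemma ray_segment (p : R * R) X s t : X != 0 -> pol p s t = seg p (pol p X t) (s / X).
Proof. by move=> X0; rewrite /seg /pol /=; congr pair; field. Qed.

End HullAux.

Section RegularPolygon.
Variable R : realType.
Variables (n : nat) (c : R * R) (q phi : R).
Hypotheses (n3 : (3 <= n)%N) (q0 : 0 < q).

Local Notation y := (pi / n%:R : R).
Local Notation H := (convex_hull (regular_vertex (n := n) c q phi)).

(** Defined for all natural indices: the angles keep increasing past a full turn, which makes the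
    edge after the last vertex an ordinary one. *)
Definition vertex_angle (k : nat) : R := phi + k%:R * (2 * y).
Definition edge_angle (k : nat) : R := vertex_angle k + y.
Definition apothem : R := q * cos y.
Local Notation r := apothem.

Lemma half_central_itv : 0 < y < pi / 2 /\ n%:R * y = pi.
Proof.
have pi0 := @pi_gt0 R; have n0 : 0 < n%:R :> R by rewrite ltr0n (leq_trans _ n3).
rewrite divr_gt0 //= ltr_pM2l // ltf_pV2 ?posrE // ltr_nat; split=> //.
by rewrite mulrC divfK // gt_eqF.
Qed.

Lemma apothem_gt0 : 0 < r.
Proof. by have [/andP[y0 y1] _] := half_central_itv; rewrite mulr_gt0 // cos_gt0 //; lra. Qed.

Lemma vertex_angleS k : vertex_angle k.+1 = vertex_angle k + 2 * y.
Proof. by rewrite /vertex_angle -natr1; ring. Qed.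

Lemma vertex_angleDn k : vertex_angle (k + n) = vertex_angle k + 2 * pi.
Proof. have [_ E] := half_central_itv; rewrite /vertex_angle natrD.
by transitivity (phi + k%:R * (2 * y) + 2 * (n%:R * y)); [ring|rewrite E]. Qed.

Lemma vertex_angle0 : vertex_angle 0 = phi.
Proof. by rewrite /vertex_angle mul0r addr0. Qed.

Lemma regular_vertexE (k : 'I_n) : regular_vertex c q phi k = pol c q (vertex_angle k).
Proof. by rewrite /regular_vertex /pol /vertex_angle (mulrA 2). Qed.

Lemma vertex_in k : H (pol c q (vertex_angle k)).
Proof.
elim/ltn_ind: k => k IH; have [kn|kn] := ltnP k n.
  rewrite -[k]/(nat_of_ord (Ordinal kn)) -regular_vertexE; exact: hull_vertex.
by rewrite -(subnK kn) vertex_angleDn pol_2pi; apply: IH; rewrite ltn_subrL (leq_trans _ n3) // (leq_trans _ kn) // (leq_trans _ n3).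
Qed.

Lemma sector_exists t : phi <= t < phi + 2 * pi -> exists2 k, (k < n)%N &
  vertex_angle k <= t < vertex_angle k.+1.
Proof.
move=> tt; apply: param_arc => [i _|]; last first.
  by rewrite vertex_angle0 -[n]add0n vertex_angleDn vertex_angle0.
by have [/andP[y0 y1] _] := half_central_itv; rewrite vertex_angleS ltrDl mulr_gt0.
Qed.

Lemma edge_angle_near k t : vertex_angle k <= t <= vertex_angle k.+1 -> `|t - edge_angle k| <= y.
Proof. by rewrite vertex_angleS /edge_angle ler_norml; lra. Qed.

(** The crossing of the ray with the chord between vertices [k] and [k.+1]; for equal radii [q] the
    formula of [ray_cross] collapses to the polar equation of the edge. *)
Lemma edge_point_in k t : `|t - edge_angle k| <= y -> H (pol c (r / cos (t - edge_angle k)) t).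
Proof.
have [/andP[y0 y1] _] := half_central_itv.
set u := t - edge_angle k => uy; have [u1 u2] : - y <= u /\ u <= y by move: uy; rewrite ler_norml => /andP[].
have tE : t = edge_angle k + u by rewrite /u addrC subrK.
clearbody u.
have := ray_cross (@hull_convex _ _ _) (vertex_in k) (vertex_in k.+1) q0 q0
  (b := t) (t := vertex_angle k.+1).
rewrite vertex_angleS => /(_ ltac:(rewrite tE /edge_angle; lra) ltac:(lra)).
have -> : t - vertex_angle k = y + u by rewrite tE /edge_angle; ring.
have -> : vertex_angle k + 2 * y - t = y - u by rewrite tE /edge_angle; ring.
have -> : vertex_angle k + 2 * y - vertex_angle k = y + y by ring.
have s0 : 0 < sin y by apply: sin_gt0_pi; lra.
have c0 : 0 < cos u by apply: cos_gt0; lra.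
rewrite (_ : _ / _ = r / cos u) // /apothem !sinD sinN cosN.
rewrite ?cosN ?sinN; move: (sin y) (cos y) (sin u) (cos u) s0 c0 => a b d e a0 e0.
have a0' : a != 0 by rewrite gt_eqF.
have e0' : e != 0 by rewrite gt_eqF.
have E : q * (a * e + b * d) + q * (a * e + b * - d) = 2 * q * a * e by ring.
by rewrite E; field; rewrite e0' a0' gt_eqF.
Qed.

Lemma edge_cos_gt0 k t : `|t - edge_angle k| <= y -> 0 < cos (t - edge_angle k).
Proof.
have [/andP[y0 y1] _] := half_central_itv; rewrite ler_norml => h.
by apply: cos_gt0; lra.
Qed.

Lemma center_in : H c.
Proof.
have pi0 := @pi_gt0 R; have r0 := apothem_gt0.
have pos t : phi <= t < phi + 2 * pi -> exists2 X, 0 < X & H (pol c X t).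
  move=> /sector_exists[k kn /andP[k1 k2]].
  have tk : `|t - edge_angle k| <= y by apply: edge_angle_near; rewrite k1 ltW.
  exists (r / cos (t - edge_angle k)); last exact: edge_point_in.
  by rewrite divr_gt0 // edge_cos_gt0.
have [X X0 HX] := pos phi ltac:(lra).
have [Y Y0 HY] := pos (phi + pi) ltac:(lra).
have XY : X + Y != 0 by rewrite gt_eqF // addr_gt0.
suff : H (seg (pol c X phi) (pol c Y (phi + pi)) (X / (X + Y))).
  congr (H _); rewrite /seg /pol /= cosDpi sinDpi [RHS]surjective_pairing; congr pair; field => //.
apply: convex_set_seg HX HY _; first exact: hull_convex.
apply/andP; split; first by apply: divr_ge0; lra.
by rewrite ler_pdivrMr ?mul1r; lra.
Qed.

Lemma regular_in k s t : `|t - edge_angle k| <= y -> 0 <= s -> s * cos (t - edge_angle k) <= r ->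
  H (pol c s t).
Proof.
move=> tk s0 sr; have c0 := edge_cos_gt0 tk; have r0 := apothem_gt0.
have X0 : 0 < r / cos (t - edge_angle k) by rewrite divr_gt0.
rewrite (ray_segment c s t (lt0r_neq0 X0)).
apply: convex_set_seg => //; [exact: hull_convex|exact: center_in|exact: edge_point_in|].
apply/andP; split; first by rewrite divr_ge0 // ltW.
by rewrite ler_pdivrMr // mul1r ler_pdivlMr.
Qed.

(** Seen from the centre, vertex [j] and the normal of edge [k] are an odd multiple of [y] apart,
    between [y] and [2 * pi - y] in absolute value, so the cosine is at most [cos y]. *)
Lemma vertex_support k (j : 'I_n) : (k < n)%N ->
  dot (regular_vertex c q phi j - c) (cos (edge_angle k), sin (edge_angle k)) <= r.
Proof.
move=> kn; rewrite regular_vertexE dot_polB /apothem ler_pM2l //.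
have [/andP[y0 y1] yn] := half_central_itv; have pi0 := @pi_gt0 R.
have key m : (1 <= m)%N -> (m <= n.*2 - 1)%N -> cos (m%:R * y) <= cos y.
  move=> m1 m2; have h1 : y <= m%:R * y by rewrite ler_peMl ?ler1n // ltW.
  have h2 : m%:R * y <= 2 * pi - y.
    have -> : 2 * pi - y = (n.*2 - 1)%:R * y.
      rewrite natrB ?double_gt0 ?(leq_trans _ n3) // mulrBl mul1r -mul2n natrM.
      by rewrite -[2 * n%:R * _]mulrA yn.
    by rewrite ler_wpM2r ?ler_nat // ltW.
  have := @cos_min R (m%:R * y) ; 
  have [mp|mp] := leP (m%:R * y) pi.
    move=> _; move: h1; rewrite le_eqVlt => /predU1P[<-//|h1].
    by apply/ltW; rewrite ltr_cos // in_itv /=; lra.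
  move=> _; have -> : cos (m%:R * y) = cos (2 * pi - m%:R * y).
    by rewrite cos_2pi_sub.
  move: h2; rewrite lerBrDr -lerBrDl le_eqVlt => /predU1P[<-//|h2].
  by apply/ltW; rewrite ltr_cos // in_itv /=; lra.
have jn := ltn_ord j; rewrite /edge_angle /vertex_angle.
have [jk|jk] := leqP j k.
  have -> : phi + j%:R * (2 * y) - (phi + k%:R * (2 * y) + y) = - ((k - j).*2.+1%:R * y).
    have -> : (k - j).*2.+1%:R = 2 * (k%:R - j%:R) + 1 :> R.
      by rewrite -natr1 -mul2n natrM natrB.
    by ring.
  rewrite cosN; apply: key => //; lia.
have -> : phi + j%:R * (2 * y) - (phi + k%:R * (2 * y) + y) = ((j - k).*2.-1%:R * y).
  have E : ((j - k).*2.-1%:R + 1 = 2 * (j%:R - k%:R) :> R).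
    by rewrite natr1 prednK ?double_gt0 ?subn_gt0 // -mul2n natrM natrB // ltnW.
  have -> : (j - k).*2.-1%:R = 2 * (j%:R - k%:R) - 1 :> R by rewrite -E addrK.
  by ring.
apply: key => //; lia.
Qed.

Lemma regular_support k s t : (k < n)%N -> H (pol c s t) -> s * cos (t - edge_angle k) <= r.
Proof.
move=> kn; rewrite -(dot_polB c); apply: (hull_min (@halfplane_convex R c _ r)).
by move=> i; exact: vertex_support.
Qed.

Lemma center_interior : H° c.
Proof.
have r0 := apothem_gt0.
apply/nbhs_boxP; exists (r / 2) => [|z z1 z2]; first by lra.
have [t [s [tt s0 zE]]] := polar_exists c z phi.
have [k kn /andP[k1 k2]] := sector_exists tt.
rewrite zE; apply: (@regular_in k) => //; first by apply: edge_angle_near; rewrite k1 ltW.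
apply: (@le_trans _ _ s); first by rewrite ler_piMr // cos_le1.
have : s ^+ 2 <= r ^+ 2.
  rewrite -(dot_pol_self c s t) -zE /dot /= -!expr2.
  have sq x : `|x| < r / 2 -> x ^+ 2 <= (r / 2) ^+ 2.
    move=> xm; rewrite -(real_normK (num_real x)) ler_sqr ?nnegrE //; lra.
  have := sq _ z1; have := sq _ z2; set X := (z.1 - c.1) ^+ 2; set Y := (z.2 - c.2) ^+ 2.
  by have := exprn_gt0 2 r0; lra.
by rewrite ler_sqr ?nnegrE // ltW.
Qed.

Let Hb : convex_body H := hull_body center_interior.

Lemma regular_rad k t : (k < n)%N -> `|t - edge_angle k| <= y ->
  rad H c t = r / cos (t - edge_angle k).
Proof.
move=> kn tk; have c0 := edge_cos_gt0 tk; have r0 := apothem_gt0.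
apply/le_anti/andP; split.
  rewrite ler_pdivlMr //; apply: regular_support => //.
  by apply/(in_radP Hb center_interior) => //; apply/ltW/(rad_gt0 Hb center_interior).
apply: (rad_ge Hb center_interior); first by rewrite divr_ge0 // ltW.
exact: edge_point_in.
Qed.

Lemma rad_vertex k : (k < n)%N -> rad H c (vertex_angle k) = q.
Proof.
move=> kn; have [/andP[y0 y1] _] := half_central_itv.
have E : vertex_angle k - edge_angle k = - y by rewrite /edge_angle; ring.
rewrite (regular_rad kn) E ?normrN ?gtr0_norm // cosN /apothem mulfK // gt_eqF // cos_gt0 //; lra.
Qed.

Lemma rad_edge k : (k < n)%N -> rad H c (edge_angle k) = r.
Proof.
move=> kn; have [/andP[y0 y1] _] := half_central_itv.
by rewrite (regular_rad kn) subrr ?normr0 ?cos0 ?divr1 // ltW.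
Qed.

Lemma regular_only_nondegenerate : only_nondegenerate H c.
Proof.
apply: hull_only_nondegenerate; first exact: center_interior.
move=> k _ i ik; have := dot_sub_gt0 ik; rewrite !regular_vertexE.
have cs a := cos2Dsin2 a.
rewrite /dot /pol /=; set a := vertex_angle i; set b := vertex_angle k => h.
suff : q ^+ 2 * (cos a * cos b + sin a * sin b - (cos b ^+ 2 + sin b ^+ 2)) < 0.
  by congr (_ < 0); ring.
have : 0 < q ^+ 2 * (cos a ^+ 2 + sin a ^+ 2 + (cos b ^+ 2 + sin b ^+ 2) - 2 * (cos a * cos b + sin a * sin b)).
  by move: h; congr (0 < _); ring.
by rewrite !cs; lra.
Qed.

Lemma regular_ps : ps_convex_body H.
Proof. by split; [exact: Hb|exact: (hull_piecewise_smooth center_interior)]. Qed.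

Lemma edge_vertex_lt : r < q.
Proof.
have [/andP[y0 y1] _] := half_central_itv; have pi0 := @pi_gt0 R.
by rewrite /apothem gtr_pMr // cos_lt1 //; lra.
Qed.

(** At most [n] because local maxima of the radius are vertices, at least [n] because the radius
    dips at every edge midpoint. *)
Lemma regular_stable : has_stable_points H c n.
Proof.
have [/andP[y0 y1] _] := half_central_itv.
have [S Sn hS] : exists2 S, (S <= n)%N & has_stable_points H c S.
  apply: (stable_count_le Hb center_interior (P := regular_vertex c q phi)) => t tmax.
  by have [i _ iE] := hull_locmax_vertex center_interior tmax; exists i.
suff nS : (n <= S)%N.
  by have E : S = n by [apply/eqP; rewrite eqn_leq nS Sn]; move: hS; rewrite E.
have [_ Hs] := regular_ps.
apply: (stable_count_ge Hb center_interior (d := vertex_angle) (c := edge_angle) Hs regular_only_nondegenerate _ _ _ hS).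
- by move=> i _; rewrite vertex_angleS /edge_angle; lra.
- by rewrite -[n]add0n vertex_angleDn.
- move=> i iN; rewrite rad_edge // rad_vertex //; split; first exact: edge_vertex_lt.
  move: (iN); rewrite leq_eqVlt => /predU1P[->|iN']; last by rewrite rad_vertex // edge_vertex_lt.
  rewrite -[n]add0n vertex_angleDn rad_2pi rad_vertex ?edge_vertex_lt // (leq_trans _ n3) //.
Qed.

End RegularPolygon.

(** * The upper bound for the robustness and its equality case *)

Section UpperBound.
Local Open Scope card_scope.
Variable R : realType.
Variables (K : set (R * R)) (p : R * R).
Hypotheses (Kb : convex_body K) (pK : K° p).
Hypotheses (Ks : piecewise_smooth_boundary K) (Kn : only_nondegenerate K p).
Local Notation rho := (rad K p).
Local Notation bp := (bpt K p).
Local Notation st := (stang K p).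

Lemma stable_angle_exists S : has_stable_points K p S -> (0 < S)%N -> exists a, st a.
Proof.
move=> hS S0.
have hB : [set t | 0 <= t < 0 + 2 * pi /\ st t] #= `I_S.
  by apply: card_eq_trans hS; rewrite card_eq_sym; exact: stable_set_angles.
have [L [_ sL LP]] := sorted_enum hB.
have /LP[_ h] : nth 0 L 0 \in L by rewrite mem_nth // sL.
by exists (nth 0 L 0).
Qed.

Lemma area_psec_sum (f : R -> R) (th : nat -> R) N : continuous f -> (forall t, 0 < f t) ->
  (forall i, (i < N)%N -> th i <= th i.+1) -> th N <= th 0%N + 2 * pi ->
  area (psec p (th 0%N) (th N) f) = \sum_(i < N) area (psec p (th i) (th i.+1) f).
Proof.
move=> cf f0; elim: N => [_ _|N IH thi thN].
  by rewrite big_ord0 area_psec_empty.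
have h0N : th 0%N <= th N.
  have : forall k, (k <= N)%N -> th 0%N <= th k.
    by elim=> // k IHk kN; apply: le_trans (IHk (ltnW kN)) _; apply: thi; exact: ltnW.
  exact.
have hN := thi N (ltnSn N).
rewrite big_ord_recr /= -IH; first by apply: area_psec_cat; rewrite ?h0N.
- by move=> i iN; apply: thi; exact: ltnW.
- exact: le_trans thN.
Qed.

Variables (S : nat) (M : R).
Hypotheses (S3 : (3 <= S)%N) (hS : has_stable_points K p S)
  (M_le : forall K', fewer_stable K p K' -> M <= area (K `\` K')).

Lemma window_bound : exists th : nat -> R,
  [/\ th S = th 0%N + 2 * pi, forall i, (i < S)%N -> th i < th i.+1,
     forall i, (i <= S)%N -> st (th i) &
     forall i, (i < S)%N -> let x := (th i.+1 - th i) / 2 in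
       [/\ 0 < x < pi, M * gain x <= area (psec p (th i) (th i.+1) rho) &
         area (psec p (th i) (th i.+1) rho) = M * gain x ->
         [/\ x < pi / 2, rho (th i) = rho (th i.+1) & rho (th i + x) * cos x = rho (th i)]]].
Proof.
have S0 : (0 < S)%N by apply: leq_trans S3.
have [a sa] := stable_angle_exists hS S0.
have [th [th0 thS thi sth nth]] := stable_window Kb pK hS S0 sa.
exists th; split => //; first by rewrite thS th0.
move=> i iS x; have [m pk] := peak_exists Kb pK Ks Kn (sth i (ltnW iS)) (sth i.+1 iS) (thi i iS) (fun t => nth i t iS).
have [/andP[um mv] umax _ _] := pk.
have uv := thi i iS.
have sE j : (j <= S)%N -> equilibrium K p (bp (th j)) by move=> /sth[].
have strict j : (j <= S)%N -> j = i \/ j = i.+1 -> rho (th j) < rho (m).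
  move=> jS ji; have sm := stable_strict_min Kb pK (sth j jS).
  case: ji => jE; rewrite jE in sm jS *.
    have [c /andP[c1 c2] c3] := strict_min_right sm uv.
    by apply: (lt_le_trans c3); apply: umax; rewrite !ltW.
  have [c /andP[c1 c2] c3] := strict_min_left sm uv.
  by apply: (lt_le_trans c3); apply: umax; rewrite !ltW.
(* With at least three windows, all of positive length, no single one fills the turn. *)
have vu2 : th i.+1 - th i < 2 * pi.
  have mono := seq_mono_le thi.
  have h0 : th 0%N <= th i by apply: mono => //; exact: ltnW.
  have h1 : th i.+1 <= th S by exact: mono.
  rewrite thS -th0 in h1.
  have [i0|i0] := posnP i; last first.
    have : th 0%N < th i.
      apply: (@lt_le_trans _ _ (th 1%N)); first exact: thi.
      by apply: mono => //; exact: ltnW.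
    by lra.
  rewrite i0 ltrBlDl th0 -thS; apply: (@lt_le_trans _ _ (th 2%N)).
    by apply: thi; apply: leq_trans S3.
  by apply: mono => //; apply: leq_trans S3.
have x0 : 0 < x < pi by rewrite /x; lra.
have [h1 h2] := sector_gain Kb pK pk (sE i (ltnW iS)) (sE i.+1 iS) vu2
  (strict i (ltnW iS) (or_introl erefl)) (strict i.+1 iS (or_intror erefl)).
have hM := cut_bound Kb pK M_le Ks Kn hS (leq_trans (isT : (2 <= 3)%N) S3) (sth i (ltnW iS)) (sth i.+1 iS) uv (fun t => nth i t iS).
have g0 : 0 < gain x.
  by rewrite /gain divr_gt0 ?sub_mulcos_gt0 // sin_gt0_pi.
rewrite -/x in h1 h2.
have h3 := ler_wpM2r (ltW g0) hM.
split => //; first exact: le_trans h1.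
move=> e; apply: h2; apply/le_anti; rewrite h1 andbT.
by apply: le_trans h3; rewrite -e.
Qed.

(** Summing [window_bound] bounds [M] times the sum of the gains by the area, and [gain_jensen]
    bounds that sum from below, as the half angles add up to [pi]. Equality forces equal half angles
    and equality in every sector. *)
Lemma lower_bound_gain : 0 <= M ->
  M * (S%:R * gain (pi / S%:R)) <= area K /\
  (0 < M -> M * (S%:R * gain (pi / S%:R)) = area K ->
   exists a, forall i, (i <= S)%N -> [/\ st (a + i%:R * (2 * (pi / S%:R))),
     rho (a + i%:R * (2 * (pi / S%:R))) = rho a &
     rho (a + i%:R * (2 * (pi / S%:R)) + pi / S%:R) * cos (pi / S%:R) = rho a]).
Proof.
move=> M0; have rc := rad_continuous Kb pK; have rg := rad_gt0 Kb pK.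
have [th [thS thi sth thB]] := window_bound.
pose x (i : 'I_S) := (th i.+1 - th i) / 2.
have S2 : (2 <= S)%N by apply: leq_trans S3.
have sx : \sum_i x i = pi.
  rewrite /x -mulr_suml; have -> : \sum_(i < S) (th i.+1 - th i) = th S - th 0%N.
    by rewrite -(telescope_sumr th (leq0n S)) big_mkord.
  by rewrite thS addrAC subrr add0r mulrC mulKf.
have xI (i : 'I_S) : 0 < x i < pi by have [] := thB i (ltn_ord i).
have [J1 J2] := gain_jensen S2 xI sx.
have AE : area K = \sum_(i < S) area (psec p (th i) (th i.+1) rho).
  rewrite (area_body Kb pK (th 0%N)) -thS; apply: area_psec_sum => //; last by rewrite thS.
  by move=> i iS; exact/ltW/thi.
have B1 : M * \sum_i gain (x i) <= area K.
  rewrite AE mulr_sumr; apply: ler_sum => i _.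
  by have [] := thB i (ltn_ord i).
have B2 : M * (S%:R * gain (pi / S%:R)) <= M * \sum_i gain (x i) by rewrite ler_wpM2l.
split; first exact: le_trans B1.
move=> Mp e; rewrite e in B2.
have e1 : M * \sum_i gain (x i) = area K by apply/le_anti; rewrite B1.
have xE : forall i, x i = pi / S%:R.
  by apply: J2; apply: (mulfI (lt0r_neq0 Mp)); rewrite e1 e.
have e2 : \sum_(i < S) (area (psec p (th i) (th i.+1) rho) - M * gain (x i)) = 0.
  by rewrite sumrB -AE -mulr_sumr e1 subrr.
have eqi i : (i < S)%N -> [/\ rho (th i) = rho (th i.+1) &
    rho (th i + pi / S%:R) * cos (pi / S%:R) = rho (th i)].
  move=> iS; have [_ _] := thB i iS.
  have -> : (th i.+1 - th i) / 2 = pi / S%:R by rewrite -(xE (Ordinal iS)).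
  have h : area (psec p (th i) (th i.+1) rho) = M * gain (pi / S%:R).
    move/eqP: e2; rewrite psumr_eq0 => [|j _]; last first.
      by rewrite subr_ge0; have [] := thB j (ltn_ord j).
    move=> /allP /(_ (Ordinal iS) (mem_index_enum _)) /=.
    by rewrite xE subr_eq0 => /eqP.
  by move=> /(_ h)[_ h1 h2].
have thE i : (i <= S)%N -> th i = th 0%N + i%:R * (2 * (pi / S%:R)).
  elim: i => [_|i IH iS]; first by rewrite mul0r addr0.
  have := xE (Ordinal iS); rewrite /x /= => h.
  have -> : th i.+1 = th i + 2 * ((th i.+1 - th i) / 2) by field.
  by rewrite h IH 1?ltnW // -natr1; ring.
have rE i : (i <= S)%N -> rho (th i) = rho (th 0%N).
  elim: i => // i IH iS; have [h _] := eqi i iS.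
  by rewrite -h IH // ltnW.
exists (th 0%N) => i iS; rewrite -thE //; split.
- exact: sth.
- exact: rE.
move: iS; rewrite leq_eqVlt => /predU1P[->|iS].
  have [_ <-] := eqi 0%N (leq_trans (isT : (0 < 3)%N) S3).
  by rewrite thS addrAC rad_2pi.
by have [_ ->] := eqi i iS; rewrite rE // ltnW.
Qed.

(** The boundary points on the bisectors are the vertices of the polygon, so it lies in [K]; the
    supporting lines at the stable points are its edge lines, so it contains [K]. *)
Lemma extremal_regular a : (forall i, (i <= S)%N -> [/\ st (a + i%:R * (2 * (pi / S%:R))),
     rho (a + i%:R * (2 * (pi / S%:R))) = rho a &
     rho (a + i%:R * (2 * (pi / S%:R)) + pi / S%:R) * cos (pi / S%:R) = rho a]) ->
  K = convex_hull (regular_vertex (n := S) p (rho a / cos (pi / S%:R)) (a + pi / S%:R)).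
Proof.
move=> hK; set y := pi / S%:R in hK *; set q := rho a / cos y.
have [/andP[y0 y1] _] := @half_central_itv R S S3; rewrite -/y in y0 y1.
have c0 : 0 < cos y by apply: cos_gt0; lra.
have q0 : 0 < q by rewrite divr_gt0 // rad_gt0.
apply/seteqP; split; last first.
  have [_ Kc _] := Kb; apply: hull_min => // i; rewrite regular_vertexE.
  have [_ _ h] := hK i (ltnW (ltn_ord i)).
  apply/(in_radP Kb pK); first exact: ltW.
  rewrite /vertex_angle -/y addrAC /q -h mulfK ?gt_eqF //.
move=> z Kz; have [t [s [tt s0 zE]]] := polar_exists p z (a + y).
have [k kn /andP[k1 k2]] := sector_exists S3 tt.
have kt : `|t - edge_angle S (a + y) k| <= y by apply: edge_angle_near => //; rewrite k1 ltW.
rewrite zE; apply: (@regular_in R S p q (a + y) S3 q0 k s t kt s0); rewrite /apothem -/y divfK ?gt_eqF //.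
have [sk rk _] := hK k.+1 kn.
(* The stable angles are numbered from [a], but the polygon starts with the vertex at [a + y]; hence
   edge [k] faces the stable angle of index [k.+1]. *)
have eE : edge_angle S (a + y) k = a + k.+1%:R * (2 * y).
  by rewrite /edge_angle /vertex_angle -/y -natr1; ring.
have cg : 0 < cos (t - edge_angle S (a + y) k) by apply: cos_gt0; move: kt; rewrite ler_norml; lra.
apply: (@le_trans _ _ (rho t * cos (t - edge_angle S (a + y) k))).
  by rewrite ler_pM2r //; apply/(in_radP Kb pK) => //; rewrite -zE.
rewrite -rk eE; apply: (equilibrium_rad_le Kb pK); first by case: sk.
by rewrite -eE.
Qed.

End UpperBound.

(** * The centroid of a set invariant under a rotation *)

Section Centroid.
Variable R : realType.

Local Notation T1 := (measurableTypeR R).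
Local Notation T2 := (measurableTypeR R * measurableTypeR R)%type.
Local Notation lam := (@lebesgue_measure R).
Local Notation mu := (lam \x lam)%E.
Variable K : set (R * R).
Hypothesis cK : compact K.

Let mK : measurable (K : set T2) := compact_mes cK.

Lemma integrable_compact (f : T2 -> R) : measurable_fun setT f ->
  continuous (f : R * R -> R) -> mu.-integrable K (EFin \o f).
Proof.
move=> mf cf; apply: measurable_bounded_integrable.
- exact: mK.
- by have [] := compact_fmes cK.
- exact: measurable_funTS.
- have cfK : compact ((f : R * R -> R) @` K).
    by apply: continuous_compact => //; exact: continuous_subspaceT.
  have [M [Mr HM]] := compact_bounded cfK; exists M; split => // x Mx y Ky.
  by apply: (HM x Mx); exists y.
Qed.

Lemma integrable_fst : mu.-integrable K (EFin \o (fst : T2 -> R)).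
Proof. by apply: integrable_compact; [exact: measurable_fst|move=> x; exact: cvg_fst]. Qed.

Lemma integrable_snd : mu.-integrable K (EFin \o (snd : T2 -> R)).
Proof. by apply: integrable_compact; [exact: measurable_snd|move=> x; exact: cvg_snd]. Qed.

Lemma integrable_const a : mu.-integrable K (EFin \o (cst a : T2 -> R)).
Proof. by apply: integrable_compact; [exact: measurable_cst|move=> x; exact: cvg_cst]. Qed.

Local Notation I1 := (\int[mu]_(z in (K : set T2)) z.1).
Local Notation I2 := (\int[mu]_(z in (K : set T2)) z.2).

Lemma integral_affine a b d : \int[mu]_(z in (K : set T2)) (a + b * z.1 + d * z.2) =
  a * area K + b * I1 + d * I2.
Proof.
have i1 := integrableZl mK b integrable_fst.
have i2 := integrableZl mK d integrable_snd.
have i0 := integrable_const a.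
have i01 : mu.-integrable K (EFin \o (fun z : T2 => a + b * z.1)).
  exact: (integrableD mK i0 i1).
rewrite (RintegralD mK i01 i2) (RintegralD mK i0 i1).
by rewrite (RintegralZl _ mK integrable_fst) (RintegralZl _ mK integrable_snd) Rintegral_cst.
Qed.

Lemma integrable_affine a b d :
  mu.-integrable K (EFin \o (fun z : T2 => a + b * z.1 + d * z.2)).
Proof.
have i1 := integrableZl mK b integrable_fst.
have i2 := integrableZl mK d integrable_snd.
have i01 : mu.-integrable K (EFin \o (fun z : T2 => a + b * z.1)).
  exact: (integrableD mK (integrable_const a) i1).
exact: (integrableD mK i01 i2).
Qed.

(** The rotation preserves area and maps [K] onto itself, so [f] may be replaced by its composite
    with the rotation, which is affine. *)
Lemma integral_invariant (c : R * R) u (f : T2 -> R) a b d :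
  (forall z, K z <-> K (polar_map c c 1 u z)) -> measurable_fun setT f ->
  (forall z, f (polar_map c c 1 u z) = a + b * z.1 + d * z.2) ->
  \int[mu]_(z in (K : set T2)) f z = a * area K + b * I1 + d * I2.
Proof.
move=> KT mf fT; set T := polar_map c c 1 u : T2 -> T2.
have [mT sT] := scales_polar_map c c u (oner_neq0 R).
have TK : T @^-1` K = K by apply/seteqP; split => z; [exact: (KT z).2|exact: (KT z).1].
have fTE : f \o T = (fun z : T2 => a + b * z.1 + d * z.2) by apply/funext => z; exact: fT.
rewrite -integral_affine /Rintegral; congr fine.
rewrite (@eq_measure_integral _ _ _ _ (pushforward mu T)); last first.
  by move=> A mA _; rewrite /pushforward [RHS](sT A mA) expr1n invr1 mul1e.
have iT : mu.-integrable (T @^-1` K) ((EFin \o f) \o T).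
  by rewrite TK -[_ \o T]/(EFin \o (f \o T)) fTE; exact: integrable_affine.
have mEf : measurable_fun setT (EFin \o f) by exact: measurableT_comp.
rewrite (integral_pushforward mT mEf iT mK) TK.
by apply: eq_integral => z _; rewrite /= fT.
Qed.

(* The first moments about [c] form a vector fixed by a nontrivial rotation. *)
Lemma rotation_centroid (c : R * R) u : 0 < u < 2 * pi -> 0 < area K ->
  (forall z, K z <-> K (polar_map c c 1 u z)) -> centroid K = c.
Proof.
move=> u0 A0 KT.
have E1 : I1 = (c.1 - cos u * c.1 + sin u * c.2) * area K + cos u * I1 + - sin u * I2.
  by apply: (integral_invariant (c := c) (u := u)) => // z; rewrite /polar_map /=; ring.
have E2 : I2 = (c.2 - sin u * c.1 - cos u * c.2) * area K + sin u * I1 + cos u * I2.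
  by apply: (integral_invariant (c := c) (u := u)) => // z; rewrite /polar_map /=; ring.
rewrite /centroid [c]surjective_pairing.
rewrite -[X in (X / _, _)]/I1 -[X in (_, X / _)]/I2.
have cs := cos2Dsin2 u; have c1 := cos_lt1 u0.
move: I1 I2 (area K) E1 E2 A0 => J1 J2 A E1 E2 A0.
set M1 := J1 - c.1 * A; set M2 := J2 - c.2 * A.
have F1 : (1 - cos u) * M1 + sin u * M2 = 0 by rewrite /M1 /M2; lra.
have F2 : (1 - cos u) * M2 - sin u * M1 = 0 by rewrite /M1 /M2; lra.
(* The determinant of the linear system [F1], [F2] in the moments, nonzero because the rotation is
   nontrivial. *)
have D : (1 - cos u) ^+ 2 + sin u ^+ 2 != 0.
  by rewrite gt_eqF // ltr_wpDr ?sqr_ge0 // exprn_gt0 // subr_gt0.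
have Z1 : M1 = 0.
  apply: (mulIf D); rewrite mul0r.
  transitivity ((1 - cos u) * ((1 - cos u) * M1 + sin u * M2) - sin u * ((1 - cos u) * M2 - sin u * M1)).
    by ring.
  by rewrite F1 F2; ring.
have Z2 : M2 = 0.
  apply: (mulIf D); rewrite mul0r.
  transitivity (sin u * ((1 - cos u) * M1 + sin u * M2) + (1 - cos u) * ((1 - cos u) * M2 - sin u * M1)).
    by ring.
  by rewrite F1 F2; ring.
have -> : J1 = c.1 * A by apply/eqP; rewrite -subr_eq0; apply/eqP.
have -> : J2 = c.2 * A by apply/eqP; rewrite -subr_eq0; apply/eqP.
by rewrite !mulfK // gt_eqF.
Qed.

End Centroid.

Lemma stable_points_unique (R : realType) (K : set (R * R)) p S S' :
  has_stable_points K p S -> has_stable_points K p S' -> S = S'.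
Proof.
move=> h h'; have : (`I_S #= `I_S')%card by apply: card_eq_trans h'; rewrite card_eq_sym.
by move/card_eqPle; rewrite !card_le_II => -[h1 h2]; apply/eqP; rewrite eqn_leq h1.
Qed.

Lemma rad_le (R : realType) (K K' : set (R * R)) p t : convex_body K -> K° p ->
  convex_body K' -> K'° p -> K' `<=` K -> rad K' p t <= rad K p t.
Proof.
move=> Kb pK Kb' pK' KK; apply: (rad_ge Kb pK); first exact/ltW/rad_gt0.
by apply: KK; apply/(in_radP Kb' pK') => //; exact/ltW/rad_gt0.
Qed.

(** * The lower bound for regular polygons *)

Section RegularPolygonRobustness.
Variable R : realType.
Variables (n : nat) (c : R * R) (q phi : R).
Hypotheses (n3 : (3 <= n)%N) (q0 : 0 < q).

Local Notation y := (pi / n%:R : R).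
Local Notation H := (convex_hull (regular_vertex (n := n) c q phi)).
Local Notation r := (apothem n q).
Local Notation va := (vertex_angle n phi).
Local Notation ea := (edge_angle n phi).
Local Notation rho := (rad H c).

Let Hi : H° c := center_interior c phi n3 q0.
Let Hb : convex_body H := hull_body Hi.
Let r0 : 0 < r := apothem_gt0 n3 q0.
Let rc : continuous rho := rad_continuous Hb Hi.
Let rg : forall t, 0 < rho t := rad_gt0 Hb Hi.

Lemma edge_angleS k : ea k.+1 = ea k + 2 * y.
Proof. by rewrite /edge_angle vertex_angleS; ring. Qed.

Lemma edge_angleDn k : ea (k + n) = ea k + 2 * pi.
Proof. by rewrite /edge_angle vertex_angleDn // addrAC. Qed.

Lemma regular_rad_all k t : `|t - ea k| <= y -> rho t = r / cos (t - ea k).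
Proof.
elim/ltn_ind: k t => k IH t; have [kn|kn] := ltnP k n; first exact: regular_rad.
rewrite -(subnK kn) edge_angleDn opprD addrA -[t in rho t](subrK (2 * pi)) rad_2pi.
rewrite addrAC => tk; apply: IH => //.
by rewrite ltn_subrL (leq_trans _ n3) // (leq_trans _ kn) // (leq_trans _ n3).
Qed.

Lemma regular_rotate z : H z <-> H (polar_map c c 1 (2 * y) z).
Proof.
have [t [s [tt s0 ->]]] := polar_exists c z phi.
have [k kn /andP[k1 k2]] := sector_exists n3 tt.
have uk : `|t - ea k| <= y by apply: edge_angle_near => //; rewrite k1 ltW.
have E : t + 2 * y - ea k.+1 = t - ea k by rewrite edge_angleS; ring.
have rE : rho (t + 2 * y) = rho t by rewrite (regular_rad_all uk) (@regular_rad_all k.+1) E.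
by rewrite polar_map_pol mul1r !(in_radP Hb Hi) // rE.
Qed.

Lemma regular_sector k a b : ea k - y <= a -> a <= b -> b <= ea k + y ->
  area (psec c a b rho) = r ^+ 2 * (tan (b - ea k) - tan (a - ea k)) / 2.
Proof.
move=> ka ab bk; have [/andP[y0 y1] _] := @half_central_itv R n n3.
have [f [cf f0 fE <-]] := @area_triangle R c r a b (ea k) r0 ltac:(lra) ab ltac:(lra).
congr area; apply: psec_eq => t /andP[at_ tb].
have tab : a <= t <= b by rewrite at_ ltW.
rewrite fE //; apply: regular_rad_all; rewrite ler_norml; lra.
Qed.

Lemma regular_area : area H = n%:R * (r ^+ 2 * tan y).
Proof.
have [/andP[y0 y1] _] := @half_central_itv R n n3.
have vn : va n = va 0%N + 2 * pi by rewrite -[n in LHS]add0n vertex_angleDn.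
rewrite (area_body Hb Hi (va 0%N)) -vn area_psec_sum //; last by rewrite vn.
  rewrite (eq_bigr (fun=> r ^+ 2 * tan y)) ?sumr_const ?card_ord ?mulr_natl // => i _.
  rewrite (@regular_sector i) /edge_angle ?vertex_angleS; try lra.
  have -> : va i + 2 * y - (va i + y) = y by ring.
  have -> : va i - (va i + y) = - y by ring.
  by rewrite tanN; field.
by move=> i _; rewrite vertex_angleS; lra.
Qed.

Lemma tan_gt0 : 0 < tan y.
Proof. by have [yI _] := @half_central_itv R n n3; have := tan_gt_id yI; lra. Qed.

Lemma regular_area_gt0 : 0 < area H.
Proof.
rewrite regular_area; apply: mulr_gt0; first by rewrite ltr0n (leq_trans _ n3).
by rewrite mulr_gt0 ?exprn_gt0 ?tan_gt0.
Qed.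

Lemma regular_centroid : centroid H = c.
Proof.
have [/andP[y0 y1] _] := @half_central_itv R n n3; have pi0 := @pi_gt0 R.
have [cH _ _] := Hb; have uI : 0 < 2 * y < 2 * pi by lra.
exact: (rotation_centroid cH uI regular_area_gt0 regular_rotate).
Qed.

Lemma regular_class : stable_class n H.
Proof.
rewrite /stable_class /= regular_centroid; split.
- exact: regular_ps.
- exact: regular_only_nondegenerate.
- exact: regular_stable.
Qed.

(** Between the directions of two consecutive edge midpoints the polygon is a kite of area
    [r ^+ 2 * tan y]. If [K'] stayed within the incircle there, the whole tip beyond it, of area
    [r ^+ 2 * (tan y - y)], would be cut off. *)
Lemma vertex_sector_exceeds K' k : convex_body K' -> K'° c -> K' `<=` H ->
  area (H `\` K') < r ^+ 2 * (tan y - y) ->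
  exists2 d, ea k < d < ea k.+1 & r < rad K' c d.
Proof.
move=> Kb' pK' K'H small; have [/andP[y0 y1] _] := @half_central_itv R n n3; have pi0 := @pi_gt0 R.
apply: contrapT => nex.
have eSk := edge_angleS k.
(* The left midpoint direction belongs to the half-open sector but is not a candidate for [d]; there
   the bound comes from the inclusion of [K'] in the polygon. *)
have small' t : ea k <= t < ea k.+1 -> rad K' c t <= r.
  move=> /andP[]; rewrite le_eqVlt => /predU1P[<- _|t1 t2].
    apply: (le_trans (rad_le _ Hb Hi Kb' pK' K'H)).
    by rewrite (@regular_rad_all k) subrr ?cos0 ?divr1 // normr0 ltW.
  by rewrite leNgt; apply/negP => h; apply: nex; exists t; rewrite ?t1.
have vS : va k.+1 = ea k + y by rewrite vertex_angleS /edge_angle; ring.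
have half t : ea k <= t <= ea k.+1 -> r <= rho t.
  have ge j : `|t - ea j| <= y -> r <= rho t.
    move=> tj; rewrite (regular_rad_all tj) ler_pdivlMr ?edge_cos_gt0 //.
    by rewrite ler_piMr ?cos_le1 // ltW.
  move=> tt; have [tv|tv] := leP t (va k.+1).
    by apply: (ge k); rewrite ler_norml; lra.
  by apply: (ge k.+1); rewrite ler_norml; lra.
have cI : ea k <= ea k.+1 <= ea k + 2 * pi by lra.
have A1 : area (psec c (ea k) (ea k.+1) rho) = r ^+ 2 * tan y.
  have vI : ea k <= va k.+1 <= ea k.+1 by lra.
  rewrite (area_psec_cat c rc rg vI); last by case/andP: cI.
  rewrite (@regular_sector k) ?(@regular_sector k.+1); try lra.
  have -> : va k.+1 - ea k = y by rewrite vS; ring.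
  have -> : va k.+1 - ea k.+1 = - y by rewrite vS edge_angleS; ring.
  by rewrite !subrr tan0 tanN; field.
have A2 := area_sector c r0 cI.
have fP := psec_fmes c (ea k) (ea k.+1) rc rg.
have fQ := psec_fmes c (ea k) (ea k.+1) (@cst_cont R r) (fun=> r0).
have QP : psec c (ea k) (ea k.+1) (cst r) `<=` psec c (ea k) (ea k.+1) rho.
  by apply: psec_sub => t /andP[t1 t2]; apply: half; rewrite t1 ltW.
have AD := areaD fP (fmesW fQ) QP.
have [cH _ _] := Hb; have [cK' _ _] := Kb'.
have mD : mes (H `\` K') by apply: measurableD; apply: fmesW; exact: compact_fmes.
have fD : fmes (H `\` K') by apply: (fmes_sub mD (compact_fmes cH)) => z [].
have mPQ : mes (psec c (ea k) (ea k.+1) rho `\` psec c (ea k) (ea k.+1) (cst r)).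
  by apply: measurableD; exact: fmesW.
have : area (psec c (ea k) (ea k.+1) rho `\` psec c (ea k) (ea k.+1) (cst r)) <= area (H `\` K').
  apply: area_le => // z [[t [s [tt /andP[s0 sr] ->]]] nQ]; split.
    by apply/(in_radP Hb Hi) => //; exact: ltW.
  move=> /(in_radP Kb' pK' _ (ltW s0)) s1; apply: nQ; exists t, s; split => //.
  by rewrite s0 (le_trans s1) // small'.
rewrite AD A1 A2; have -> : ea k.+1 - ea k = 2 * y by rewrite eSk; ring.
move: small; move: (area _) => A; rewrite mulrBr => s1 s2.
have E (a b : R) : a * (2 * b) / 2 = a * b by field.
by have := le_lt_trans s2 s1; rewrite E ltxx.
Qed.

(** The directions found near the vertices alternate with the edge midpoints, where [K'] has radius
    at most [r]; between any two consecutive ones lies a minimum, so [K'] has at least [n] stable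
    points. *)
Lemma regular_cut_ge K' : fewer_stable H c K' -> r ^+ 2 * (tan y - y) <= area (H `\` K').
Proof.
move=> [[Kb' Ks'] K'H pK' Kn' [S [S' [hS hS' SS]]]].
rewrite leNgt; apply/negP => small.
have Sn := stable_points_unique hS (regular_stable c phi n3 q0); rewrite Sn in SS.
have [d dP] := choice (fun k => let: ex_intro2 d h1 h2 := vertex_sector_exceeds k Kb' pK' K'H small in
  ex_intro (fun d => ea k < d < ea k.+1 /\ r < rad K' c d) d (conj h1 h2)).
(* Index [n] is the direction [d 0] one turn later, since the unconstrained choice of [d n] need not
   agree with it. *)
pose d' k := if k == n then d 0%N + 2 * pi else d k.
have n0 : (0 < n)%N by apply: leq_trans n3.
have d'S i : (i < n)%N -> ea i.+1 < d' i.+1 /\ r < rad K' c (d' i.+1).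
  move=> iN; rewrite /d'; case: eqP => [->|_].
    rewrite rad_2pi -[n]add0n edge_angleDn ltrD2r.
    by have [/andP[]] := dP 0%N.
  by have [/andP[]] := dP i.+1.
have d'E i : (i < n)%N -> d' i = d i by move=> iN; rewrite /d' ltn_eqF.
have le_edge i : rad K' c (ea i) <= r.
  apply: (le_trans (rad_le _ Hb Hi Kb' pK' K'H)).
  rewrite (@regular_rad_all i) subrr ?cos0 ?divr1 // normr0.
  by have [/andP[y0 y1] _] := @half_central_itv R n n3; exact: ltW.
have := @stable_count_ge R K' c Kb' pK' n d' (fun i => ea i.+1) S' Ks' Kn'.
have h1 i : (i < n)%N -> d' i < ea i.+1 < d' i.+1.
  by move=> iN; have [-> _] := d'S i iN; rewrite d'E // andbT; have [/andP[]] := dP i.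
have h2 : d' n = d' 0%N + 2 * pi by rewrite /d' eqxx ltn_eqF.
move=> /(_ h1 h2) h3; have : (n <= S')%N.
  apply: h3 => // i iN; have [_ h] := d'S i iN.
  by split; [rewrite d'E //; have [_] := dP i; exact: le_lt_trans|exact: le_lt_trans h].
by rewrite leqNgt SS.
Qed.

End RegularPolygonRobustness.

(** * The value of the supremum and the extremal bodies *)

Section ExternalRobustness.
Variable R : realType.
Implicit Types (K : set (R * R)).

Definition max_value (S : nat) : R := (tan (pi / S%:R) - pi / S%:R) / (S%:R * tan (pi / S%:R)).

Lemma body_area_gt0 K : convex_body K -> 0 < area K.
Proof.
move=> Kb; have [_ _ [p pK]] := Kb; have pi0 := @pi_gt0 R.
have rc := rad_continuous Kb pK; have rg := rad_gt0 Kb pK.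
rewrite (area_body Kb pK 0).
have [||m _ mP] := @EVT_min R (rad K p) 0 (0 + 2 * pi); [lra|exact: continuous_subspaceT|].
have : 0 < area (psec p 0 (0 + 2 * pi) (cst (rad K p m))).
  rewrite (area_sector p (rg m)) ?lexx ?andbT ?lerDl ?mulr_ge0 ?pi_ge0 //.
  by rewrite addrAC subrr add0r divr_gt0 // mulr_gt0 ?exprn_gt0 ?mulr_gt0.
move=> /lt_le_trans; apply; apply: area_psec_le => //; [exact: cst_cont|by move=> t; exact: rg|].
by move=> t /andP[t1 t2]; apply: mP; rewrite in_itv /= t1 ltW.
Qed.

Lemma gainE S : (3 <= S)%N ->
  S%:R * gain (pi / S%:R) = (max_value S)^-1 /\ 0 < max_value S :> R.
Proof.
move=> S3; have [/andP[y0 y1] _] := @half_central_itv R S S3.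
have S0 : 0 < S%:R :> R by rewrite ltr0n (leq_trans _ S3).
rewrite /max_value /gain; set y := pi / S%:R in y0 y1 *.
have ty := tan_gt_id (introT andP (conj y0 y1)).
have c0 : 0 < cos y by apply: cos_gt0; lra.
have s0 : 0 < sin y by apply: sin_gt0_pi; have := @pi_gt0 R; lra.
have tE : tan y = sin y / cos y by [].
have d0 : 0 < sin y - y * cos y.
  by move: ty; rewrite tE ltr_pdivlMr // subr_gt0.
split; last first.
  by rewrite divr_gt0 ?subr_gt0 // mulr_gt0 // (lt_trans y0).
rewrite tE; clearbody y; move: S%:R (sin y) (cos y) S0 s0 c0 d0 {ty tE y1} => n s k n0 s0 k0 d0.
have sn : s != 0 by rewrite gt_eqF.
have kn : k != 0 by rewrite gt_eqF.
have nn : n != 0 by rewrite gt_eqF.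
have dn : s - y * k != 0 by rewrite gt_eqF.
have -> : s / k - y = (s - y * k) / k by field.
by move: (s - y * k) dn => d dn; field; rewrite ?sn ?kn ?nn ?dn.
Qed.

(** Without competitors every number would be an admissible [M] in [lower_bound_gain]; the choice
    [(area K + 1) * max_value S] then contradicts its conclusion. So the infimum is taken over a
    nonempty set. *)
Lemma robustness_inf K S p : ps_convex_body K -> only_nondegenerate K p ->
  has_stable_points K p S -> (3 <= S)%N -> K° p ->
  [/\ 0 <= inf [set area (K `\` K') | K' in fewer_stable K p],
      fewer_stable K p !=set0 &
      forall K', fewer_stable K p K' -> inf [set area (K `\` K') | K' in fewer_stable K p] <= area (K `\` K')].
Proof.
move=> [Kb Ks] Kn hS S3 pK; have A0 := body_area_gt0 Kb.
have [gE v0] := gainE S3.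
have lbA : lbound [set area (K `\` K') | K' in fewer_stable K p] 0.
  by move=> _ [K' _ <-]; exact: area_ge0.
have ne : fewer_stable K p !=set0.
  apply: contrapT => ne.
  have M0 : 0 <= (area K + 1) * max_value S by rewrite mulr_ge0 // ltW //; lra.
  have [] := @lower_bound_gain R K p Kb pK Ks Kn S _ S3 hS _ M0.
    by move=> K' fK; exfalso; apply: ne; exists K'.
  by rewrite gE mulfK ?gt_eqF //; lra.
split => //.
  by apply: lb_le_inf => //; case: ne => K' fK; exists (area (K `\` K')); exists K'.
by move=> K' fK; apply: ge_inf; [exists 0|exists K'].
Qed.

Lemma ext_robustness_bound S K : (3 <= S)%N -> stable_class S K ->
  ext_robustness K (centroid K) <= max_value S /\
  (ext_robustness K (centroid K) = max_value S -> regular_polygon S K).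
Proof.
move=> S3 [Kps Kn hS]; have [gE v0] := gainE S3.
have [Kb Ks] := Kps; have A0 := body_area_gt0 Kb; set p := centroid K in Kn hS *.
(* If the centroid were not interior, there would be no competitor and the robustness would be 0,
   the conventional infimum of the empty set, which is below [max_value S]. *)
have [pK|npK] := pselect (K° p); last first.
  have e0 : [set area (K `\` K') | K' in fewer_stable K p] = set0.
    apply/seteqP; split => // x [K' [_ K'K K'p _ _] _]; apply: npK.
    exact: (interiorS K'K).
  have -> : ext_robustness K p = 0 by rewrite /ext_robustness e0 inf0 mul0r.
  by split; [exact: ltW|move=> e; move: v0; rewrite -e ltxx].
have [I0 ne ile] := robustness_inf Kps Kn hS S3 pK.
have [B1 B2] := lower_bound_gain Kb pK Ks Kn S3 hS ile I0.
rewrite /ext_robustness; move: I0 B1 B2 {ile}; set I := inf _ => I0 B1 B2.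
rewrite gE ler_pdivrMr // in B1 B2.
split; first by rewrite ler_pdivrMr // mulrC.
move=> e; have IE : I = max_value S * area K by rewrite -e divfK // gt_eqF.
have Ip : 0 < I by rewrite IE mulr_gt0.
have [|a aP] := B2 Ip; first by rewrite IE mulrAC mulfV ?mul1r // gt_eqF.
have KE := extremal_regular Kb pK S3 aP.
have [/andP[y0 y1] _] := @half_central_itv R S S3.
exists p, (rad K p a / cos (pi / S%:R)), (a + pi / S%:R); split => //.
by rewrite divr_gt0 ?rad_gt0 // cos_gt0 //; lra.
Qed.

Lemma regular_robustness S K : (3 <= S)%N -> regular_polygon S K ->
  stable_class S K /\ ext_robustness K (centroid K) = max_value S.
Proof.
move=> S3 [c [q [phi [q0 KE]]]].
have cl : stable_class S K by rewrite KE; exact: regular_class.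
split => //; apply/le_anti; have [-> _] := ext_robustness_bound S3 cl => /=.
have cE : centroid K = c by rewrite KE; exact: regular_centroid.
have [Kps Kn hS] := cl; rewrite cE in Kn hS *.
have pK : K° c by rewrite KE; exact: center_interior.
have [_ ne _] := robustness_inf Kps Kn hS S3 pK.
have AE : area K = S%:R * (apothem S q ^+ 2 * tan (pi / S%:R)) by rewrite KE regular_area.
have [Kb _] := Kps; have A0 := body_area_gt0 Kb.
rewrite /ext_robustness ler_pdivlMr //.
have -> : max_value S * area K = apothem S q ^+ 2 * (tan (pi / S%:R) - pi / S%:R).
  have t0 := @tan_gt0 R S S3; have S0 : 0 < S%:R :> R by rewrite ltr0n (leq_trans _ S3).
  rewrite AE /max_value; move: S%:R (pi / S%:R) (tan (pi / S%:R)) (apothem S q) t0 S0 => n y t r t0 n0.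
  by field; rewrite !gt_eqF.
apply: lb_le_inf; first by case: ne => K' fK; exists (area (K `\` K')); exists K'.
by move=> _ [K' fK <-]; rewrite KE in fK *; exact: regular_cut_ge fK.
Qed.

Lemma regular_polygon_nonempty S : (regular_polygon S : set (set (R * R))) !=set0.
Proof. by exists (convex_hull (regular_vertex (n := S) 0 1 0)), 0, 1, 0. Qed.

Lemma max_ext_robustnessE S : (3 <= S)%N -> max_ext_robustness R S = max_value S.
Proof.
move=> S3; apply/le_anti/andP; split.
  apply: ge_sup; last by move=> _ [K KS <-]; have [] := ext_robustness_bound S3 KS.
  have [K /(regular_robustness S3)[KS _]] := regular_polygon_nonempty S.
  by exists (ext_robustness K (centroid K)); exists K.
have [K /(regular_robustness S3)[KS <-]] := regular_polygon_nonempty S.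
apply: ub_le_sup; last by exists K.
by exists (max_value S) => _ [K' KS' <-]; have [] := ext_robustness_bound S3 KS'.
Qed.

End ExternalRobustness.

Theorem corollary1 (R : realType) (S : nat) (hS : (3 <= S)%N) :
  max_ext_robustness R S =
    (tan (pi / S%:R) - pi / S%:R) / (S%:R * tan (pi / S%:R)) /\
  (forall K : set (R * R),
     (stable_class S K /\
      ext_robustness K (centroid K) = max_ext_robustness R S) <->
     regular_polygon S K).
Proof.
rewrite (max_ext_robustnessE R hS); split => // K; split.
  by move=> [KS]; have [_] := ext_robustness_bound hS KS.
exact: regular_robustness.
Qed.
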